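(* Let $n,d\ge1$ be integers. Take a complete probability space with a countably generated filtration $\mathcal H_0\subseteq\cdots\subseteq\mathcal H_n$, supporting $\mathbb R^d$-valued square-integrable random vectors $X_1,\ldots,X_n$ such that $X_i$ is $\mathcal H_i$-measurable with $\mathbb E[X_i\mid\mathcal H_{i-1}]=0$ for $1\le i\le n$. Let $S=\sum_{i=1}^nX_i$, let $\Sigma$ be a non-random positive semi-definite $d\times d$ matrix, let $V_i=\mathrm{Var}[X_i\mid\mathcal H_{i-1}]$ and $\Omega=\sum_{i=1}^nV_i-\Sigma$, and let $T\sim\mathcal N(0,\Sigma)$. Then for any class $\mathcal A$ of measurable subsets of $\mathbb R^d$, $$\sup_{A\in\mathcal A}\big|\mathbb P(S\in A)-\mathbb P(T\in A)\big|\le\inf_{p\in[1,\infty]}\inf_{\eta>0}\big\{\Gamma_p(\eta)+\Delta_p(\mathcal A,\eta)\big\},$$ where $$\Gamma_p(\eta)=24\left(\frac{\beta_{p,2}\,\phi_p(d)^2}{\eta^3}\right)^{1/3}+17\left(\frac{\mathbb E[\|\Omega\|_2]\,\phi_p(d)^2}{\eta^2}\right)^{1/3},$$ $$\Delta_p(\mathcal A,\eta)=\sup_{A\in\mathcal A}\max\big\{\mathbb P(T\in A_p^\eta\setminus A),\ \mathbb P(T\in A\setminus A_p^{-\eta})\big\}.$$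
   Context: $A_p^\eta=\{x\in\mathbb R^d:\|x-A\|_p\le\eta\}$, $A_p^{-\eta}=\mathbb R^d\setminus(\mathbb R^d\setminus A)_p^\eta$, $\|x-A\|_p=\inf_{x'\in A}\|x-x'\|_p$, with $\|\cdot\|_p$ the $\ell_p$-norm. For $p\in[1,\infty)$, $\phi_p(d)=\sqrt{p\,d^{2/p}}$, and $\phi_\infty(d)=\sqrt{2\log2d}$. $$\beta_{p,2}=\sum_{i=1}^n\mathbb E\big[\|X_i\|_2^2\|X_i\|_p+\|V_i^{1/2}Z_i\|_2^2\|V_i^{1/2}Z_i\|_p\big]$$ with $Z_1,\ldots,Z_n$ i.i.d. $\mathcal N(0,I_d)$ independent of $\mathcal H_n$. $\|\Omega\|_2$ is the $\ell_2$ operator norm, $A^{1/2}$ of a matrix is the positive semi-definite square root, and $\mathrm{Var}[\cdot\mid\mathcal H]$ is the conditional covariance matrix. *)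

(* Defs.v *)
From HB Require Import structures.
From mathcomp Require Import all_boot all_order all_algebra.
From mathcomp Require Import all_classical all_reals all_analysis.

Set Implicit Arguments.
Unset Strict Implicit.
Unset Printing Implicit Defensive.

Import Order.TTheory GRing.Theory Num.Theory.
Import numFieldNormedType.Exports.

Local Open Scope classical_set_scope.
Local Open Scope ring_scope.

(* Matrices, hence vectors of R^d = 'cV[R]_d, carry their Borel sigma-algebra. *)
HB.instance Definition _ (R : realType) (m n : nat) :=
  Measurable.copy 'M[R]_(m, n) (g_sigma_algebraType (@open 'M[R]_(m, n))).

Section LinearAlgebra.
Context {R : realType} {d : nat}.

(* Only used for 1 <= p <= +oo; the value at -oo is a dummy. *)
Definition lpnorm (p : \bar R) (x : 'cV[R]_d) : R :=
  match p with
  | r%:E => (\sum_(i < d) `|x i 0| `^ r) `^ r^-1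
  | +oo%E => \big[Num.max/0]_(i < d) `|x i 0|
  | -oo%E => 0
  end.

Definition opnorm2 (M : 'M[R]_d) : R :=
  sup [set lpnorm 2%:E (M *m x) | x in [set x | lpnorm 2%:E x <= 1]].

Definition psdmx (M : 'M[R]_d) : Prop :=
  M^T = M /\ forall u : 'cV[R]_d, 0 <= (u^T *m M *m u) 0 0.

(* The square root is unique when M is positive semi-definite; otherwise the
   value is 0 (a version of a conditional covariance matrix may fail to be
   positive semi-definite on a null set). *)
Definition psd_sqrt (M : 'M[R]_d) : 'M[R]_d :=
  xget 0 [set B | psdmx B /\ B *m B = M].

(* The infimum is +oo when A is empty, so that the enlargement of set0 is
   set0 and the contraction of setT is setT. *)
Definition dist_set (p : \bar R) (x : 'cV[R]_d) (A : set 'cV[R]_d) : \bar R :=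
  ereal_inf [set (lpnorm p (x - y))%:E | y in A].

Definition enlarge (p : \bar R) (eta : R) (A : set 'cV[R]_d) : set 'cV[R]_d :=
  [set x | (dist_set p x A <= eta%:E)%E].

Definition shrink (p : \bar R) (eta : R) (A : set 'cV[R]_d) : set 'cV[R]_d :=
  ~` enlarge p eta (~` A).

End LinearAlgebra.

Definition phi {R : realType} (p : \bar R) (d : nat) : R :=
  match p with
  | r%:E => Num.sqrt (r * d%:R `^ (2 / r))
  | +oo%E => Num.sqrt (2 * ln (2 * d%:R))
  | -oo%E => 0
  end.

Section Probability.
Context {R : realType} {dsp : measure_display} {Omega : measurableType dsp}.
Variable P : probability Omega R.

Definition countably_generated (F : set (set Omega)) : Prop :=
  exists2 G : set (set Omega), countable G & F = <<s G >>.

(* The values H_i for i > n play no role. *)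
Definition filtration (n : nat) (H : nat -> set (set Omega)) : Prop :=
  (forall i, (i <= n)%N -> sigma_algebra setT (H i) /\ H i `<=` measurable) /\
  (forall i, (i < n)%N -> H i `<=` H i.+1).

Definition measurable_wrt {dsp' : measure_display} {T : measurableType dsp'}
    (F : set (set Omega)) (f : Omega -> T) : Prop :=
  forall B, measurable B -> F (f @^-1` B).

(* Y is a version of E[X | F]; for matrices this is understood entrywise. *)
Definition is_cond_exp {m n : nat} (F : set (set Omega))
    (X Y : Omega -> 'M[R]_(m, n)) : Prop :=
  forall i j,
  [/\ P.-integrable setT (fun w => (X w i j)%:E),
      P.-integrable setT (fun w => (Y w i j)%:E),
      measurable_wrt F (fun w => Y w i j) &
      forall A, F A ->
        (\int[P]_(w in A) (Y w i j)%:E = \int[P]_(w in A) (X w i j)%:E)%E].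

(* V is a version of Var[X | F]; M is a version of E[X | F]. *)
Definition is_cond_cov {d : nat} (F : set (set Omega))
    (X : Omega -> 'cV[R]_d) (V : Omega -> 'M[R]_d) : Prop :=
  exists2 M : Omega -> 'cV[R]_d, is_cond_exp F X M &
    is_cond_exp F (fun w => (X w - M w) *m (X w - M w)^T) V.

(* normal_prob 0 0 is not the Dirac mass at 0, whence the case distinction. *)
Definition centered_normal (s : R) (B : set R) : \bar R :=
  if s == 0 then \d_(0 : R) B else normal_prob 0 s B.

(* X ~ N(0, Sigma): each u^T X is univariate N(0, u^T Sigma u), possibly
   degenerate. *)
Definition gaussian_vector {d : nat} (Sigma : 'M[R]_d)
    (X : Omega -> 'cV[R]_d) : Prop :=
  forall (u : 'cV[R]_d) (B : set R), measurable B ->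
    P [set w | B ((u^T *m X w) 0 0)] =
    centered_normal (Num.sqrt ((u^T *m Sigma *m u) 0 0)) B.

Definition mutually_independent {I : finType} (F : I -> set (set Omega)) :=
  forall (J : {set I}) (E : I -> set Omega), (forall i, i \in J -> F i (E i)) ->
    P (\bigcap_(i in [set` J]) E i) = (\prod_(i in J) P (E i))%E.

Definition independent2 (F G : set (set Omega)) : Prop :=
  forall A B, F A -> G B -> P (A `&` B) = (P A * P B)%E.

Definition sigma_rv {dsp' : measure_display} {T : measurableType dsp'}
    (f : Omega -> T) : set (set Omega) :=
  preimage_set_system setT f measurable.

Definition iid_std_gaussian_indep {n d : nat} (Z : 'I_n -> Omega -> 'cV[R]_d)
    (F : set (set Omega)) : Prop :=
  [/\ forall i, gaussian_vector 1%:M (Z i),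
      mutually_independent (fun i => sigma_rv (Z i)) &
      independent2 <<s \bigcup_i sigma_rv (Z i) >> F].

End Probability.

(* Then (Omega', P') is, through proj, an enlargement of (Omega, P): the
   identity and the projection of a product space are instances. *)
Definition measure_preserving {R : realType} {dsp dsp' : measure_display}
    {Omega : measurableType dsp} {Omega' : measurableType dsp'}
    (P : probability Omega R) (P' : probability Omega' R)
    (proj : Omega' -> Omega) : Prop :=
  measurable_fun setT proj /\
  forall A, measurable A -> P' (proj @^-1` A) = P A.

Section Bounds.
Context {R : realType} {dsp dsp' : measure_display}
  {Omega : measurableType dsp} {Omega' : measurableType dsp'} {n d : nat}.
Variables (P : probability Omega R) (P' : probability Omega' R)
  (proj : Omega' -> Omega).
Variables (X : 'I_n -> Omega -> 'cV[R]_d) (V : 'I_n -> Omega -> 'M[R]_d).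
Variables (Sigma : 'M[R]_d) (Z : 'I_n -> Omega' -> 'cV[R]_d)
  (T : Omega' -> 'cV[R]_d).
Local Open Scope ereal_scope.

(* X_i and V_i live on Omega, Z_i on its enlargement Omega'. *)
Definition beta2 (p : \bar R) : \bar R :=
  \sum_(i < n) 'E_P'[fun w =>
    (let x := X i (proj w) in
     let g := psd_sqrt (V i (proj w)) *m Z i w in
     lpnorm 2%:E x ^+ 2 * lpnorm p x + lpnorm 2%:E g ^+ 2 * lpnorm p g)%R].

Definition OmegaV (w : Omega) : 'M[R]_d := (\sum_(i < n) V i w - Sigma)%R.

Definition Gamma (p : \bar R) (eta : R) : \bar R :=
  24%:E * (beta2 p * (phi p d ^+ 2 / eta ^+ 3)%:E) `^ 3^-1 +
  17%:E * ('E_P[fun w => opnorm2 (OmegaV w)] * (phi p d ^+ 2 / eta ^+ 2)%:E)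
    `^ 3^-1.

Definition Delta (calA : set (set 'cV[R]_d)) (p : \bar R) (eta : R) : \bar R :=
  ereal_sup [set maxe (P' (T @^-1` (enlarge p eta A `\` A)))
                      (P' (T @^-1` (A `\` shrink p eta A))) | A in calA].

End Bounds.

(* Main.v *)
(* No coupling is used. Replacing A by its complement, it suffices to bound
   P(S in A) by P(T in A^eta) plus the error. After truncation to a large box,
   the indicator of A is replaced by a trigonometric polynomial
   f(x) = sum_k c_k cos(u_k.x + th_k) uniformly close to a periodic function
   that is 3/eta-Lipschitz for the l_p-norm (Fejer kernel). For such f the
   Gaussian mean F(x; M) = E f(x + N(0, M)) is the explicit sum with damping
   factors exp(-u_k^T M u_k / 2), so no Gaussian density is needed and Gaussian
   vectors enter through their one-dimensional marginals only. If M >= s^2 I,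
   the Lipschitz bound of f gives a third-order Taylor estimate of F(.; M) with
   remainder of order |y|_p |y|_2^2 / (s^2 eta).

   The Lindeberg telescoping moves from F(0; Sigma + (nu^2 + s^2) I) to
   E F(S; M_n), where M_i = Sigma + (nu^2 + s^2) I - V_1 - ... - V_i and a
   summand is discarded once M_i - s^2 I would leave the positive semi-definite
   cone; first and second order terms cancel conditionally on H_{i-1}. Nothing
   is discarded when |Omega|_2 <= nu^2, which fails with probability at most
   E|Omega|_2 / nu^2. Both ends cost Gaussian tails of order
   (s + nu) phi_p(d) / eta, and the theorem follows by choosing
   s phi_p(d) / eta = (beta phi_p(d)^2 / eta^3)^(1/3) and
   2 nu phi_p(d) / eta = (E|Omega|_2 phi_p(d)^2 / eta^2)^(1/3). *)
Require Import Defs.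
From HB Require Import structures.
From mathcomp Require Import all_boot all_order all_algebra.
From mathcomp Require Import all_classical all_reals all_analysis.
From mathcomp Require Import measurable_realfun ring lra.
Import Order.TTheory GRing.Theory Num.Theory.
Import numFieldNormedType.Exports.
Local Open Scope classical_set_scope.
Local Open Scope ring_scope.
Set Implicit Arguments.
Unset Strict Implicit.
Unset Printing Implicit Defensive.

(** * Quadratic forms and square roots of matrices *)
Section QuadraticForms.
Context {R : realType} {d : nat}.
Implicit Types (u v x : 'cV[R]_d) (M N A B C : 'M[R]_d).

(** The Taylor estimate has to gain both 1 / s^2 and the Lipschitz constant of f, without
    differentiating f twice and without a density. If B B = M and y = B v, the second derivative of
    F(.; M) in direction y is the limit, as h -> 0, of means of f(x + B Z) against the weight 2 (1 -
    cos(h v.Z)) / h^2, up to the term |v|^2 F. The weight is nonnegative with mean at most |v|^2, so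
    any bound on the variation of f passes through. For cosine sums every mean involved is an
    explicit exponential.

    The price is that f is Lipschitz only up to a small eps. The resulting error eps |y|_2^2 is not
    controlled by the third-order quantity alone; it is absorbed by |y|_2^2 <= |y|_2^2 |y|_p + d and
    disappears with eps.

    A second obstacle is that the square root inside beta is defined by choice. Its measurability in
    V is needed to integrate over Z with V frozen, and is obtained by exhibiting the root as a limit
    of explicit polynomial iterates. *)

Definition dot u x : R := (u^T *m x) 0 0.
Definition qf M u : R := (u^T *m M *m u) 0 0.

Lemma dotE u x : dot u x = \sum_i u i 0 * x i 0.
Proof. by rewrite /dot mxE; apply: eq_bigr => i _; rewrite mxE. Qed.

Lemma dotC u x : dot u x = dot x u.
Proof. by rewrite !dotE; apply: eq_bigr => i _; rewrite mulrC. Qed.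

Lemma dotDr u x y : dot u (x + y) = dot u x + dot u y.
Proof. by rewrite /dot mulmxDr mxE. Qed.

Lemma dotZr a u x : dot u (a *: x) = a * dot u x.
Proof. by rewrite /dot -scalemxAr mxE. Qed.

Lemma dotDl u v x : dot (u + v) x = dot u x + dot v x.
Proof. by rewrite dotC dotDr !(dotC x). Qed.

Lemma dotZl a u x : dot (a *: u) x = a * dot u x.
Proof. by rewrite dotC dotZr dotC. Qed.

Lemma dotNr u x : dot u (- x) = - dot u x.
Proof. by rewrite -scaleN1r dotZr mulN1r. Qed.

Lemma dotNl u x : dot (- u) x = - dot u x.
Proof. by rewrite dotC dotNr dotC. Qed.

Lemma dot0r u : dot u 0 = 0.
Proof. by rewrite /dot mulmx0 mxE. Qed.

Lemma dot0l u : dot 0 u = 0.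
Proof. by rewrite dotC dot0r. Qed.

Lemma dot_ge0 u : 0 <= dot u u.
Proof. by rewrite dotE sumr_ge0// => i _; rewrite -expr2 sqr_ge0. Qed.

Lemma dot_eq0 u : dot u u = 0 -> u = 0.
Proof.
rewrite dotE => /eqP; rewrite psumr_eq0 => [/allP h|i _]; last first.
  by rewrite -expr2 sqr_ge0.
apply/matrixP => i j; rewrite ord1 mxE.
by have := h i (mem_index_enum i); rewrite /= mulf_eq0 orbb => /eqP.
Qed.

Lemma dot_delta i x : dot (delta_mx i 0) x = x i 0.
Proof.
rewrite dotE (bigD1 i)//= big1 ?addr0 ?mxE ?eqxx ?mul1r// => j /negPf ji.
by rewrite mxE ji mul0r.
Qed.

Lemma dot_mulmx B u x : dot u (B *m x) = dot (B^T *m u) x.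
Proof. by rewrite /dot trmx_mul trmxK mulmxA. Qed.

Lemma qfE M u : qf M u = dot u (M *m u).
Proof. by rewrite /qf /dot mulmxA. Qed.

Lemma qfD M N u : qf (M + N) u = qf M u + qf N u.
Proof. by rewrite !qfE mulmxDl dotDr. Qed.

Lemma qfZ a M u : qf (a *: M) u = a * qf M u.
Proof. by rewrite !qfE -scalemxAl dotZr. Qed.

Lemma qfN M u : qf (- M) u = - qf M u.
Proof. by rewrite -scaleN1r qfZ mulN1r. Qed.

Lemma qfB M N u : qf (M - N) u = qf M u - qf N u.
Proof. by rewrite qfD qfN. Qed.

Lemma qf0 u : qf 0 u = 0.
Proof. by rewrite qfE mul0mx dot0r. Qed.

Lemma qf_scalar a u : qf a%:M u = a * dot u u.
Proof. by rewrite qfE mul_scalar_mx dotZr. Qed.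

Lemma qf_scale a M u : qf M (a *: u) = a ^+ 2 * qf M u.
Proof. by rewrite !qfE -scalemxAr dotZl dotZr mulrA. Qed.

Lemma dot_scale a u : dot (a *: u) (a *: u) = a ^+ 2 * dot u u.
Proof. by rewrite dotZl dotZr mulrA. Qed.

Lemma qf_coord M u : qf M u = \sum_i \sum_j u i 0 * u j 0 * M i j.
Proof.
rewrite qfE dotE; apply: eq_bigr => i _; rewrite mxE big_distrr/=.
by apply: eq_bigr => j _; rewrite mulrCA mulrC; ring.
Qed.

Lemma qf_delta M i : qf M (delta_mx i 0) = M i i.
Proof.
rewrite qfE dot_delta mxE (bigD1 i)//= big1 ?addr0 ?mxE ?eqxx ?mulr1//.
by move=> j /negPf ji; rewrite mxE ji mulr0.
Qed.

Lemma psdmx_ge0 M u : psdmx M -> 0 <= qf M u. Proof. by case=> _; apply. Qed.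

Lemma psdmxP M : M^T = M -> (forall u, 0 <= qf M u) -> psdmx M.
Proof. by []. Qed.

Lemma psdmxD M N : psdmx M -> psdmx N -> psdmx (M + N).
Proof.
move=> Mp Np; apply: psdmxP => [|u]; last by rewrite qfD addr_ge0// psdmx_ge0.
by rewrite linearD/= Mp.1 Np.1.
Qed.

Lemma psdmxZ a M : 0 <= a -> psdmx M -> psdmx (a *: M).
Proof.
move=> a0 Mp; apply: psdmxP => [|u]; last by rewrite qfZ mulr_ge0// psdmx_ge0.
by rewrite linearZ/= Mp.1.
Qed.

Lemma psdmx0 : psdmx (0 : 'M[R]_d).
Proof. by apply: psdmxP => [|u]; rewrite ?trmx0// qf0. Qed.

Lemma psdmx_scalar a : 0 <= a -> psdmx (a%:M : 'M[R]_d).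
Proof.
move=> a0; apply: psdmxP => [|u]; first by rewrite tr_scalar_mx.
by rewrite qf_scalar mulr_ge0// dot_ge0.
Qed.

Lemma psdmx_congr N M : psdmx M -> psdmx (N *m M *m N^T).
Proof.
move=> Mp; apply: psdmxP => [|u].
  by rewrite !trmx_mul trmxK Mp.1 mulmxA.
by have := psdmx_ge0 (N^T *m u) Mp; rewrite /qf trmx_mul trmxK !mulmxA.
Qed.

Lemma dot_sym M u v : M^T = M -> dot u (M *m v) = dot v (M *m u).
Proof. by move=> Ms; rewrite dot_mulmx Ms dotC. Qed.

Lemma qf_line M u v t : M^T = M ->
  qf M (u + t *: v) = qf M u + t * (2 * dot v (M *m u)) + t ^+ 2 * qf M v.
Proof.
move=> Ms; rewrite !qfE mulmxDr -scalemxAr !dotDr !dotDl !dotZl !dotZr.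
by rewrite (dot_sym u v Ms); ring.
Qed.

(** The polynomial t -> qf M (u + t v) is nonnegative, so its discriminant is not positive. *)
Lemma psdmx_cauchy M u v : psdmx M ->
  (dot v (M *m u)) ^+ 2 <= qf M u * qf M v.
Proof.
move=> Mp; set b := dot _ _.
have h t : 0 <= qf M u + t * (2 * b) + t ^+ 2 * qf M v.
  by rewrite -qf_line ?Mp.1// psdmx_ge0.
have := psdmx_ge0 v Mp; rewrite le_eqVlt => /orP[/eqP v0|v0].
  rewrite -v0 mulr0; have [->|b0] := eqVneq b 0; first by rewrite expr0n.
  (* Without its quadratic term the polynomial is affine; at this t it would equal -1. *)
  have := h (- (qf M u + 1) / (2 * b)).
  by rewrite -v0 mulr0 addr0 divfK ?mulf_neq0// ?addrA ?opprD; lra.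
have := h (- b / qf M v).
have -> : qf M u + - b / qf M v * (2 * b) + (- b / qf M v) ^+ 2 * qf M v =
  qf M u - b ^+ 2 / qf M v by field; rewrite gt_eqF.
by rewrite subr_ge0 ler_pdivrMr.
Qed.

Lemma dot_cauchy u v : (dot u v) ^+ 2 <= dot u u * dot v v.
Proof.
have := psdmx_cauchy v u (psdmx_scalar ler01).
by rewrite !qf_scalar mul1mx !mul1r mulrC.
Qed.

(** Cauchy-Schwarz between u and M u bounds |M u|^4 by a multiple of qf M u. *)
Lemma psdmx_ker M u : psdmx M -> qf M u = 0 -> M *m u = 0.
Proof.
move=> Mp u0; apply: dot_eq0; apply/eqP.
by rewrite -sqrf_eq0 eq_le sqr_ge0 andbT (le_trans (psdmx_cauchy _ _ Mp))// u0 mul0r.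
Qed.

(** With D = B - C, commutation gives D (B + C) = 0, so the two nonnegative forms of B and C add up
    to 0 at every D u. Hence B and C both kill D u, so D D = 0, and D = 0 by symmetry. *)
Lemma psdmx_sqrt_uniq B C : psdmx B -> psdmx C -> B *m B = C *m C ->
  B *m C = C *m B -> B = C.
Proof.
move=> Bp Cp BC2 comm; set D := B - C.
have Ds : D^T = D by rewrite linearB/= Bp.1 Cp.1.
have DBC : D *m (B + C) = 0.
  by rewrite mulmxDr !mulmxBl BC2 comm addrA subrK subrr.
have D0 u : D *m (D *m u) = 0.
  have s0 : qf B (D *m u) + qf C (D *m u) = 0.
    by rewrite -qfD qfE dotC dot_mulmx Ds mulmxA DBC mul0mx dot0l.
  have [hB hC] : qf B (D *m u) = 0 /\ qf C (D *m u) = 0.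
    by have := psdmx_ge0 (D *m u) Bp; have := psdmx_ge0 (D *m u) Cp; split; lra.
  by rewrite {1}/D mulmxBl (psdmx_ker Bp hB) (psdmx_ker Cp hC) subrr.
apply/eqP; rewrite -subr_eq0; apply/eqP/matrixP => i j.
rewrite [RHS]mxE; have -> : D i j = (D *m delta_mx j (0 : 'I_1)) i 0.
  by rewrite -colE [RHS]mxE.
rewrite (_ : D *m _ = 0) ?mxE//; apply: dot_eq0.
by rewrite dot_mulmx Ds D0 dot0l.
Qed.

End QuadraticForms.

(** * The positive semi-definite square root as a limit of polynomials *)

Section SquareRoot.
Context {R : realType}.

(** An iteration with fixed point p = (X + p^2) / 2, that is p = 1 - sqrt(1 - X). The coefficients
    are nonnegative and increase with k, so evaluation at a matrix between 0 and 1 is monotone in k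
    for the semi-definite order. *)
Fixpoint sqrt_poly k : {poly R} :=
  if k is k'.+1 then 2^-1 *: ('X + sqrt_poly k' ^+ 2) else 0.

Lemma nneg_sqrt_poly k : sqrt_poly k \is a polyOver Num.nneg.
Proof.
elim: k => [|k ih]/=; first exact: polyOver0.
by rewrite polyOverZ ?nnegrE ?invr_ge0// rpredD ?polyOverX// rpredX.
Qed.

(** Monotonicity is inherited: the next difference is half the previous one times a sum of
    polynomials with nonnegative coefficients. *)
Lemma nneg_sqrt_polyB k : sqrt_poly k.+1 - sqrt_poly k \is a polyOver Num.nneg.
Proof.
elim: k => [|k ih].
  by rewrite /= subr0 expr0n addr0 polyOverZ ?nnegrE ?invr_ge0// polyOverX.
have -> : sqrt_poly k.+2 - sqrt_poly k.+1 =
    2^-1 *: ((sqrt_poly k.+1 - sqrt_poly k) * (sqrt_poly k.+1 + sqrt_poly k)).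
  rewrite /= -!scalerBr; congr (_ *: _).
  by rewrite opprD addrACA subrr add0r -subr_sqr.
by rewrite polyOverZ ?nnegrE ?invr_ge0// rpredM// rpredD// nneg_sqrt_poly.
Qed.

Lemma sqrt_poly_le1 k : 0 <= (sqrt_poly k).[1] <= 1.
Proof.
elim: k => [|k /andP[h0 h1]]/=; first by rewrite horner0 lexx ler01.
rewrite hornerZ hornerD hornerX horner_exp.
have : (sqrt_poly k).[1] ^+ 2 <= 1 by rewrite expr_le1.
by have := sqr_ge0 (sqrt_poly k).[1]; lra.
Qed.

Section Iteration.
Context {d : nat}.
Variable A : 'M[R]_d.+1.
Hypothesis (A0 : psdmx A) (A1 : psdmx (1%:M - A)).

Let trmx_exp k : (A ^+ k)^T = A ^+ k.
Proof.
elim: k => [|k ih]; first by rewrite expr0 trmx1.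
by rewrite [in LHS]exprS [LHS](trmx_mul A) ih A0.1 exprSr.
Qed.

Let psdmx_exprM k B : psdmx B -> psdmx (A ^+ k * B * A ^+ k).
Proof.
move=> Bp; have -> : A ^+ k * B * A ^+ k = A ^+ k *m B *m (A ^+ k)^T.
  by rewrite trmx_exp.
exact: psdmx_congr.
Qed.

Let commA : A * (1 - A) = (1 - A) * A.
Proof. by rewrite mulrBr mulrBl mulr1 mul1r. Qed.

(** A (1 - A) = A (1 - A) A + (1 - A) A (1 - A) is a sum of two congruences, which avoids
    diagonalization. *)
Let psdmx_AA : psdmx (A * (1 - A)).
Proof.
have -> : A * (1 - A) = A *m (1%:M - A) *m A^T + (1%:M - A) *m A *m (1%:M - A)^T.
  rewrite A1.1 A0.1; change (A * (1 - A) = A * (1 - A) * A + (1 - A) * A * (1 - A)).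
  by rewrite -commA -mulrDr [A + _]addrC subrK mulr1.
by apply: psdmxD; exact: psdmx_congr.
Qed.

(** Half of the powers move to the right of B: the product becomes A^m B A^m for even k and A^m (A
    B) A^m for odd k, a congruence by a symmetric matrix. *)
Let psdmx_exp_split B k : psdmx B -> psdmx (A * B) -> A * B = B * A ->
  psdmx (A ^+ k * B).
Proof.
move=> Bp ABp AB; rewrite -(odd_double_half k) -addnn addnC -addnA.
set m := k./2; have AmB : A ^+ (m + odd k) * B = (if odd k then A * B else B) * A ^+ m.
  have cm : A ^+ m * B = B * A ^+ m.
    elim: m => [|m ih]; first by rewrite expr0 mulr1 mul1r.
    by rewrite exprSr -mulrA AB mulrA ih -mulrA -exprSr.
  by case: (odd k); rewrite ?addn1 ?addn0 // exprS -mulrA cm mulrA.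
rewrite exprD -mulrA AmB mulrA; apply: psdmx_exprM; by case: ifP.
Qed.

Lemma psdmx_exp k : psdmx (A ^+ k).
Proof.
rewrite -[A ^+ k]mulr1; apply: psdmx_exp_split.
- exact: psdmx_scalar ler01.
- by rewrite mulr1.
- by rewrite mulr1 mul1r.
Qed.

Lemma psdmx_exp_le1 k : psdmx (1%:M - A ^+ k).
Proof.
elim: k => [|k ih]; first by rewrite expr0 subrr; exact: psdmx0.
have -> : 1%:M - A ^+ k.+1 = (1%:M - A ^+ k) + A ^+ k * (1 - A).
  by rewrite mulrBr mulr1 exprSr addrA subrK.
by apply: psdmxD => //; apply: psdmx_exp_split.
Qed.

Lemma horner_mxE (p : {poly R}) :
  horner_mx A p = \sum_(i < size p) p`_i *: A ^+ i.
Proof.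
rewrite -[in LHS](coefK p) poly_def rmorph_sum; apply: eq_bigr => i _ /=.
by rewrite horner_mxZ rmorphXn/= horner_mx_X.
Qed.

Lemma psdmx_horner (p : {poly R}) : p \is a polyOver Num.nneg ->
  psdmx (horner_mx A p).
Proof.
move=> /polyOverP pp; rewrite horner_mxE.
elim/big_ind: _ => [|? ?|i _]; first exact: psdmx0.
  exact: psdmxD.
by apply: psdmxZ (psdmx_exp _); have := pp i; rewrite nnegrE.
Qed.

Lemma psdmx_horner_le1 (p : {poly R}) : p \is a polyOver Num.nneg ->
  psdmx (p.[1]%:M - horner_mx A p).
Proof.
move=> /polyOverP pp; rewrite horner_mxE horner_coef raddf_sum -sumrB.
elim/big_ind: _ => [|? ?|i _]; first exact: psdmx0.
  exact: psdmxD.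
rewrite /= expr1n mulr1 -[X in X - _]scalemx1 -scalerBr.
by apply: psdmxZ (psdmx_exp_le1 _); have := pp i; rewrite nnegrE.
Qed.

Definition sqrt_iter k : 'M[R]_d.+1 := horner_mx A (sqrt_poly k).

Lemma sqrt_iterS k :
  sqrt_iter k.+1 = 2^-1 *: (A + sqrt_iter k *m sqrt_iter k).
Proof. by rewrite /sqrt_iter/= horner_mxZ rmorphD rmorphXn/= horner_mx_X. Qed.

Lemma psdmx_sqrt_iter k : psdmx (sqrt_iter k).
Proof. exact/psdmx_horner/nneg_sqrt_poly. Qed.

Lemma qf_sqrt_iter_ndecr u k : qf (sqrt_iter k) u <= qf (sqrt_iter k.+1) u.
Proof.
rewrite -subr_ge0 -qfB; apply: psdmx_ge0.
by rewrite /sqrt_iter -rmorphB; apply/psdmx_horner/nneg_sqrt_polyB.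
Qed.

Lemma qf_sqrt_iter_le u k : qf (sqrt_iter k) u <= dot u u.
Proof.
have := psdmx_ge0 u (psdmx_horner_le1 (nneg_sqrt_poly k)).
rewrite qfB qf_scalar subr_ge0 => /le_trans; apply.
have /andP[h0 h1] := sqrt_poly_le1 k.
by rewrite ler_piMl// dot_ge0.
Qed.

Lemma cvg_qf_sqrt_iter u : cvgn (fun k => qf (sqrt_iter k) u).
Proof.
apply: nondecreasing_is_cvgn.
  by apply/nondecreasing_seqP => k; exact: qf_sqrt_iter_ndecr.
by exists (dot u u) => _ [k _ <-]; exact: qf_sqrt_iter_le.
Qed.

(** Monotone bounded convergence is available for the quadratic forms; polarization carries it to
    the entries. The factor [1] matches the shape of [qf_line]. *)
Lemma sym_polarization (M : 'M[R]_d.+1) i j : M^T = M ->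
  M i j = 2^-1 * (qf M (delta_mx i 0 + 1 *: delta_mx j 0) - qf M (delta_mx i 0)
          - qf M (delta_mx j 0)).
Proof.
move=> Ms; rewrite (qf_line _ _ _ Ms) expr1n !mul1r.
rewrite dot_delta -colE mxE.
have -> : M j i = M i j by rewrite -[in LHS]Ms mxE.
by field.
Qed.

Lemma cvg_sqrt_iter i j : cvgn (fun k => sqrt_iter k i j).
Proof.
have h k : sqrt_iter k i j = _ := sym_polarization i j (psdmx_sqrt_iter k).1.
under eq_fun do rewrite h.
apply: is_cvgMr; apply: is_cvgB; last exact: cvg_qf_sqrt_iter.
by apply: is_cvgB; exact: cvg_qf_sqrt_iter.
Qed.

End Iteration.
End SquareRoot.

Lemma cvg_sumr {R : realType} {T I : Type} {F : set_system T} {FF : Filter F}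
    (r : seq I) (f : I -> T -> R) (l : I -> R) :
  (forall i, f i x @[x --> F] --> l i) ->
  (\sum_(i <- r) f i x) @[x --> F] --> \sum_(i <- r) l i.
Proof.
move=> fl; elim: r => [|i r ih].
  by under eq_fun do rewrite big_nil; rewrite big_nil; exact: cvg_cst.
by under eq_fun do rewrite big_cons; rewrite big_cons; exact: cvgD.
Qed.

Section PsdSqrt.
Context {R : realType}.

Definition mxabs {d : nat} (M : 'M[R]_d) : R := \sum_i \sum_j `|M i j|.

Lemma mxabs_ge0 d (M : 'M[R]_d) : 0 <= mxabs M.
Proof. by apply: sumr_ge0 => i _; apply: sumr_ge0. Qed.

Lemma sqr_coord_le_dot d (u : 'cV[R]_d) i : (u i 0) ^+ 2 <= dot u u.
Proof.
rewrite dotE (bigD1 i)//= -expr2 lerDl sumr_ge0// => j _.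
by rewrite -expr2 sqr_ge0.
Qed.

Lemma normr_qf_le d (M : 'M[R]_d) u : `|qf M u| <= mxabs M * dot u u.
Proof.
rewrite qf_coord /mxabs mulr_suml (le_trans (ler_norm_sum _ _ _))//.
apply: ler_sum => i _; rewrite mulr_suml (le_trans (ler_norm_sum _ _ _))//.
apply: ler_sum => j _; rewrite normrM mulrC ler_wpM2l// ler_norml.
have := sqr_coord_le_dot u i; have := sqr_coord_le_dot u j.
have := sqr_ge0 (u i 0 + u j 0); have := sqr_ge0 (u i 0 - u j 0).
by rewrite sqrrB sqrrD; lra.
Qed.

Section NonTrivial.
Context {d : nat}.
Implicit Types M : 'M[R]_d.+1.

(** The summand 1 keeps the scale positive at M = 0; [mxabs] dominates the quadratic form, so
    division by the scale brings M below the identity. *)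
Definition sqrt_scale M : R := 1 + mxabs M.

Lemma sqrt_scale_gt0 M : 0 < sqrt_scale M.
Proof. by rewrite /sqrt_scale; have := mxabs_ge0 M; lra. Qed.

Definition sqrt_arg M : 'M[R]_d.+1 := 1%:M - (sqrt_scale M)^-1 *: M.

Definition sqrt_approx M k : 'M[R]_d.+1 :=
  Num.sqrt (sqrt_scale M) *: (1%:M - sqrt_iter (sqrt_arg M) k).

Lemma psdmx_sqrt_arg M : psdmx M -> psdmx (sqrt_arg M).
Proof.
move=> Mp; apply: psdmxP => [|u].
  by rewrite linearB/= linearZ/= trmx1 Mp.1.
have := normr_qf_le M u; rewrite ler_norml => /andP[_ h].
rewrite qfB qf_scalar qfZ mul1r subr_ge0 mulrC ler_pdivrMr ?sqrt_scale_gt0//.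
rewrite (le_trans h)// mulrC ler_wpM2l ?dot_ge0// /sqrt_scale; lra.
Qed.

Lemma psdmx_sqrt_arg1 M : psdmx M -> psdmx (1%:M - sqrt_arg M).
Proof.
move=> Mp; rewrite opprB addrC subrK; apply: psdmxZ => //.
by rewrite invr_ge0 ltW// sqrt_scale_gt0.
Qed.

(** With A = 1 - M / c, the limit L of the iterates satisfies L = (A + L L) / 2, that is (1 - L)^2 =
    M / c, so sqrt(c) (1 - L) is a root of M. Commutation passes to the limit because every iterate
    is a polynomial in A. The approximants stay in the statement for the measurability of the
    root. *)
Lemma sqrt_approx_cvg M : psdmx M -> exists B : 'M[R]_d.+1,
  [/\ psdmx B, B *m B = M, (forall C, C *m M = M *m C -> C *m B = B *m C) &
   forall i j, sqrt_approx M k i j @[k --> \oo] --> B i j].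
Proof.
move=> Mp; set A := sqrt_arg M.
have A0 : psdmx A := psdmx_sqrt_arg Mp.
have A1 : psdmx (1%:M - A) := psdmx_sqrt_arg1 Mp.
pose L : 'M[R]_d.+1 := \matrix_(i, j) limn (fun k => sqrt_iter A k i j).
have cL i j : sqrt_iter A k i j @[k --> \oo] --> L i j.
  by rewrite mxE; exact: cvg_sqrt_iter.
have LA : L = 2^-1 *: (A + L *m L).
  apply/matrixP => i j.
  have h1 : sqrt_iter A k.+1 i j @[k --> \oo] --> L i j.
    by have := cL i j; rewrite -cvg_shiftS.
  have h2 : sqrt_iter A k.+1 i j @[k --> \oo] --> (2^-1 *: (A + L *m L)) i j.
    under eq_fun do rewrite sqrt_iterS !mxE; rewrite !mxE.
    apply: cvgM; first exact: cvg_cst.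
    apply: cvgD; first exact: cvg_cst.
    by apply: cvg_sumr => k; apply: cvgM.
  by rewrite -(cvg_lim _ h1)// (cvg_lim _ h2).
have Ls : L^T = L.
  apply/matrixP => i j; rewrite !mxE.
  have -> // : (fun k => sqrt_iter A k j i) = (fun k => sqrt_iter A k i j).
  by apply/funext => k; rewrite -[in RHS](psdmx_sqrt_iter A0 k).1 mxE.
pose c := sqrt_scale M; have c0 : 0 < c := sqrt_scale_gt0 M.
pose B := Num.sqrt c *: (1%:M - L).
have cB i j : sqrt_approx M k i j @[k --> \oo] --> B i j.
  under eq_fun do rewrite !mxE; rewrite [B i j]mxE [(1%:M - L) i j]mxE [(- L) i j]mxE [1%:M i j]mxE.
  by apply: cvgM; [exact: cvg_cst|apply: cvgB; [exact: cvg_cst|exact: cL]].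
exists B; split => //.
- apply: psdmxZ; first exact: sqrtr_ge0.
  apply: psdmxP => [|u]; first by rewrite linearB/= trmx1 Ls.
  rewrite qfB qf_scalar mul1r subr_ge0.
  have cq : qf (sqrt_iter A k) u @[k --> \oo] --> qf L u.
    under eq_fun do rewrite qf_coord; rewrite qf_coord.
    by apply: cvg_sumr => i; apply: cvg_sumr => j; apply: cvgM; [exact: cvg_cst|].
  rewrite -(cvg_lim _ cq)//; apply: limr_le; first by apply/cvg_ex; eexists; exact: cq.
  by apply: nearW => k; exact: qf_sqrt_iter_le.
- rewrite /B -scalemxAl -scalemxAr scalerA -expr2 sqr_sqrtr ?ltW//.
  have -> : (1%:M - L) *m (1%:M - L) = c^-1 *: M.
    have -> : c^-1 *: M = 1%:M - A by rewrite opprB addrC subrK.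
    have -> : A = 2 *: L - L *m L by rewrite {1}LA scalerA divff// scale1r addrK.
    rewrite mulmxBr !mulmxBl !mulmx1 !mul1mx scaler_nat mulr2n.
    by rewrite !opprD !opprK !addrA.
  by rewrite scalerA divff ?gt_eqF// scale1r.
- move=> C CM.
  have CA : C *m A = A *m C.
    by rewrite mulmxBr mulmxBl mulmx1 mul1mx -scalemxAr -scalemxAl CM.
  have CL : C *m L = L *m C.
    apply/matrixP => i j.
    have h1 : (C *m sqrt_iter A k) i j @[k --> \oo] --> (C *m L) i j.
      under eq_fun do rewrite mxE; rewrite mxE.
      by apply: cvg_sumr => k; apply: cvgM; [exact: cvg_cst|].
    have h2 : (C *m sqrt_iter A k) i j @[k --> \oo] --> (L *m C) i j.
      have e k : C *m sqrt_iter A k = sqrt_iter A k *m C by exact: comm_mx_horner.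
      under eq_fun do rewrite e mxE; rewrite mxE.
      by apply: cvg_sumr => k; apply: cvgM; [|exact: cvg_cst].
    by rewrite -(cvg_lim _ h1)// (cvg_lim _ h2).
  by rewrite /B -scalemxAr -scalemxAl mulmxBr mulmxBl CL mulmx1 mul1mx.
Qed.

(** Any semi-definite root C of M commutes with M = C C, hence with the constructed root; uniqueness
    among commuting roots identifies the value picked by [xget]. *)
Lemma psd_sqrtP M : psdmx M -> [/\ psdmx (psd_sqrt M),
  psd_sqrt M *m psd_sqrt M = M &
  forall i j, sqrt_approx M k i j @[k --> \oo] --> psd_sqrt M i j].
Proof.
move=> Mp; have [B [Bp BM BC Bl]] := sqrt_approx_cvg Mp.
suff -> : psd_sqrt M = B by [].
apply: xget_unique => // C [Cp CM]; apply: psdmx_sqrt_uniq => //.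
  by rewrite CM BM.
by apply: BC; rewrite -CM mulmxA.
Qed.

Lemma psd_sqrt_notpsd M : ~ psdmx M -> psd_sqrt M = 0.
Proof.
move=> nM; apply: xgetPN => B [Bp BM]; apply: nM; apply: psdmxP => [|u].
  by rewrite -BM trmx_mul Bp.1.
by rewrite -BM qfE -mulmxA dot_mulmx Bp.1 dot_ge0.
Qed.

End NonTrivial.
End PsdSqrt.

(** * Norms *)
Section LpNorm.
Context {R : realType} {d : nat}.
Implicit Types (x y : 'cV[R]_d) (p : \bar R) (r : R).

Lemma lpnorm_ge0 p x : 0 <= lpnorm p x.
Proof.
by case: p => [r||]//=; [exact: powR_ge0|elim/big_ind: _ => // a b; rewrite le_max => ->].
Qed.

Let S r x : R := \sum_(i < d) `|x i 0| `^ r.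

Let S_ge0 r x : 0 <= S r x.
Proof. by apply: sumr_ge0 => i _; exact: powR_ge0. Qed.

Let lpnorm_powR r x : 0 < r -> lpnorm r%:E x `^ r = S r x.
Proof. by move=> r0; rewrite /= -powRrM mulVf ?gt_eqF// powRr1// S_ge0. Qed.

Let lpnorm_le r x a : 0 < r -> 0 <= a -> (lpnorm r%:E x <= a) = (S r x <= a `^ r).
Proof.
move=> r0 a0; rewrite -lpnorm_powR//; apply/idP/idP => h.
  by apply: ge0_ler_powR; rewrite ?nnegrE ?lpnorm_ge0// ltW.
rewrite leNgt; apply/negP => h'.
have := @gt0_ltr_powR R r r0 a (lpnorm r%:E x).
by rewrite !nnegrE a0 lpnorm_ge0 => /(_ isT isT h'); rewrite ltNge h.
Qed.

Lemma lpnorm_coord p x i : (1 <= p)%E -> `|x i 0| <= lpnorm p x.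
Proof.
case: p => [r r1||//] /=; last by move=> _; exact: (le_bigmax _ (fun i => `|x i 0|) i).
have r0 : 0 < r by rewrite (lt_le_trans ltr01)// -lee_fin.
rewrite leNgt; apply/negP => h.
have := @gt0_ltr_powR R r r0 (lpnorm r%:E x) `|x i 0|.
rewrite !nnegrE lpnorm_ge0 normr_ge0 => /(_ isT isT h).
rewrite lpnorm_powR// /S (bigD1 i)//= ltNge lerDl.
by rewrite sumr_ge0// => j _; exact: powR_ge0.
Qed.

Lemma lpnormZ p a x : (1 <= p)%E -> lpnorm p (a *: x) = `|a| * lpnorm p x.
Proof.
case: p => [r r1||//] /=.
  have r0 : 0 < r by rewrite (lt_le_trans ltr01)// -lee_fin.
  rewrite (eq_bigr (fun i => `|a| `^ r * `|x i 0| `^ r)); last first.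
    by move=> i _; rewrite mxE normrM powRM.
  rewrite -mulr_sumr powRM ?powR_ge0//; last exact: S_ge0.
  by rewrite -powRrM mulfV ?gt_eqF// powRr1.
move=> _; elim/big_rec2: _ => [|i y1 y2 _ ->]; first by rewrite mulr0.
by rewrite mxE normrM maxr_pMr.
Qed.

Lemma lpnormN p x : (1 <= p)%E -> lpnorm p (- x) = lpnorm p x.
Proof. by move=> p1; rewrite -scaleN1r lpnormZ// normrN1 mul1r. Qed.

Lemma lpnorm0 p : (1 <= p)%E -> lpnorm p (0 : 'cV[R]_d) = 0.
Proof. by move=> p1; rewrite -(scale0r (0 : 'cV[R]_d)) lpnormZ// normr0 mul0r. Qed.

Let powR_convex2 r (l a b : R) : 1 <= r -> 0 <= l <= 1 -> 0 <= a -> 0 <= b ->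
  (l * a + (1 - l) * b) `^ r <= l * a `^ r + (1 - l) * b `^ r.
Proof.
move=> r1 l01 a0 b0; pose t : {i01 R} := Itv01 (andP l01).1 (andP l01).2.
have := @convex_powR R r r1 t a b.
rewrite !inE/= !in_itv/= !andbT => /(_ a0 b0).
by rewrite !convRE.
Qed.

(** Minkowski by convexity of t -> t^r: |x_i + y_i| / (a + b) is at most the convex combination of
    |x_i| / a and |y_i| / b with weight l = a / (a + b). Positive upper bounds a and b in place of
    the norms avoid dividing by a zero norm. *)
Let lpnormD_lt r x y a b : 1 <= r -> 0 < a -> 0 < b ->
  lpnorm r%:E x <= a -> lpnorm r%:E y <= b -> lpnorm r%:E (x + y) <= a + b.
Proof.
move=> r1 a0 b0; have r0 : 0 < r by rewrite (lt_le_trans ltr01).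
have a0' := ltW a0; have b0' := ltW b0; have c0 := addr_gt0 a0 b0.
have c0' := ltW c0.
move=> lxa lyb.
have xa : S r x <= a `^ r by move: lxa; rewrite (lpnorm_le x r0 a0').
have yb : S r y <= b `^ r by move: lyb; rewrite (lpnorm_le y r0 b0').
rewrite (lpnorm_le (x + y) r0 c0').
pose l := a / (a + b).
have /andP[l0 l1] : 0 <= l <= 1.
  by rewrite divr_ge0//= ler_pdivrMr// mul1r lerDl.
have h i : `|(x + y) i 0| `^ r <= (a + b) `^ r *
    (l * (`|x i 0| `^ r / a `^ r) + (1 - l) * (`|y i 0| `^ r / b `^ r)).
  have powR_div (u v : R) : 0 <= u -> 0 < v -> u `^ r / v `^ r = (u / v) `^ r.
    move=> u0 v0; rewrite powRM// ?invr_ge0 ?(ltW v0)//.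
    by rewrite -powRN -powR_inv1 ?(ltW v0)// -powRrM mulN1r.
  rewrite !powR_div//.
  have m0 : 0 <= l * (`|x i 0| / a) + (1 - l) * (`|y i 0| / b).
    by rewrite addr_ge0// mulr_ge0 ?subr_ge0// divr_ge0.
  apply: (@le_trans _ _ ((a + b) `^ r * (l * (`|x i 0| / a) + (1 - l) * (`|y i 0| / b)) `^ r)).
    rewrite -powRM//.
    apply: ge0_ler_powR; rewrite ?nnegrE ?mulr_ge0// ?(ltW r0)//.
    have -> : (a + b) * (l * (`|x i 0| / a) + (1 - l) * (`|y i 0| / b)) = `|x i 0| + `|y i 0|.
      by rewrite /l; field; rewrite !gt_eqF.
    by rewrite mxE ler_normD.
  by rewrite ler_wpM2l ?powR_ge0//; apply: powR_convex2; rewrite ?l0// divr_ge0.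
rewrite /S (le_trans (ler_sum _ (fun i _ => h i)))// -mulr_sumr.
rewrite -[leRHS]mulr1 ler_wpM2l ?powR_ge0// big_split/= -!mulr_sumr.
rewrite -[leRHS](subrKC l 1); apply: lerD; rewrite -[leRHS]mulr1 ler_wpM2l ?subr_ge0//.
  by rewrite -mulr_suml ler_pdivrMr ?powR_gt0// mul1r.
by rewrite -mulr_suml ler_pdivrMr ?powR_gt0// mul1r.
Qed.

Lemma ler_lpnormD p x y : (1 <= p)%E -> lpnorm p (x + y) <= lpnorm p x + lpnorm p y.
Proof.
case: p => [r r1||//].
  apply/ler_addgt0Pr => e e0; have e20 : 0 < e / 2 by rewrite divr_gt0.
  have := @lpnormD_lt r x y (lpnorm r%:E x + e / 2) (lpnorm r%:E y + e / 2).
  have := lpnorm_ge0 r%:E x; have := lpnorm_ge0 r%:E y.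
  rewrite lee_fin in r1.
  move: (lpnorm r%:E x) (lpnorm r%:E y) (lpnorm r%:E (x + y)) => X Y XY Y0 X0 h.
  have h1 : 0 < X + e / 2 by rewrite ltr_wpDl.
  have h2 : 0 < Y + e / 2 by rewrite ltr_wpDl.
  have -> : X + Y + e = X + e / 2 + (Y + e / 2) by field.
  by apply: h => //; rewrite lerDl ltW.
move=> _ /=; apply: bigmax_le => [|i _]; first by apply: addr_ge0; exact: (lpnorm_ge0 +oo%E).
rewrite mxE (le_trans (ler_normD _ _))//; apply: lerD; [exact: (lpnorm_coord x i (leey 1%E))|exact: (lpnorm_coord y i (leey 1%E))].
Qed.

Lemma ler_lpnormB p x y : (1 <= p)%E -> lpnorm p (x - y) <= lpnorm p x + lpnorm p y.
Proof. by move=> p1; have := ler_lpnormD x (- y) p1; rewrite lpnormN. Qed.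

Lemma lpnorm2_sqr x : lpnorm 2%:E x ^+ 2 = dot x x.
Proof.
rewrite -powR_mulrn ?lpnorm_ge0// lpnorm_powR// dotE; apply: eq_bigr => i _.
by rewrite powR_mulrn// -normrX ger0_norm ?sqr_ge0.
Qed.

(** A crude constant valid for every p at once; the summand 1 makes it at least 1, so that its power
    r dominates d. It serves qualitative facts such as finiteness and continuity and does not reach
    the final constants. *)
Lemma lpnorm_coord_bound p a x : (1 <= p)%E -> 0 <= a ->
  (forall i, `|x i 0| <= a) -> lpnorm p x <= (1 + d%:R) * a.
Proof.
case: p => [r||//] r1 a0 xa.
  rewrite lee_fin in r1; have r0 : 0 < r by rewrite (lt_le_trans ltr01).
  have d1 : (1:R) <= 1 + d%:R by rewrite lerDl.
  have d0 : (0:R) <= 1 + d%:R by rewrite (le_trans _ d1).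
  rewrite lpnorm_le ?mulr_ge0// powRM//.
  apply: (@le_trans _ _ (d%:R * a `^ r)).
    have -> : d%:R * a `^ r = \sum_(i < d) a `^ r.
      by rewrite sumr_const card_ord mulr_natl.
    by apply: ler_sum => i _; apply: ge0_ler_powR; rewrite ?nnegrE ?(ltW r0).
  rewrite ler_wpM2r ?powR_ge0// (@le_trans _ _ (1 + d%:R))// ?lerDr//.
  exact: le1r_powR.
rewrite /=; have h : a <= (1 + d%:R) * a by rewrite mulrDl mul1r lerDl mulr_ge0.
by apply: bigmax_le => [|i _]; [exact: le_trans a0 h|exact: le_trans (xa i) h].
Qed.

Lemma lpnorm_le_sum p x : (1 <= p)%E ->
  lpnorm p x <= (1 + d%:R) * \sum_i `|x i 0|.
Proof.
move=> p1; apply: lpnorm_coord_bound => //; first exact: sumr_ge0.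
by move=> i; rewrite (bigD1 i)//= lerDl sumr_ge0.
Qed.

End LpNorm.

Section OpNorm.
Context {R : realType} {d : nat}.

Lemma normr_qf_opnorm2 (M : 'M[R]_d) u : `|qf M u| <= opnorm2 M * dot u u.
Proof.
have lp2 (x : 'cV[R]_d) a : 0 <= a -> (lpnorm 2%:E x <= a) = (dot x x <= a ^+ 2).
  by move=> a0; rewrite -lpnorm2_sqr ler_sqr// ?nnegrE ?lpnorm_ge0.
set E := [set lpnorm 2%:E (M *m x) | x in [set x | lpnorm 2%:E x <= 1]].
(* [sup] takes a default value on unbounded sets, so the images of the unit ball must be bounded
   before the supremum can serve as an upper bound. *)
have E0 : has_sup E.
  split; first by exists (lpnorm 2%:E (M *m 0)), 0 => //; rewrite /mkset lpnorm0// lee_fin ler1n.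
  exists ((1 + d%:R) * mxabs M) => _ [x x1 <-].
  apply: (lpnorm_coord_bound _ (mxabs_ge0 M)) => [|i]; first by rewrite lee_fin ler1n.
  rewrite mxE (le_trans (ler_norm_sum _ _ _))//.
  rewrite /mxabs [leRHS](bigD1 i)//= -[leLHS]addr0 lerD//; last first.
    by apply: sumr_ge0 => k _; exact: sumr_ge0.
  apply: ler_sum => j _; rewrite normrM ler_piMr//.
  apply: le_trans x1; apply: lpnorm_coord; by rewrite lee_fin ler1n.
have [u0|u0] := eqVneq (dot u u) 0.
  by rewrite (dot_eq0 u0) qfE mulmx0 !dot0r normr0 mulr0.
have du0 : 0 < dot u u by rewrite lt_def u0 dot_ge0.
set c := Num.sqrt (dot u u); have c0 : 0 < c by rewrite sqrtr_gt0.
have cc : c ^+ 2 = dot u u by rewrite sqr_sqrtr// ltW.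
pose x := c^-1 *: u.
have x1 : dot x x = 1 by rewrite /x dot_scale exprVn cc mulVf.
have xE : u = c *: x by rewrite scalerA divff ?gt_eqF// scale1r.
have lx1 : lpnorm 2%:E x <= 1 by rewrite lp2// expr1n x1.
have Mx : lpnorm 2%:E (M *m x) <= opnorm2 M.
  by apply: ub_le_sup; [exact: E0.2|exists x].
have o0 : 0 <= opnorm2 M by apply: le_trans Mx; exact: lpnorm_ge0.
have qx : `|qf M x| <= opnorm2 M.
  rewrite -ler_sqr ?nnegrE// real_normK ?num_real// qfE.
  rewrite (le_trans (dot_cauchy _ _))// x1 mul1r -lp2//.
rewrite xE qf_scale dot_scale x1 mulr1 normrM (ger0_norm (sqr_ge0 c)) mulrC.
by rewrite ler_wpM2r ?sqr_ge0.
Qed.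
End OpNorm.

(** * Gaussian variables *)
Section NormalIntegral.
Context {R : realType} (s : R) (s0 : s != 0).
Local Notation mu := (@lebesgue_measure R).
Local Notation N := (normal_prob 0 s).

(** The change of variables is available for a Radon-Nikodym derivative; it agrees almost everywhere
    with the explicit density because both integrate to the same measure. *)
Lemma ge0_integral_normal_prob (f : R -> \bar R) : (forall x, (0 <= f x)%E) ->
  measurable_fun setT f ->
  (\int[N]_x f x = \int[mu]_x (f x * (normal_pdf 0 s x)%:E))%E.
Proof.
move=> f0 mf.
have dom : N `<< mu := normal_prob_dominates 0 s.
rewrite -(Radon_Nikodym_SigmaFinite.change_of_variables dom)//.
have mpdf : measurable_fun setT (fun x => (normal_pdf 0 s x)%:E).
  by apply/measurable_EFinP; exact: measurable_normal_pdf.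
apply: ae_eq_integral => //.
- apply: emeasurable_funM => //.
  exact: measurable_int (Radon_Nikodym_SigmaFinite.f_integrable dom).
- exact: emeasurable_funM.
- apply: ae_eqe_mul2l; apply: integral_ae_eq => //.
    exact: Radon_Nikodym_SigmaFinite.f_integrable.
  move=> E _ mE; rewrite -Radon_Nikodym_SigmaFinite.f_integral//.
Qed.

(** Cameron-Martin shift: substitute x -> x + a s^2 and complete the square in the exponent. The
    Laplace transform and, through [integral_id_sin], the cosine transform both derive from it. *)
Lemma normal_prob_translation (f : R -> R) (a : R) : (forall x, 0 <= f x) ->
  continuous f ->
  (\int[N]_x (f (x + a * s ^+ 2))%:E =
   \int[N]_x (f x * expR (a * x - a ^+ 2 * s ^+ 2 / 2))%:E)%E.
Proof.
move=> f0 cf; set h := a * s ^+ 2.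
have mf : measurable_fun setT f := continuous_measurable_fun cf.
have F' : (fun x : R => x + h)^`()%classic = cst 1.
  apply/funext => x; rewrite derive1E deriveD//= derive_id derive_cst addr0//.
rewrite !ge0_integral_normal_prob//; last 4 first.
- by move=> x; rewrite lee_fin mulr_ge0// expR_ge0.
- apply/measurable_EFinP/measurable_funM => //; apply: measurableT_comp => //.
  by apply: measurable_funB => //; apply: measurable_funM.
- by move=> x; rewrite lee_fin.
- by apply/measurable_EFinP; apply: measurableT_comp => //; apply: measurable_funD.
pose G x := f x * normal_pdf 0 s (x - h).
have e1 : (\int[mu]_x ((f (x + h))%:E * (normal_pdf 0 s x)%:E) =
    \int[mu]_x (((G \o (fun x => x + h)) * (fun x : R => x + h)^`()%classic) x)%:E)%E.
  by apply: eq_integral => x _; rewrite F' /G !fctE mulr1 addrK EFinM.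
have e2 : (\int[mu]_x (G x)%:E =
    \int[mu]_x ((f x * expR (a * x - a ^+ 2 * s ^+ 2 / 2))%:E * (normal_pdf 0 s x)%:E))%E.
  apply: eq_integral => x _; rewrite /G -EFinM; congr (_%:E); rewrite -[RHS]mulrA; congr (_ * _).
  rewrite !normal_pdfE// mulrCA; congr (_ * _); rewrite -expRD; congr expR.
  by rewrite /h !subr0 -[s ^+ 2 *+ 2]mulr_natl; field.
apply: (etrans e1); apply: etrans e2; apply/esym.
apply: (@increasing_ge0_integration_by_substitutionT R (fun x => x + h) G).
- by move=> x y; rewrite ltrD2r.
- by rewrite F' => ?; exact: cvg_cst.
- by rewrite F'; exact: is_cvg_cst.
- by rewrite F'; exact: is_cvg_cst.
- by move=> x; apply: derivableD; [exact: derivable_id|exact: derivable_cst].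
- exact: cvg_addrr_Ny.
- exact: cvg_addrr.
- move=> x; apply: cvgM; first exact: cf.
  apply: (@cvg_comp _ _ _ (fun x => x - h) (normal_pdf 0 s)).
    by apply: cvgB; [exact: cvg_id|exact: cvg_cst].
  exact: continuous_normal_pdf.
- by move=> x; rewrite mulr_ge0// normal_pdf_ge0.
Qed.

(** The integrand halves the exponent of the density, and the product is sqrt 2 times the density of
    standard deviation sqrt 2 s. *)
Lemma ge0_integral_normal_prob_expR_sqr :
  (\int[N]_x (expR (x ^+ 2 / (4 * s ^+ 2)))%:E = (Num.sqrt 2)%:E)%E.
Proof.
have r2 : Num.sqrt 2 != 0 :> R by rewrite gt_eqF// sqrtr_gt0.
have s2 : Num.sqrt 2 * s != 0 by rewrite mulf_neq0.
rewrite ge0_integral_normal_prob; last 2 first.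
- by move=> x; rewrite lee_fin expR_ge0.
- apply/measurable_EFinP; apply: measurableT_comp => //.
  by apply: measurable_funM => //; apply: measurable_funX.
have peak2 : normal_peak s = Num.sqrt 2 * normal_peak (Num.sqrt 2 * s).
  rewrite /normal_peak.
  have -> : (Num.sqrt 2 * s) ^+ 2 * pi *+ 2 = 2 * (s ^+ 2 * pi *+ 2).
    by rewrite exprMn sqr_sqrtr// !mulr2n; ring.
  by rewrite sqrtrM// invfM mulrA divff// mul1r.
transitivity (\int[mu]_x ((Num.sqrt 2)%:E * (normal_pdf 0 (Num.sqrt 2 * s) x)%:E))%E.
  apply: eq_integral => x _; rewrite -!EFinM; congr (_%:E).
  rewrite !normal_pdfE// mulrCA [RHS]mulrA -peak2; congr (_ * _).
  rewrite -expRD; congr expR; rewrite /normal_fun !subr0 exprMn sqr_sqrtr//.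
  have -> : s ^+ 2 *+ 2 = 2 * s ^+ 2 by rewrite mulr_natl.
  have -> : 2 * s ^+ 2 *+ 2 = 4 * s ^+ 2 by rewrite mulr2n; ring.
  by field.
rewrite ge0_integralZl//=.
- by rewrite integral_normal_pdf mule1.
- by apply/measurable_EFinP; exact: measurable_normal_pdf.
- by move=> x _; rewrite lee_fin normal_pdf_ge0.
Qed.
End NormalIntegral.

Section NormalMoments.
Context {R : realType} (s : R) (s0 : s != 0).
Local Notation N := (normal_prob 0 s).

Lemma integral_expR_normal_prob (a : R) :
  (\int[N]_x (expR (a * x))%:E = (expR (a ^+ 2 * s ^+ 2 / 2))%:E)%E.
Proof.
have := normal_prob_translation s0 a (fun=> ler01) (@cst_continuous R R 1).
have e1 : (\int[N]_x 1%:E = 1%:E)%E.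
  by rewrite integral_cst//= mul1e; exact: integral_normal_pdf.
rewrite /= e1 => /esym.
under eq_integral do rewrite mul1r expRD mulrC EFinM.
rewrite ge0_integralZl//=; last first.
  by apply/measurable_EFinP; apply: measurableT_comp => //; apply: measurable_funM.
set q := a ^+ 2 * s ^+ 2 / 2; set I := integral _ _ _ => h.
have -> : I = ((expR q)%:E * ((expR (- q))%:E * I))%E.
  by rewrite muleA -EFinM -expRD subrr expR0 mul1e.
by rewrite h mule1.
Qed.

Lemma integrable_expR_normal_prob (a : R) :
  N.-integrable setT (fun x => (expR (a * x))%:E).
Proof.
apply/integrableP; split.
  by apply/measurable_EFinP; apply: measurableT_comp => //; apply: measurable_funM.
under eq_integral do rewrite /= ger0_norm ?expR_ge0//.
by rewrite integral_expR_normal_prob ltry.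
Qed.

Let expR_norm_le (k x : R) : expR (k * `|x|) <= expR (k * x) + expR (- k * x).
Proof.
have [x0|x0] := ger0P x; first by rewrite lerDl expR_ge0.
by rewrite mulrN -mulNr lerDr expR_ge0.
Qed.

Lemma integrable_expR_norm_normal_prob (k : R) :
  N.-integrable setT (fun x => (expR (k * `|x|))%:E).
Proof.
apply: (le_integrable measurableT _ _
  (integrableD measurableT (integrable_expR_normal_prob k) (integrable_expR_normal_prob (- k)))).
  apply/measurable_EFinP; apply: measurableT_comp => //; apply: measurable_funM => //.
move=> x _; rewrite /= lee_fin (ger0_norm (expR_ge0 _)).
rewrite (ger0_norm (addr_ge0 (expR_ge0 _) (expR_ge0 _))).
exact: expR_norm_le.
Qed.

Lemma integrable_exp_growth (f : R -> R) k M : measurable_fun setT f ->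
  (forall x, `|f x| <= M * expR (k * `|x|)) -> N.-integrable setT (EFin \o f).
Proof.
move=> mf fM; apply: (le_integrable measurableT _ _
  (integrableZl measurableT M (integrable_expR_norm_normal_prob k))).
  exact/measurable_EFinP.
move=> x _; rewrite /= lee_fin (le_trans (fM x))//.
by rewrite ler_norm.
Qed.

Lemma le_id_expR (x : R) : x <= expR x.
Proof. by have := expR_ge1Dx x; lra. Qed.

(** Differentiation under the integral. The dominating exponential has rate 3: one unit for f, one
    for the factor x, one for exp(a x) with |a| < 1. *)
Lemma is_derive_integral_expR (f : R -> R) (M a : R) : measurable_fun setT f ->
  (forall x, `|f x| <= M * expR `|x|) -> `|a| < 1 ->
  is_derive a (1 : R) (fun a : R => \int[N]_x (f x * expR (a * x)))
                (\int[N]_x (x * f x * expR (a * x))).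
Proof.
move=> mf fM a1.
have M0 : 0 <= M by have := fM 0; rewrite normr0 expR0 mulr1; exact: le_trans.
have Ia : `]-1, 1[%classic a by rewrite /= in_itv/= -ltr_norml.
have me b : measurable_fun setT (fun x : R => expR (b * x)).
  by apply: measurableT_comp => //; apply: measurable_funM.
have D (b y : R) : is_derive b (1 : R) (fun b : R => f y * expR (b * y)) (y * f y * expR (b * y)).
  apply: is_derive_eq; rewrite /GRing.scale/=; ring.
have D1 (b y : R) : partial1of2 (fun b x => f x * expR (b * x)) b y = y * f y * expR (b * y).
  by rewrite partial1of2E; exact: derive_val.
have bnd (b x : R) : `|b| < 1 -> expR (b * x) <= expR `|x|.
  move=> b1; rewrite ler_expR (le_trans (ler_norm _))// normrM ler_piMl//.
  exact: ltW.
have bnd3 (b y : R) : `|b| < 1 -> `|y * f y * expR (b * y)| <= M * expR (3 * `|y|).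
  move=> b1; rewrite !normrM (ger0_norm (expR_ge0 _)).
  have -> : 3 * `|y| = `|y| + `|y| + `|y| by ring.
  rewrite !expRD !mulrA; apply: ler_pM => //; [|exact: bnd].
  rewrite mulrC; apply: ler_pM => //; exact: le_id_expR.
have bnd2 (b y : R) : `|b| < 1 -> `|f y * expR (b * y)| <= M * expR (2 * `|y|).
  move=> b1; rewrite normrM (ger0_norm (expR_ge0 _)).
  have -> : 2 * `|y| = `|y| + `|y| by ring.
  by rewrite expRD mulrA; apply: ler_pM => //; exact: bnd.
have hint (b : R) : `]-1, 1[%classic b -> N.-integrable setT (EFin \o (fun x => f x * expR (b * x))).
  rewrite /= in_itv/= -ltr_norml => b1; apply: (@integrable_exp_growth _ 2 M).
    exact: measurable_funM.
  by move=> x; exact: bnd2.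
have hder (b y : R) : `]-1, 1[%classic b -> setT y -> derivable ((fun b x => f x * expR (b * x)) ^~ y) b 1.
  by move=> _ _; exact: ex_derive.
have hG (y : R) : 0 <= M * expR (3 * `|y|) by rewrite mulr_ge0// expR_ge0.
have hiG : N.-integrable setT (EFin \o (fun y : R => M * expR (3 * `|y|))).
  apply: (@integrable_exp_growth _ 3 M) => [|y]; last by rewrite ger0_norm.
  apply: measurable_funM => //; apply: measurableT_comp => //.
  exact: measurable_funM.
have hub (b y : R) : `]-1, 1[%classic b -> setT y ->
    `|partial1of2 (fun b x => f x * expR (b * x)) b y| <= M * expR (3 * `|y|).
  by rewrite /= in_itv/= -ltr_norml => b1 _; rewrite D1; exact: bnd3.
have h1 := derivable_under_integral measurableT Ia hint hder hG hiG hub.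
have h2 := differentiation_under_integral measurableT Ia hint hder hG hiG hub.
apply: DeriveDef; first exact: h1.
rewrite -derive1E h2; apply: eq_Rintegral => y _; exact: D1.
Qed.

End NormalMoments.

Section NormalMoments.
Context {R : realType} (s : R) (s0 : s != 0).
Local Notation N := (normal_prob 0 s).

Let integral_expRE (a : R) : \int[N]_x (1 * expR (a * x)) = expR (a ^+ 2 * s ^+ 2 / 2).
Proof.
rewrite /Rintegral; under eq_integral do rewrite mul1r.
by rewrite integral_expR_normal_prob.
Qed.

Let mcst1 : measurable_fun setT (fun _ : R => 1 : R). Proof. by []. Qed.

Let cst1_le (x : R) : `|(fun _ : R => 1 : R) x| <= 1 * expR `|x|.
Proof. by rewrite normr1 mul1r -expR0 ler_expR. Qed.

Let is_derive_gauss (a : R) : is_derive a (1 : R) (fun a : R => expR (a ^+ 2 * s ^+ 2 / 2))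
  (a * s ^+ 2 * expR (a ^+ 2 * s ^+ 2 / 2)).
Proof.
apply: is_derive_eq.
by rewrite /GRing.scale/=; field.
Qed.

Let integral_id_expR (a : R) : `|a| < 1 ->
  \int[N]_x (x * expR (a * x)) = a * s ^+ 2 * expR (a ^+ 2 * s ^+ 2 / 2).
Proof.
move=> a1.
have h := is_derive_integral_expR s0 mcst1 cst1_le a1.
have e : (fun a : R => \int[N]_x (1 * expR (a * x))) = (fun a : R => expR (a ^+ 2 * s ^+ 2 / 2)).
  by apply/funext => b; exact: integral_expRE.
rewrite e in h.
have := @derive_val _ _ _ _ _ _ _ (is_derive_gauss a); rewrite (@derive_val _ _ _ _ _ _ _ h) => <-.
by apply: eq_Rintegral => x _; rewrite mulr1.
Qed.

Lemma Rintegral_normal_prob_id : \int[N]_x x = 0.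
Proof.
have := @integral_id_expR 0; rewrite normr0 => /(_ ltr01); rewrite !mul0r; apply: etrans.
by apply: eq_Rintegral => x _; rewrite mul0r expR0 mulr1.
Qed.

(** Second derivative of the Laplace transform at 0: [integral_id_expR] gives the first derivative
    near 0, and differentiating it there in two ways gives both sides. *)
Lemma Rintegral_normal_prob_sqr : \int[N]_x (x ^+ 2) = s ^+ 2.
Proof.
have bid (x : R) : `|x| <= 1 * expR `|x| by rewrite mul1r le_id_expR.
have h := @is_derive_integral_expR _ _ s0 id 1 0 (@measurable_id _ _ _) bid.
rewrite normr0 in h; have {}h := h ltr01.
have h2 : is_derive (0 : R) (1 : R) (fun a : R => a * s ^+ 2 * expR (a ^+ 2 * s ^+ 2 / 2)) (s ^+ 2).
  apply: is_derive_eq; rewrite /GRing.scale/= expr0n !mul0r expR0; ring.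
transitivity (\int[N]_x (x * id x * expR (0 * x))).
  by apply: eq_Rintegral => x _; rewrite mul0r expR0 mulr1 expr2.
rewrite -(@derive_val _ _ _ _ _ _ _ h) -(@derive_val _ _ _ _ _ _ _ h2).
apply: near_eq_derive.
near=> a; apply: integral_id_expR.
near: a.
have := @nbhsx_ballx R R 0 1 ltr01; apply: filterS => a.
by rewrite /ball/= sub0r normrN.
Unshelve. all: by end_near. Qed.

Let mtrig (f : R -> R) (th t : R) : measurable_fun setT f ->
  measurable_fun setT (fun x : R => f (t * x + th)).
Proof.
by move=> mf; apply: measurableT_comp => //; apply: measurable_funD.
Qed.

Let mcos : measurable_fun setT (@cos R).
Proof. exact: continuous_measurable_fun (@continuous_cos R). Qed.

Let msin : measurable_fun setT (@sin R).
Proof. exact: continuous_measurable_fun (@continuous_sin R). Qed.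

Let H (th t : R) := \int[N]_x cos (t * x + th).

Let integrable_bnd (f : R -> R) (M : R) : measurable_fun setT f ->
  (forall x, `|f x| <= M) -> N.-integrable setT (EFin \o f).
Proof.
move=> mf fM; apply: (@integrable_exp_growth _ _ s0 f 0 M) => // x.
by rewrite mul0r expR0 mulr1.
Qed.

(** Stein's identity for the sine, read off by differentiating the shifted mean at a = 0. The
    function 1 + sin stands in for the sine because the shift formula is stated for nonnegative
    integrands. *)
Let integral_id_sin (th t : R) : \int[N]_x (x * sin (t * x + th)) = t * s ^+ 2 * H th t.
Proof.
pose f x := 1 + sin (t * x + th).
have mf : measurable_fun setT f.
  by apply: measurable_funD => //; exact: mtrig.
have isin : N.-integrable setT (EFin \o (fun x : R => sin (t * x + th))).
  by apply: (@integrable_bnd _ 1) => [|x]; [exact: mtrig|rewrite ler_norml sin_geN1 sin_le1].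
have icos : N.-integrable setT (EFin \o (fun x : R => cos (t * x + th))).
  by apply: (@integrable_bnd _ 1) => [|x]; [exact: mtrig|rewrite ler_norml cos_geN1 cos_le1].
have f0 x : 0 <= f x by rewrite /f; have := sin_geN1 (t * x + th); lra.
have f2 x : `|f x| <= 2.
  by rewrite ger0_norm// /f; have := sin_le1 (t * x + th); lra.
have fM x : `|f x| <= 2 * expR `|x|.
  by rewrite (le_trans (f2 x))// ler_peMr// -expR0 ler_expR.
have h := @is_derive_integral_expR _ _ s0 f 2 0 mf fM.
rewrite normr0 in h; have {}h := h ltr01.
have cf : continuous f.
  move=> x; apply: cvgD; first exact: cvg_cst.
  apply: (@cvg_comp _ _ _ (fun x => t * x + th) sin); last exact: continuous_sin.
  by apply: cvgD; [apply: cvgM; [exact: cvg_cst|exact: cvg_id]|exact: cvg_cst].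
pose G (a : R) := 1 + (sin (t * (a * s ^+ 2)) * H th t + cos (t * (a * s ^+ 2)) * \int[N]_x sin (t * x + th)).
have intN1 : \int[N]_x 1 = 1.
  rewrite Rintegral_cst// mul1r.
  by have -> : fine (N setT) = fine 1%E by congr fine; exact: integral_normal_pdf.
have e a : \int[N]_x (f x * expR (a * x)) = expR (a ^+ 2 * s ^+ 2 / 2) * G a.
  have tr := normal_prob_translation s0 a f0 cf.
  have e1 : \int[N]_x f (x + a * s ^+ 2) = G a.
    transitivity (\int[N]_x (1 + (sin (t * (a * s ^+ 2)) * cos (t * x + th) + cos (t * (a * s ^+ 2)) * sin (t * x + th)))).
      apply: eq_Rintegral => x _; rewrite /f.
      have -> : t * (x + a * s ^+ 2) + th = t * (a * s ^+ 2) + (t * x + th) by ring.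
      by rewrite sinD.
    rewrite RintegralD//; first last.
    - apply: (@integrable_bnd _ 2) => [|x].
        by apply: measurable_funD; apply: measurable_funM => //; exact: mtrig.
      rewrite (le_trans (ler_normD _ _))// !normrM.
      rewrite (_ : 2 = 1 + 1)//; apply: lerD; apply: mulr_ile1 => //;
        by rewrite ler_norml ?sin_geN1 ?sin_le1 ?cos_geN1 ?cos_le1.
    - by apply: (@integrable_bnd _ 1) => // x; rewrite normr1.
    rewrite intN1 RintegralD//; last 2 first.
    - apply: (@integrable_bnd _ 1) => [|x].
        by apply: measurable_funM => //; exact: mtrig.
      by rewrite normrM; apply: mulr_ile1 => //; rewrite ler_norml ?sin_geN1 ?sin_le1 ?cos_geN1 ?cos_le1.
    - apply: (@integrable_bnd _ 1) => [|x].
        by apply: measurable_funM => //; exact: mtrig.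
      by rewrite normrM; apply: mulr_ile1 => //; rewrite ler_norml ?sin_geN1 ?sin_le1 ?cos_geN1 ?cos_le1.
    by rewrite !RintegralZl.
  have e2 : \int[N]_x f (x + a * s ^+ 2) = \int[N]_x (f x * expR (a * x - a ^+ 2 * s ^+ 2 / 2)).
    by rewrite /Rintegral tr.
  rewrite -e1 e2 -RintegralZl//; last first.
    apply: (@integrable_exp_growth _ _ s0 _ `|a| 2).
      apply: measurable_funM => //; apply: measurableT_comp => //.
      by apply: measurable_funB => //; exact: measurable_funM.
    move=> x; rewrite normrM; apply: ler_pM => //.
    rewrite (ger0_norm (expR_ge0 _)) ler_expR (@le_trans _ _ (a * x))//.
      by rewrite gerBl// mulr_ge0// mulr_ge0// sqr_ge0.
    by rewrite (le_trans (ler_norm _))// normrM.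
  by apply: eq_Rintegral => x _; rewrite mulrCA -expRD addrC subrK.
have hG : is_derive (0 : R) (1 : R) (fun a => expR (a ^+ 2 * s ^+ 2 / 2) * G a) (t * s ^+ 2 * H th t).
  rewrite /G; apply: is_derive_eq.
  rewrite /GRing.scale/= !(mul0r, mulr0) expr0n !(mul0r, mulr0) expR0 sin0 cos0; ring.
have e' := funext e; rewrite e' in h.
have := @derive_val _ _ _ _ _ _ _ hG; rewrite (@derive_val _ _ _ _ _ _ _ h) => <-.
have iid : N.-integrable setT (EFin \o (fun x : R => x)).
  by apply: (@integrable_exp_growth _ _ s0 _ 1 1) => // x; rewrite !mul1r le_id_expR.
transitivity (\int[N]_x (x + x * sin (t * x + th))); last first.
  by apply: eq_Rintegral => x _; rewrite mul0r expR0 mulr1 /f mulrDr mulr1.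
rewrite RintegralD//; first by rewrite Rintegral_normal_prob_id add0r.
apply: (@integrable_exp_growth _ _ s0 _ 1 1).
  by apply: measurable_funM => //; exact: mtrig.
move=> x; rewrite normrM mulrC !mul1r -[leRHS]mul1r; apply: ler_pM => //.
  by rewrite ler_norml sin_geN1 sin_le1.
exact: le_id_expR.
Qed.

(** The transform satisfies H' = - u s^2 H, so H(u) exp(u^2 s^2 / 2) is constant, equal to its value
    cos th at 0. *)
Lemma Rintegral_normal_prob_cos (th t : R) :
  \int[N]_x cos (t * x + th) = cos th * expR (- (t ^+ 2 * s ^+ 2 / 2)).
Proof.
have dH (u : R) : is_derive u (1 : R) (H th) (- (u * s ^+ 2 * H th u)).
  have Iu : `]u - 1, u + 1[%classic u by rewrite /= in_itv/= ltrBlDr ltrDl ltr01.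
  have D (b y : R) : is_derive b (1 : R) (fun b : R => cos (b * y + th)) (- (y * sin (b * y + th))).
    by apply: is_derive_eq; rewrite /GRing.scale/=; ring.
  have D1 (b y : R) : partial1of2 (fun b x => cos (b * x + th)) b y = - (y * sin (b * y + th)).
    by rewrite partial1of2E; exact: derive_val.
  have hint (b : R) : `]u - 1, u + 1[%classic b -> N.-integrable setT (EFin \o (fun x => cos (b * x + th))).
    by move=> _; apply: (@integrable_bnd _ 1) => [|x]; [exact: mtrig|rewrite ler_norml cos_geN1 cos_le1].
  have hder (b y : R) : `]u - 1, u + 1[%classic b -> setT y -> derivable ((fun b x => cos (b * x + th)) ^~ y) b 1.
    by move=> _ _; exact: ex_derive.
  have hG (y : R) : 0 <= expR `|y| by exact: expR_ge0.
  have hiG : N.-integrable setT (EFin \o (fun y : R => expR `|y|)).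
    apply: (@integrable_exp_growth _ _ s0 _ 1 1) => [|y]; last by rewrite ger0_norm// !mul1r.
    exact: measurableT_comp.
  have hub (b y : R) : `]u - 1, u + 1[%classic b -> setT y ->
      `|partial1of2 (fun b x => cos (b * x + th)) b y| <= expR `|y|.
    move=> _ _; rewrite D1 normrN normrM -[leRHS]mulr1; apply: ler_pM => //.
      exact: le_id_expR.
    by rewrite ler_norml sin_geN1 sin_le1.
  have h1 := derivable_under_integral measurableT Iu hint hder hG hiG hub.
  have h2 := differentiation_under_integral measurableT Iu hint hder hG hiG hub.
  apply: DeriveDef; first exact: h1.
  rewrite -derive1E h2 -integral_id_sin -mulN1r -RintegralZl//.
    by apply: eq_Rintegral => y _; rewrite mulN1r; exact: D1.
  apply: (@integrable_exp_growth _ _ s0 _ 1 1) => [|x].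
    by apply: measurable_funM => //; exact: mtrig.
  rewrite normrM !mul1r -[leRHS]mulr1; apply: ler_pM => //; first exact: le_id_expR.
  by rewrite ler_norml sin_geN1 sin_le1.
have dK (u : R) : is_derive u (1 : R) (fun u => H th u * expR (u ^+ 2 * s ^+ 2 / 2)) 0.
  have := is_derive_gauss u; have := dH u => d1 d2.
  by apply: is_derive_eq; rewrite /GRing.scale/=; ring.
have := is_derive_0_is_cst t 0 dK.
rewrite expr0n !mul0r expR0 mulr1 => K.
have H0 : H th 0 = cos th.
  rewrite /H; transitivity (\int[N]_x cos th).
    by apply: eq_Rintegral => x _; rewrite mul0r add0r.
  rewrite Rintegral_cst//.
  have -> : fine (N setT) = fine 1%E by congr fine; exact: integral_normal_pdf.
  by rewrite mulr1.
rewrite -/(H th t); set q := t ^+ 2 * s ^+ 2 / 2 in K *.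
have -> : H th t = H th t * expR q * expR (- q).
  by rewrite -mulrA -expRD subrr expR0 mulr1.
by rewrite K H0.
Qed.

End NormalMoments.

Section GaussianVariable.
Context {R : realType} {dsp : measure_display} {W : measurableType dsp}
  (P : probability W R) (Y : W -> R) (s : R).
Hypothesis mY : measurable_fun setT Y.
Hypothesis YN : forall B, measurable B -> P [set w | B (Y w)] = centered_normal s B.

Let ge0_transfer (f : R -> \bar R) : s != 0 -> measurable_fun setT f ->
  (forall x, (0 <= f x)%E) ->
  (\int[P]_w f (Y w) = \int[normal_prob 0 s]_x f x)%E.
Proof.
move=> s0 mf f0.
rewrite -[LHS](@ge0_integral_pushforward _ _ W (measurableTypeR R) R Y mY P setT f)//.
apply: eq_measure_integral => A mA _.
by apply: etrans (YN mA) _; rewrite /centered_normal (negbTE s0).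
Qed.

Let ge0_transfer0 (f : R -> \bar R) : s = 0 -> measurable_fun setT f ->
  (forall x, (0 <= f x)%E) -> (\int[P]_w f (Y w) = f 0%R)%E.
Proof.
move=> s0 mf f0.
rewrite -[LHS](@ge0_integral_pushforward _ _ W (measurableTypeR R) R Y mY P setT f)//.
transitivity (\int[\d_((0:R)%R : measurableTypeR R)]_x f x)%E.
  apply: eq_measure_integral => A mA _.
  by apply: etrans (YN mA) _; rewrite /centered_normal s0 eqxx.
by rewrite integral_dirac// diracT mul1e.
Qed.

Let transfer (f : R -> R) : s != 0 -> measurable_fun setT f ->
  (normal_prob 0 s).-integrable setT (EFin \o f) ->
  P.-integrable setT (fun w => (f (Y w))%:E) /\
  \int[P]_w f (Y w) = \int[normal_prob 0 s]_x f x.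
Proof.
move=> s0 mf fi.
have mf' : measurable_fun setT (EFin \o f) by exact/measurable_EFinP.
have iP : P.-integrable setT (fun w => (f (Y w))%:E).
  apply/integrableP; split; first by apply/measurable_EFinP; exact: measurableT_comp.
  have := @ge0_transfer (fun x => `|(f x)%:E|%E) s0 (measurableT_comp (@abse_measurable _ _) mf') (fun x => abse_ge0 _) => /= ->.
  by have /integrableP[] := fi.
split => //; rewrite /Rintegral; congr fine.
rewrite -[LHS](@integral_pushforward _ _ W (measurableTypeR R) R Y mY P setT (EFin \o f))//.
apply: eq_measure_integral => A mA _.
by apply: etrans (YN mA) _; rewrite /centered_normal (negbTE s0).
Qed.

Let P1 : fine (P setT) = 1. Proof. by rewrite probability_setT. Qed.

Let as0 (f : R -> R) : s = 0 -> measurable_fun setT f ->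
  P.-integrable setT (fun w => (f (Y w))%:E) /\ \int[P]_w f (Y w) = f 0.
Proof.
move=> s0 mf.
have mf' : measurable_fun setT (EFin \o f) by exact/measurable_EFinP.
have iP : P.-integrable setT (fun w => (f (Y w))%:E).
  apply/integrableP; split; first by apply/measurable_EFinP; exact: measurableT_comp.
  have := @ge0_transfer0 (fun x => `|(f x)%:E|%E) s0 (measurableT_comp (@abse_measurable _ _) mf') (fun x => abse_ge0 _) => /= ->.
  by rewrite ltry.
split => //; rewrite /Rintegral; transitivity (fine (f 0)%:E) => //; congr fine.
rewrite -[LHS](@integral_pushforward _ _ W (measurableTypeR R) R Y mY P setT (EFin \o f))//.
transitivity (\int[\d_((0:R)%R : measurableTypeR R)]_x (EFin \o f) x)%E.
  apply: eq_measure_integral => A mA _.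
  by apply: etrans (YN mA) _; rewrite /centered_normal s0 eqxx.
by rewrite integral_dirac// diracT mul1e.
Qed.

Lemma gaussian_cos (th : R) :
  \int[P]_w cos (Y w + th) = cos th * expR (- (s ^+ 2 / 2)).
Proof.
have mc : measurable_fun setT (fun x : R => cos (x + th)).
  apply: measurableT_comp; first exact: continuous_measurable_fun (@continuous_cos R).
  exact: measurable_funD.
have [s0|s0] := eqVneq s 0.
  by rewrite (as0 s0 mc).2 add0r s0 expr0n mul0r oppr0 expR0 mulr1.
rewrite (transfer s0 mc _).2.
  have := Rintegral_normal_prob_cos s0 th 1; rewrite expr1n mul1r => <-.
  by apply: eq_Rintegral => x _; rewrite mul1r.
apply: (@integrable_exp_growth _ _ s0 _ 0 1) => // x.
by rewrite mul0r expR0 mulr1 ler_norml cos_geN1 cos_le1.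
Qed.

Lemma gaussian_id : P.-integrable setT (fun w => (Y w)%:E) /\ \int[P]_w Y w = 0.
Proof.
have [s0|s0] := eqVneq s 0; first exact: (@as0 id).
have [h1 h2] := @transfer id s0 (@measurable_id _ _ _) (@integrable_exp_growth _ _ s0 _ 1 1 (@measurable_id _ _ _) (fun x => ltac:(by rewrite !mul1r le_id_expR))).
split => //; exact: etrans h2 (Rintegral_normal_prob_id s0).
Qed.

Lemma gaussian_sqr : P.-integrable setT (fun w => (Y w ^+ 2)%:E) /\
  \int[P]_w (Y w ^+ 2) = s ^+ 2.
Proof.
have ms : measurable_fun setT (fun x : R => x ^+ 2) by exact: measurable_funX.
have [s0|s0] := eqVneq s 0.
  by have [h1 h2] := as0 s0 ms; split => //; rewrite h2 s0.
have [|h1 h2] := @transfer (fun x => x ^+ 2) s0 ms.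
  apply: (@integrable_exp_growth _ _ s0 _ 2 1) => // x.
  have -> : 2 * `|x| = `|x| + `|x| by ring.
  rewrite mul1r expRD expr2 normrM; apply: ler_pM => //; exact: le_id_expR.
by split => //; rewrite h2 Rintegral_normal_prob_sqr.
Qed.

(** Replacing lam by s only raises the exponent; at s the mean is sqrt 2, and in the degenerate case
    it is 1. *)
Lemma gaussian_expR_sqr (lam : R) : 0 < lam -> s ^+ 2 <= lam ^+ 2 ->
  (\int[P]_w (expR (Y w ^+ 2 / (4 * lam ^+ 2)))%:E <= 2%:E)%E.
Proof.
move=> l0 sl.
have mf (c : R) : measurable_fun setT (fun x : R => (expR (x ^+ 2 / (4 * c ^+ 2)))%:E).
  apply/measurable_EFinP; apply: measurableT_comp => //; exact: measurable_funM.
have [s0|s0] := eqVneq s 0.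
  rewrite (@ge0_transfer0 (fun x => (expR (x ^+ 2 / (4 * lam ^+ 2)))%:E))//.
  by rewrite expr0n mul0r expR0 lee_fin ler1n.
rewrite (@ge0_transfer (fun x => (expR (x ^+ 2 / (4 * lam ^+ 2)))%:E))//.
apply: (@le_trans _ _ (\int[normal_prob 0 s]_x (expR (x ^+ 2 / (4 * s ^+ 2)))%:E)%E).
  apply: ge0_le_integral => //; [exact: mf|exact: mf|].
  move=> x _; rewrite lee_fin ler_expR ler_wpM2l ?sqr_ge0// lef_pV2 ?posrE.
  - by rewrite ler_wpM2l.
  - by rewrite mulr_gt0// exprn_gt0.
  - by rewrite mulr_gt0// exprn_even_gt0.
rewrite ge0_integral_normal_prob_expR_sqr// lee_fin.
rewrite -[leRHS]ger0_norm// -sqrtr_sqr ler_wsqrtr// expr2; lra.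
Qed.

End GaussianVariable.

(** * Borel measurability of matrix-valued maps *)

Section MatrixMeasurability.
Context {R : realType} {m n : nat}.

Lemma mx_nbhsP (M : 'M[R]_(m, n)) (A : set 'M[R]_(m, n)) :
  nbhs M A <-> exists2 e : R, 0 < e & forall N : 'M[R]_(m, n),
    (forall i j, `|M i j - N i j| < e) -> A N.
Proof.
split.
  move=> /nbhs_ballP[e /= e0 eA]; exists e => // N MN; apply: eA.
  by split => // i j; exact: MN.
move=> [e e0 eA]; apply/nbhs_ballP; exists e => //= N [_ MN].
by apply: eA => i j; exact: MN.
Qed.

Lemma measurable_coord i j : measurable_fun setT (fun M : 'M[R]_(m, n) => M i j).
Proof.
apply: (measurability _ (RGenOInfty.measurableE R)) => /= _ [_ [a ->]] <-.
rewrite setTI; apply: sub_sigma_algebra => /=.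
rewrite openE => M /=; rewrite in_itv/= andbT => aM; apply/mx_nbhsP.
exists (M i j - a); first by rewrite subr_gt0.
move=> N /(_ i j) /(le_lt_trans (ler_norm _)).
by move=> h; rewrite /= in_itv/= andbT; lra.
Qed.

(** An open set is a countable union of boxes with rational centre and radius 1 / (k + 1), and the
    preimage of a box is a finite intersection of conditions on single entries. *)
Lemma measurable_mx {dsp} {T : measurableType dsp} (f : T -> 'M[R]_(m, n)) :
  (forall i j, measurable_fun setT (fun w => f w i j)) -> measurable_fun setT f.
Proof.
move=> mf.
apply: (measurability _ (erefl : @measurable _ 'M[R]_(m, n) = <<s @open 'M[R]_(m, n) >>)).
move=> /= _ [A oA] <-; rewrite setTI.
pose box (Qk : 'M[rat]_(m, n) * nat) : set 'M[R]_(m, n) :=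
  [set N | forall i j, `|ratr (Qk.1 i j) - N i j| < Qk.2.+1%:R^-1].
have mbox Qk : measurable (f @^-1` box Qk).
  have -> : f @^-1` box Qk = \big[setI/setT]_(ij : 'I_m * 'I_n)
      [set w | `|ratr (Qk.1 ij.1 ij.2) - f w ij.1 ij.2| < Qk.2.+1%:R^-1].
    rewrite -bigcap_seq; apply/seteqP; split => w.
      by move=> h ij _; exact: h.
    by move=> h i j; apply: (h (i, j)); exact: mem_index_enum.
  apply: bigsetI_measurable => ij _.
  have mg : measurable_fun setT (fun w => `|ratr (Qk.1 ij.1 ij.2) - f w ij.1 ij.2|).
    by apply: measurableT_comp => //; apply: measurable_funB.
  have := mg measurableT _ (measurable_itv `]-oo, Qk.2.+1%:R^-1[).
  by rewrite setTI; congr measurable; apply/seteqP; split => w /=; rewrite in_itv.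
have -> : f @^-1` A = \bigcup_(Qk in [set Qk | box Qk `<=` A]) (f @^-1` box Qk).
  apply/seteqP; split => w /=; last by move=> [Qk QA bw]; exact: QA.
  move=> Aw; have /mx_nbhsP[e e0 eA] : nbhs (f w) A by apply: open_nbhs_nbhs.
  have e20 : 0 < e / 2 by rewrite divr_gt0.
  have [k ke] := filter_ex (near_infty_natSinv_lt (PosNum e20)).
  have k0 : (0 : R) < k.+1%:R^-1 by rewrite invr_gt0.
  have hq i j : exists q : rat, `|ratr q - f w i j| < k.+1%:R^-1.
    have [|q] := @rat_in_itvoo R (f w i j - k.+1%:R^-1) (f w i j + k.+1%:R^-1).
      by rewrite ltrBlDr -addrA ltrDl addr_gt0.
    by rewrite in_itv/= => qh; exists q; rewrite ltr_distl.
  pose Q : 'M[rat]_(m, n) := \matrix_(i, j) sval (cid (hq i j)).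
  have hQ i j : `|ratr (Q i j) - f w i j| < k.+1%:R^-1.
    by rewrite mxE; case: cid.
  exists (Q, k) => //= N NQ; apply: eA => i j.
  have h1 : `|ratr (Q i j) - N i j| < k.+1%:R^-1 := NQ i j.
  have h2 : `|f w i j - ratr (Q i j)| < k.+1%:R^-1 by rewrite distrC.
  have h3 : k.+1%:R^-1 < e / 2 := ke.
  apply: le_lt_trans (ler_distD (ratr (Q i j)) (f w i j) (N i j)) _.
  by rewrite [ltRHS](splitr e) ltrD// (lt_trans _ h3).
rewrite bigcup_mkcond; apply: countable_bigcupT_measurable => [|Qk].
  exact: countableP.
by case: ifPn.
Qed.

Lemma open_measurable_mx (A : set 'M[R]_(m, n)) : open A -> measurable A.
Proof. by move=> oA; exact: sub_sigma_algebra. Qed.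

Lemma closed_measurable_mx (A : set 'M[R]_(m, n)) : closed A -> measurable A.
Proof. by rewrite -openC => /open_measurable_mx/measurableC; rewrite setCK. Qed.

End MatrixMeasurability.

Section VectorMeasurability.
Context {R : realType} {dsp : measure_display} {T : measurableType dsp}.

Lemma measurable_entry {m n : nat} (f : T -> 'M[R]_(m, n)) i j :
  measurable_fun setT f -> measurable_fun setT (fun w => f w i j).
Proof. by move=> mf; exact: measurableT_comp (measurable_coord i j) mf. Qed.

Lemma measurable_dot {d : nat} (f g : T -> 'cV[R]_d) :
  measurable_fun setT f -> measurable_fun setT g ->
  measurable_fun setT (fun w => dot (f w) (g w)).
Proof.
move=> mf mg; under eq_fun do rewrite dotE.
by apply: measurable_sum => i; apply: measurable_funM; exact: measurable_entry.
Qed.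

Lemma measurable_mulmx {m n p : nat} (f : T -> 'M[R]_(m, n)) (g : T -> 'M[R]_(n, p)) :
  measurable_fun setT f -> measurable_fun setT g ->
  measurable_fun setT (fun w => f w *m g w).
Proof.
move=> mf mg; apply: measurable_mx => i j; under eq_fun do rewrite mxE.
by apply: measurable_sum => k; apply: measurable_funM; exact: measurable_entry.
Qed.

Lemma measurable_addmx {m n : nat} (f g : T -> 'M[R]_(m, n)) :
  measurable_fun setT f -> measurable_fun setT g ->
  measurable_fun setT (fun w => f w + g w).
Proof.
move=> mf mg; apply: measurable_mx => i j; under eq_fun do rewrite mxE.
by apply: measurable_funD; exact: measurable_entry.
Qed.

Lemma measurable_oppmx {m n : nat} (f : T -> 'M[R]_(m, n)) :
  measurable_fun setT f -> measurable_fun setT (fun w => - f w).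
Proof.
move=> mf; apply: measurable_mx => i j; under eq_fun do rewrite mxE.
by apply: measurableT_comp => //; exact: measurable_entry.
Qed.

Lemma measurable_scalemx {m n : nat} (a : T -> R) (f : T -> 'M[R]_(m, n)) :
  measurable_fun setT a -> measurable_fun setT f ->
  measurable_fun setT (fun w => a w *: f w).
Proof.
move=> ma mf; apply: measurable_mx => i j; under eq_fun do rewrite mxE.
by apply: measurable_funM => //; exact: measurable_entry.
Qed.

Lemma measurable_summx {m n k : nat} (r : seq 'I_k) (Q : pred 'I_k)
    (f : 'I_k -> T -> 'M[R]_(m, n)) :
  (forall i, measurable_fun setT (f i)) ->
  measurable_fun setT (fun w => \sum_(i <- r | Q i) f i w).
Proof.
move=> mf; apply: measurable_mx => i j; under eq_fun do rewrite summxE big_mkcond.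
apply: measurable_sum => l; case: (Q l) => //; exact: measurable_entry.
Qed.

Lemma measurable_qf {d : nat} (M : T -> 'M[R]_d) (u : T -> 'cV[R]_d) :
  measurable_fun setT M -> measurable_fun setT u ->
  measurable_fun setT (fun w => qf (M w) (u w)).
Proof.
move=> mM mu; under eq_fun do rewrite qfE.
by apply: measurable_dot => //; exact: measurable_mulmx.
Qed.

Lemma measurable_lpnorm {d : nat} (p : \bar R) (f : T -> 'cV[R]_d) :
  measurable_fun setT f -> measurable_fun setT (fun w => lpnorm p (f w)).
Proof.
move=> mf; case: p => [r| |] //=.
- apply: (measurableT_comp (@measurable_powR R r^-1)).
  apply: measurable_sum => i; apply: (measurableT_comp (@measurable_powR R r)).
  by apply: measurableT_comp => //; exact: measurable_entry.
- elim: (index_enum _) => [|i s ih]; first by under eq_fun do rewrite big_nil; exact: measurable_cst.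
  under eq_fun do rewrite big_cons; apply: measurable_maxr => //.
  by apply: measurableT_comp => //; exact: measurable_entry.
Qed.

End VectorMeasurability.

(** * Gaussian smoothing of trigonometric polynomials *)
Section RintegralExtra.
Context {R : realType} {dsp : measure_display} {W : measurableType dsp}
  (P : probability W R).
Implicit Types f g : W -> R.

Lemma integrable_EFinD f g : P.-integrable setT (EFin \o f) ->
  P.-integrable setT (EFin \o g) -> P.-integrable setT (EFin \o (fun w => f w + g w)).
Proof.
move=> fi gi; rewrite (_ : EFin \o _ = ((EFin \o f) \+ (EFin \o g))%E) //.
exact: integrableD.
Qed.

Lemma integrable_EFinZ (a : R) f : P.-integrable setT (EFin \o f) ->
  P.-integrable setT (EFin \o (fun w => a * f w)).
Proof.
move=> fi; rewrite (_ : EFin \o _ = (fun w => a%:E * (EFin \o f) w)%E) //.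
exact: integrableZl.
Qed.

Lemma integrable_EFinB f g : P.-integrable setT (EFin \o f) ->
  P.-integrable setT (EFin \o g) -> P.-integrable setT (EFin \o (fun w => f w - g w)).
Proof.
move=> fi gi; rewrite (_ : EFin \o _ = ((EFin \o f) \- (EFin \o g))%E) //.
exact: integrableB.
Qed.

Lemma integrable_EFin_sum (I : Type) (r : seq I) (f : I -> W -> R) :
  (forall i, P.-integrable setT (EFin \o f i)) ->
  P.-integrable setT (EFin \o (fun w => \sum_(i <- r) f i w)).
Proof.
move=> fi; elim: r => [|i r ih].
  rewrite [X in P.-integrable _ X](_ : _ = cst 0%E); first exact: integrable0.
  by apply/funext => w; rewrite /= big_nil.
rewrite [X in P.-integrable _ X](_ : _ = EFin \o (fun w => f i w + \sum_(j <- r) f j w)).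
  exact: integrable_EFinD.
by apply/funext => w; rewrite /= big_cons.
Qed.

Lemma Rintegral_sum (I : Type) (r : seq I) (f : I -> W -> R) :
  (forall i, P.-integrable setT (EFin \o f i)) ->
  \int[P]_w (\sum_(i <- r) f i w) = \sum_(i <- r) \int[P]_w f i w.
Proof.
move=> fi; elim: r => [|i r ih].
  rewrite big_nil; transitivity (\int[P]_w (0 : R)).
    by apply: eq_Rintegral => w _; rewrite big_nil.
  by rewrite Rintegral_cst// mul0r.
rewrite big_cons -ih -RintegralD//; last exact: integrable_EFin_sum.
by apply: eq_Rintegral => w _; rewrite big_cons.
Qed.

Lemma Rintegral_prob_cst (a : R) : \int[P]_w a = a.
Proof.
rewrite Rintegral_cst//; have -> : fine (P setT) = fine 1%E by congr fine; exact: probability_setT.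
by rewrite mulr1.
Qed.

Lemma integrable_bounded f (M : R) : measurable_fun setT f ->
  (forall w, `|f w| <= M) -> P.-integrable setT (EFin \o f).
Proof.
move=> mf fM; have iM : P.-integrable setT (EFin \o cst M) by exact: finite_measure_integrable_cst.
apply: (le_integrable measurableT _ _ iM); first exact/measurable_EFinP.
by move=> w _; rewrite /= lee_fin (le_trans (fM w))// ler_norm.
Qed.

Lemma integrable_le f g : measurable_fun setT f -> P.-integrable setT (EFin \o g) ->
  (forall w, `|f w| <= g w) -> P.-integrable setT (EFin \o f).
Proof.
move=> mf gi fg; apply: (le_integrable measurableT _ _ gi).
- exact/measurable_EFinP.
- by move=> w _; rewrite /= lee_fin (le_trans (fg w))// ler_norm.
Qed.

Lemma le_RintegralT f g : P.-integrable setT (EFin \o f) ->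
  P.-integrable setT (EFin \o g) -> (forall w, f w <= g w) ->
  \int[P]_w f w <= \int[P]_w g w.
Proof. by move=> fi gi fg; apply: le_Rintegral. Qed.

Lemma normr_Rintegral_le f (M : R) : measurable_fun setT f ->
  (forall w, `|f w| <= M) -> `|\int[P]_w f w| <= M.
Proof.
move=> mf fM; have fi := integrable_bounded mf fM.
rewrite (le_trans (le_normr_Rintegral _ fi))// -[leRHS]Rintegral_prob_cst.
apply: le_RintegralT => //; last exact: integrable_bounded.
apply: (@integrable_bounded _ M); first exact: measurableT_comp.
by move=> w; rewrite normr_id.
Qed.

End RintegralExtra.

(** * Cosine sums and their Gaussian means *)

Section TrigPoly.
Context {R : realType} {d : nat}.

(* (c, u, th) stands for x |-> c cos(u.x + th). *)
Definition trig := seq (R * 'cV[R]_d * R).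
Implicit Types (f : trig) (M V : 'M[R]_d) (x y : 'cV[R]_d).

Definition tcoef M (k : R * 'cV[R]_d * R) : R := k.1.1 * expR (- (qf M k.1.2 / 2)).

(** The damping in [tcoef] is the characteristic function of N(0, M) at the frequency; [tF f 0] is
    the cosine sum itself. *)
Definition tF f M x : R := \sum_(k <- f) tcoef M k * cos (dot k.1.2 x + k.2).

Definition tD1 f M x y : R :=
  \sum_(k <- f) tcoef M k * (- sin (dot k.1.2 x + k.2)) * dot k.1.2 y.

(** The Hessian contracted with V: for V = y y^T it is the second derivative in direction y.
    Linearity in V lets the same expression receive X X^T, a Gaussian outer product or a conditional
    covariance. *)
Definition tD2 f M x V : R :=
  \sum_(k <- f) tcoef M k * (- cos (dot k.1.2 x + k.2)) * qf V k.1.2.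

Definition tnorm f : R := \sum_(k <- f) `|k.1.1|.

Lemma tF0E f x : tF f 0 x = \sum_(k <- f) k.1.1 * cos (dot k.1.2 x + k.2).
Proof.
by apply: eq_bigr => k _; rewrite /tcoef qf0 mul0r oppr0 expR0 mulr1.
Qed.

Lemma normr_tcoef M k : psdmx M -> `|tcoef M k| <= `|k.1.1|.
Proof.
move=> Mp; rewrite normrM (ger0_norm (expR_ge0 _)) ler_piMr// -expR0 ler_expR.
by rewrite oppr_le0 divr_ge0// psdmx_ge0.
Qed.

Lemma normr_cos_le1 (a : R) : `|cos a| <= 1.
Proof. by rewrite ler_norml cos_geN1 cos_le1. Qed.

Lemma normr_sin_le1 (a : R) : `|sin a| <= 1.
Proof. by rewrite ler_norml sin_geN1 sin_le1. Qed.

Lemma normr_tF f M x : psdmx M -> `|tF f M x| <= tnorm f.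
Proof.
move=> Mp; rewrite (le_trans (ler_norm_sum _ _ _))//; apply: ler_sum => k _.
by rewrite normrM -[leRHS]mulr1 ler_pM ?normr_tcoef ?normr_cos_le1.
Qed.

Lemma qf_outer y u : qf (y *m y^T) u = dot u y ^+ 2.
Proof.
by rewrite qfE dotE expr2 {1}dotE mulr_suml; apply: eq_bigr => i _;
   rewrite -mulmxA mxE big_ord1 -/(dot y u) dotC mulrA.
Qed.

Context {dsp : measure_display} {W : measurableType dsp}.

Lemma measurable_cos (a : W -> R) : measurable_fun setT a ->
  measurable_fun setT (fun w => cos (a w)).
Proof. by move=> ma; apply: measurableT_comp ma; exact: continuous_measurable_fun (@continuous_cos R). Qed.

Lemma measurable_sin (a : W -> R) : measurable_fun setT a ->
  measurable_fun setT (fun w => sin (a w)).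
Proof. by move=> ma; apply: measurableT_comp ma; exact: continuous_measurable_fun (@continuous_sin R). Qed.

Lemma measurable_tcoef (M : W -> 'M[R]_d) k : measurable_fun setT M ->
  measurable_fun setT (fun w => tcoef (M w) k).
Proof.
move=> mM; apply: measurable_funM => //; apply: measurableT_comp => //.
apply: measurableT_comp => //; apply: measurable_funM => //.
by apply: measurable_qf => //; exact: measurable_cst.
Qed.

Lemma measurable_tphase (x : W -> 'cV[R]_d) (k : R * 'cV[R]_d * R) :
  measurable_fun setT x -> measurable_fun setT (fun w => dot k.1.2 (x w) + k.2).
Proof.
move=> mx; apply: measurable_funD => //.
by apply: measurable_dot => //; exact: measurable_cst.
Qed.

Lemma measurable_tF f (M : W -> 'M[R]_d) (x : W -> 'cV[R]_d) :
  measurable_fun setT M -> measurable_fun setT x ->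
  measurable_fun setT (fun w => tF f (M w) (x w)).
Proof.
move=> mM mx; apply: measurable_sum => k; apply: measurable_funM.
  exact: measurable_tcoef.
by apply: measurable_cos; exact: measurable_tphase.
Qed.

Context (P : probability W R) (Y : W -> 'cV[R]_d) (S : 'M[R]_d).
Hypothesis (mY : measurable_fun setT Y) (pS : psdmx S) (gY : gaussian_vector P S Y).

Let mYu u : measurable_fun setT (fun w => dot u (Y w)).
Proof. by apply: measurable_dot => //; exact: measurable_cst. Qed.

Let gYu u : forall B, measurable B ->
  P [set w | B (dot u (Y w))] = centered_normal (Num.sqrt (qf S u)) B.
Proof. by move=> B mB; exact: gY. Qed.

Let sqr_var u : Num.sqrt (qf S u) ^+ 2 = qf S u.
Proof. by rewrite sqr_sqrtr// psdmx_ge0. Qed.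

Lemma gaussian_vector_cos u th :
  \int[P]_w cos (dot u (Y w) + th) = cos th * expR (- (qf S u / 2)).
Proof. by have := gaussian_cos (mYu u) (gYu u) th; rewrite sqr_var. Qed.

Lemma integrable_tF f M x : psdmx M ->
  P.-integrable setT (EFin \o (fun w => tF f M (x + Y w))).
Proof.
move=> Mp; apply: (@integrable_bounded _ _ _ _ _ (tnorm f)) => [|w].
  apply: measurable_tF => //; apply: measurable_addmx => //; exact: measurable_cst.
exact: normr_tF.
Qed.

(** Covariances add: averaging a cosine over u.Y multiplies it by exp(- qf S u / 2), and the
    exponents are additive in the matrix. *)
Lemma tF_semigroup f M x : \int[P]_w tF f M (x + Y w) = tF f (M + S) x.
Proof.
have mc (k : R * 'cV[R]_d * R) : measurable_fun setT (fun w => cos (dot k.1.2 (x + Y w) + k.2)).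
  apply: measurable_cos; apply: (@measurable_tphase (fun w => x + Y w)).
  by apply: measurable_addmx => //; exact: measurable_cst.
have ic (k : R * 'cV[R]_d * R) : P.-integrable setT (EFin \o (fun w => cos (dot k.1.2 (x + Y w) + k.2))).
  by apply: (@integrable_bounded _ _ _ _ _ 1) => // w; exact: normr_cos_le1.
rewrite Rintegral_sum => [|k]; last exact: integrable_EFinZ.
apply: eq_bigr => k _; rewrite RintegralZl//.
have -> : \int[P]_w cos (dot k.1.2 (x + Y w) + k.2) = cos (dot k.1.2 x + k.2) * expR (- (qf S k.1.2 / 2)).
  rewrite -gaussian_vector_cos; apply: eq_Rintegral => w _.
  by rewrite dotDr; congr cos; ring.
by rewrite /tcoef qfD mulrDl opprD expRD; ring.
Qed.

Lemma gaussian_vector_dot u : P.-integrable setT (EFin \o (fun w => dot u (Y w))) /\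
  \int[P]_w dot u (Y w) = 0.
Proof. exact: gaussian_id (mYu u) (gYu u). Qed.

Lemma gaussian_vector_dot_sqr u : P.-integrable setT (EFin \o (fun w => dot u (Y w) ^+ 2)) /\
  \int[P]_w (dot u (Y w) ^+ 2) = qf S u.
Proof. by have := gaussian_sqr (mYu u) (gYu u); rewrite sqr_var. Qed.

Lemma gaussian_vector_tD1 f M x :
  P.-integrable setT (EFin \o (fun w => tD1 f M x (Y w))) /\
  \int[P]_w tD1 f M x (Y w) = 0.
Proof.
have i k := integrable_EFinZ (tcoef M k * - sin (dot k.1.2 x + k.2)) (gaussian_vector_dot k.1.2).1.
split; first exact: integrable_EFin_sum.
rewrite Rintegral_sum// big1// => k _; rewrite RintegralZl//; last exact: (gaussian_vector_dot _).1.
by rewrite (gaussian_vector_dot _).2 mulr0.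
Qed.

Lemma gaussian_vector_tD2 f M x :
  P.-integrable setT (EFin \o (fun w => tD2 f M x (Y w *m (Y w)^T))) /\
  \int[P]_w tD2 f M x (Y w *m (Y w)^T) = tD2 f M x S.
Proof.
have e : (fun w => tD2 f M x (Y w *m (Y w)^T)) = (fun w => \sum_(k <- f)
    tcoef M k * - cos (dot k.1.2 x + k.2) * dot k.1.2 (Y w) ^+ 2).
  by apply/funext => w; apply: eq_bigr => k _; rewrite qf_outer.
rewrite e.
have i k := integrable_EFinZ (tcoef M k * - cos (dot k.1.2 x + k.2)) (gaussian_vector_dot_sqr k.1.2).1.
split; first exact: integrable_EFin_sum.
rewrite Rintegral_sum//; apply: eq_bigr => k _.
rewrite RintegralZl//; last exact: (gaussian_vector_dot_sqr _).1.
by rewrite (gaussian_vector_dot_sqr _).2.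
Qed.

End TrigPoly.

Lemma gaussian_vector_mulmx {R : realType} {d : nat} {dsp : measure_display}
    {W : measurableType dsp} (P : probability W R) (Y : W -> 'cV[R]_d) (B S : 'M[R]_d) :
  gaussian_vector P S Y -> gaussian_vector P (B *m S *m B^T) (fun w => B *m Y w).
Proof.
move=> gY u A mA; have := gY (B^T *m u) A mA.
by rewrite !trmx_mul trmxK !mulmxA; under eq_set do rewrite -mulmxA.
Qed.

(** * Taylor bounds and second differences of exponentials *)

Section Taylor.
Context {R : realType}.

(* The constant is not optimal: applying the mean value theorem twice gives K instead of K / 2. *)
Lemma taylor2_bound (f f1 f2 : R -> R) (K : R) :
  (forall t : R, is_derive t (1 : R) f (f1 t)) ->
  (forall t : R, is_derive t (1 : R) f1 (f2 t)) ->
  (forall t : R, 0 <= t <= 1 -> `|f2 t - f2 0| <= K) ->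
  `|f 1 - f 0 - f1 0 - f2 0 / 2| <= K.
Proof.
move=> df df1 hK.
have K0 : 0 <= K by apply: le_trans (hK 0 _); rewrite ?lexx ?ler01.
pose g1 t := f1 t - f1 0 - t * f2 0.
pose g t := f t - f 0 - t * f1 0 - t ^+ 2 * (f2 0 / 2).
have dg1 t : is_derive t (1 : R) g1 (f2 t - f2 0).
  by apply: is_derive_eq; rewrite /GRing.scale/=; ring.
have dg t : is_derive t (1 : R) g (g1 t).
  by apply: is_derive_eq; rewrite /g1 /GRing.scale/=; field.
have cont (h h' : R -> R) : (forall t, is_derive t (1 : R) h (h' t)) ->
    forall A : set R, {within A, continuous h}.
  move=> dh A; apply: continuous_subspaceT => t.
  exact/differentiable_continuous/derivable1_diffP/(@ex_derive _ _ _ _ _ _ _ (dh t)).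
have [c /[!in_itv]/= /andP[c0 c1] gc] := @MVT R g g1 0 1 ltr01 (fun t _ => dg t) (cont _ _ dg _).
have [e /[!in_itv]/= /andP[e0 e1] g1e] := @MVT R g1 (fun t => f2 t - f2 0) 0 c c0 (fun t _ => dg1 t) (cont _ _ dg1 _).
have -> : f 1 - f 0 - f1 0 - f2 0 / 2 = g 1 - g 0 by rewrite /g; ring.
have g10 : g1 0 = 0 by rewrite /g1; ring.
rewrite gc subr0 mulr1 -[g1 c]subr0 -g10 g1e subr0 normrM (gtr0_norm c0).
apply: (@le_trans _ _ (K * 1)); last by rewrite mulr1.
by apply: ler_pM => //; [exact: ltW|apply: hK; rewrite (ltW e0) (le_trans (ltW e1))// ltW|exact: ltW].
Qed.

Lemma expR_taylor2_bound (q L : R) : `|q| <= L ->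
  `|expR q - 1 - q - q ^+ 2 / 2| <= L ^+ 3 * expR L.
Proof.
move=> qL; have L0 : 0 <= L by rewrite (le_trans _ qL).
have e0 t : is_derive t (1 : R) (fun t : R => expR (t * q)) (q * expR (t * q)).
  by apply: is_derive_eq; rewrite /GRing.scale/=; ring.
have e1 t : is_derive t (1 : R) (fun t : R => q * expR (t * q)) (q ^+ 2 * expR (t * q)).
  by apply: is_derive_eq; rewrite /GRing.scale/=; ring.
have expR1 (x : R) : `|x| <= L -> `|expR x - 1| <= L * expR L.
  move=> xL; have [x0|x0] := leP 0 x.
    have x1 : 1 <= expR x by rewrite -expR0 ler_expR.
    rewrite ger0_norm ?subr_ge0//.
    have xL' : x <= L by rewrite (le_trans (ler_norm _)).
    have h := expR_ge1Dx (- x); rewrite expRN in h.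
    have ex0 := expR_gt0 x.
    have h2 : expR x - 1 <= x * expR x.
      have : (1 + - x) * expR x <= 1 by rewrite -ler_pdivlMr// div1r.
      by rewrite mulrDl mul1r; lra.
    rewrite (le_trans h2)//; apply: ler_pM => //; by rewrite ler_expR.
  have x1 : expR x <= 1 by rewrite -expR0 ler_expR ltW.
  rewrite ler0_norm ?subr_le0// opprB.
  have h := expR_ge1Dx x.
  have xL' : - x <= L by rewrite (le_trans (ler_norm _))// normrN.
  apply: (@le_trans _ _ L); first lra.
  by rewrite ler_peMr// -expR0 ler_expR.
have := taylor2_bound e0 e1 (K := L ^+ 3 * expR L).
rewrite mul1r !mul0r expR0 !mulr1; apply => t /andP[t0 t1].
rewrite -{2}[q ^+ 2]mulr1 -mulrBr normrM.
have -> : L ^+ 3 * expR L = L ^+ 2 * (L * expR L) by ring.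
apply: ler_pM => //.
  by rewrite normrX ler_pXn2r// nnegrE.
apply: expR1; rewrite normrM (ger0_norm t0).
by rewrite (le_trans _ qL)// ler_piMl.
Qed.

(* The symmetric second difference of a Gaussian transform along a direction:
   kap = |v|^2 and al = u.x for the frequency u and the increment x. *)
Definition wdiff (h kap al : R) : R :=
  2 / h ^+ 2 * (1 - (expR (- (h ^+ 2 * kap / 2) - h * al) +
                     expR (- (h ^+ 2 * kap / 2) + h * al)) / 2).

(** Expand both exponentials to second order: the linear parts give kap, the squares give al^2 and
    an error h^2 kap^2 / 4, and the cubic remainders divided by h^2 are of order h. *)
Lemma cvg_wdiff (kap al : R) :
  wdiff n.+1%:R^-1 kap al @[n --> \oo] --> kap - al ^+ 2.
Proof.
pose L : R := `|kap| + `|al|.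
pose C := kap ^+ 2 / 4 + 2 * (L ^+ 3 * expR L).
have hC (h : R) : 0 < h -> h <= 1 -> `|wdiff h kap al - (kap - al ^+ 2)| <= C * h.
  move=> h0 h1.
  pose q1 := - (h ^+ 2 * kap / 2) - h * al; pose q2 := - (h ^+ 2 * kap / 2) + h * al.
  pose r (q : R) := expR q - 1 - q - q ^+ 2 / 2.
  have L0 : 0 <= L by rewrite addr_ge0.
  have h0' := ltW h0.
  have hk : `|h ^+ 2 * kap / 2| <= h * `|kap|.
    have -> : h ^+ 2 * kap / 2 = (h * h / 2) * kap by field.
    have hh : 0 <= h * h / 2 <= h by apply/andP; split; nra.
    by rewrite normrM; case/andP: hh => hh0 hh1; rewrite ger0_norm// ler_wpM2r.
  have b1 : `|q1| <= h * L.
    rewrite /q1 (le_trans (ler_normB _ _))// normrN /L mulrDr lerD// normrM ger0_norm//.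
  have b2 : `|q2| <= h * L.
    rewrite /q2 (le_trans (ler_normD _ _))// normrN /L mulrDr lerD// normrM ger0_norm//.
  have hL : expR (h * L) <= expR L by rewrite ler_expR ler_piMl.
  have hr (q : R) : `|q| <= h * L -> `|r q| <= h ^+ 3 * (L ^+ 3 * expR L).
    move=> qL; rewrite (le_trans (expR_taylor2_bound qL))// exprMn -mulrA.
    by rewrite ler_wpM2l ?exprn_ge0// ler_wpM2l ?exprn_ge0.
  have -> : wdiff h kap al - (kap - al ^+ 2) =
     - (h ^+ 2 * kap ^+ 2 / 4) - (r q1 + r q2) / h ^+ 2.
    by rewrite /wdiff /r -/q1 -/q2 /q1 /q2; field; rewrite gt_eqF.
  rewrite (le_trans (ler_normB _ _))// normrN [leRHS]mulrDl; apply: lerD.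
    have k4 : 0 <= kap ^+ 2 / 4 by rewrite divr_ge0// sqr_ge0.
    rewrite -mulrA (ger0_norm (mulr_ge0 (sqr_ge0 h) k4)) mulrC ler_wpM2l//.
    by rewrite expr2 ler_piMl.
  rewrite normf_div (ger0_norm (sqr_ge0 h)) ler_pdivrMr ?exprn_gt0//.
  rewrite (le_trans (ler_normD _ _))//.
  have -> : 2 * (L ^+ 3 * expR L) * h * h ^+ 2 = h ^+ 3 * (L ^+ 3 * expR L) + h ^+ 3 * (L ^+ 3 * expR L) by ring.
  by apply: lerD; exact: hr.
have cC : C * n.+1%:R^-1 @[n --> \oo] --> (0 : R).
  rewrite -(mulr0 C); apply: cvgM; first exact: cvg_cst.
  exact: cvg_harmonic.
apply/subr_cvg0; apply: norm_cvg0.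
apply: (squeeze_cvgr _ (cvg_cst 0) cC); apply: nearW => n.
rewrite normr_ge0/=; apply: hC; first by rewrite invr_gt0.
by rewrite invf_le1// ler1n.
Qed.

(** Reduces to 1 - exp(- x) <= x; it becomes the bound on the mean of the weight [kern]. *)
Lemma wdiff0_le (h kap : R) : h != 0 -> wdiff h kap 0 <= kap.
Proof.
move=> h0; rewrite /wdiff mulr0 subr0 addr0 -mulr2n -[X in X / 2]mulr_natr mulfK//.
have h2 : 0 < h ^+ 2 by rewrite exprn_even_gt0.
have := expR_ge1Dx (- (h ^+ 2 * kap / 2)) => e.
rewrite mulrAC ler_pdivrMr//; lra.
Qed.

End Taylor.

Lemma is_derive_sumr {R : realType} (I : Type) (r : seq I) (h h' : I -> R -> R) (t : R) :
  (forall i, is_derive t (1 : R) (h i) (h' i t)) ->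
  is_derive t (1 : R) (fun t => \sum_(i <- r) h i t) (\sum_(i <- r) h' i t).
Proof.
move=> dh; elim: r => [|i r ih].
  by under eq_fun do rewrite big_nil; rewrite big_nil; exact: is_derive_cst.
by under eq_fun do rewrite big_cons; rewrite big_cons; exact: is_deriveD.
Qed.

Section GaussianSmoothing.
Context {R : realType} {d : nat} {dsp : measure_display} {W : measurableType dsp}
  (P : probability W R) (Z : W -> 'cV[R]_d.+1).
Hypothesis (mZ : measurable_fun setT Z) (gZ : gaussian_vector P 1%:M Z).
Implicit Types (f : @trig R d.+1) (M B : 'M[R]_d.+1) (y a b u v : 'cV[R]_d.+1).

(** The vector v = B^-1 y is the displacement y in the coordinates of the standard Gaussian; M >=
    s^2 I makes B invertible and |v| at most |y| / s. *)
Lemma coercive_sqrt M (s : R) : 0 < s -> psdmx M ->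
  (forall u, s ^+ 2 * dot u u <= qf M u) ->
  forall y, exists B, exists v,
    [/\ B^T = B, B *m B = M, B *m v = y & s ^+ 2 * dot v v <= dot y y].
Proof.
move=> s0 Mp Ms y; have [[Bs _] BM _] := psd_sqrtP Mp.
set B := psd_sqrt M in Bs BM *.
have Bn u : s ^+ 2 * dot u u <= dot (B *m u) (B *m u).
  by rewrite (le_trans (Ms u))// -BM qfE -mulmxA dot_mulmx Bs.
have Bu : B \in unitmx.
  rewrite unitmxE unitfE; apply/negP => /det0P[u u0 uB].
  move/negP: u0; apply; apply/eqP.
  have Bu0 : B *m u^T = 0 by rewrite -Bs -trmx_mul uB trmx0.
  have := Bn u^T; rewrite Bu0 dot0r pmulr_rle0 ?exprn_gt0// => h.
  have /dot_eq0 : dot u^T u^T = 0 by apply/eqP; rewrite eq_le h dot_ge0.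
  by move=> /(congr1 trmx); rewrite trmxK trmx0.
exists B, (invmx B *m y); have Bv : B *m (invmx B *m y) = y by rewrite mulKVmx.
by split => //; rewrite -[in leRHS]Bv.
Qed.

Let gaussian_BZ B M : B^T = B -> B *m B = M -> gaussian_vector P M (fun w => B *m Z w).
Proof. by move=> Bs BM; have := gaussian_vector_mulmx B gZ; rewrite mulmx1 Bs BM. Qed.

Let measurable_BZ B : measurable_fun setT (fun w => B *m Z w).
Proof. by apply: measurable_mulmx => //; exact: measurable_cst. Qed.

(** A bounded and nonnegative substitute for (v.Z)^2, to which it tends as h -> 0. *)
Let kern (h : R) v w : R := 2 / h ^+ 2 * (1 - cos (h * dot v (Z w))).

Let kern_ge0 h v w : 0 <= kern h v w.
Proof. by rewrite /kern mulr_ge0 ?divr_ge0 ?sqr_ge0// subr_ge0 cos_le1. Qed.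

Let measurable_kern h v : measurable_fun setT (kern h v).
Proof.
apply: measurable_funM => //; apply: measurable_funB => //.
apply: measurable_cos; apply: measurable_funM => //.
by apply: measurable_dot => //; exact: measurable_cst.
Qed.

Let measurable_tF0 f c B : measurable_fun setT (fun w => tF f 0 (c + B *m Z w)).
Proof.
apply: measurable_tF; first exact: measurable_cst.
apply: measurable_addmx; first exact: measurable_cst.
by apply: measurable_mulmx => //; exact: measurable_cst.
Qed.

Let kern_bnd h v w : `|kern h v w| <= 2 / h ^+ 2 * 2.
Proof.
rewrite ger0_norm ?kern_ge0// /kern ler_wpM2l ?divr_ge0 ?sqr_ge0//.
by have := cos_geN1 (h * dot v (Z w)); lra.
Qed.

(** Product-to-sum formulas turn the weighted cosine into the frequencies B u, B u + h v and B u - h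
    v, each with an explicit Gaussian mean. *)
Lemma tF_wdiff f B M a v h : B^T = B -> B *m B = M ->
  \int[P]_w (tF f 0 (a + B *m Z w) * (2 / h ^+ 2 * (1 - cos (h * dot v (Z w))))) =
  \sum_(k <- f) tcoef M k * cos (dot k.1.2 a + k.2) *
    wdiff h (dot v v) (dot k.1.2 (B *m v)).
Proof.
move=> Bs BM.
pose g u (c : R) w := cos (dot u (Z w) + c).
have ig u c : P.-integrable setT (EFin \o g u c).
  apply: (@integrable_bounded _ _ _ _ _ 1) => [|w]; last exact: normr_cos_le1.
  by apply: measurable_cos; exact: (@measurable_tphase _ _ _ _ Z (0, u, c)).
have gE u c : \int[P]_w g u c w = cos c * expR (- (dot u u / 2)).
  rewrite /g (gaussian_vector_cos mZ (psdmx_scalar ler01) gZ).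
  by rewrite qf_scalar mul1r.
pose T k w := k.1.1 * (2 / h ^+ 2) *
  (g (B *m k.1.2) (dot k.1.2 a + k.2) w -
   2^-1 * (g (B *m k.1.2 + h *: v) (dot k.1.2 a + k.2) w +
      g (B *m k.1.2 - h *: v) (dot k.1.2 a + k.2) w)).
have iT k : P.-integrable setT (EFin \o T k).
  by apply: integrable_EFinZ; apply: integrable_EFinB => //; apply: integrable_EFinZ; apply: integrable_EFinD.
transitivity (\int[P]_w \sum_(k <- f) T k w).
  apply: eq_Rintegral => w _; rewrite tF0E mulr_suml; apply: eq_bigr => k _.
  rewrite /T /g dotDr dotDl dotDl dotNl dotZl dot_mulmx Bs.
  set A := dot k.1.2 a; set X := dot (B *m k.1.2) (Z w); set Y := h * dot v (Z w).
  set C := X + (A + k.2); set q := 2 / h ^+ 2.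
  have -> : A + X + k.2 = C by rewrite /C; ring.
  have -> : X + Y + (A + k.2) = C + Y by rewrite /C; ring.
  have -> : X - Y + (A + k.2) = C - Y by rewrite /C; ring.
  by rewrite (cosD C Y) (cosB C Y); field.
rewrite Rintegral_sum//; apply: eq_bigr => k _.
have TE : \int[P]_w T k w = k.1.1 * (2 / h ^+ 2) * cos (dot k.1.2 a + k.2) *
  (expR (- (dot (B *m k.1.2) (B *m k.1.2) / 2)) -
   2^-1 * (expR (- (dot (B *m k.1.2 + h *: v) (B *m k.1.2 + h *: v) / 2)) +
           expR (- (dot (B *m k.1.2 - h *: v) (B *m k.1.2 - h *: v) / 2)))).
  rewrite RintegralZl//; last first.
    by apply: integrable_EFinB => //; apply: integrable_EFinZ; apply: integrable_EFinD.
  rewrite RintegralB//; last by apply: integrable_EFinZ; apply: integrable_EFinD.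
  rewrite RintegralZl//; last exact: integrable_EFinD.
  by rewrite RintegralD// !gE; ring.
rewrite TE /wdiff /tcoef.
have qM : dot (B *m k.1.2) (B *m k.1.2) = qf M k.1.2.
  by rewrite -BM qfE -mulmxA [RHS]dot_mulmx Bs.
have al : dot (B *m k.1.2) v = dot k.1.2 (B *m v) by rewrite dot_mulmx Bs.
have hp : dot (B *m k.1.2 + h *: v) (B *m k.1.2 + h *: v) =
    qf M k.1.2 + 2 * (h * dot k.1.2 (B *m v)) + h ^+ 2 * dot v v.
  by rewrite !dotDl !dotDr !dotZl !dotZr (dotC v) al qM; ring.
have hm : dot (B *m k.1.2 - h *: v) (B *m k.1.2 - h *: v) =
    qf M k.1.2 - 2 * (h * dot k.1.2 (B *m v)) + h ^+ 2 * dot v v.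
  by rewrite !dotDl !dotDr !dotNl !dotNr !dotZl !dotZr (dotC v) al qM; ring.
rewrite hp hm qM; set Q := qf M _; set al' := dot k.1.2 (B *m v); set kap := dot v v.
have -> : - ((Q + 2 * (h * al') + h ^+ 2 * kap) / 2) = - (Q / 2) + (- (h ^+ 2 * kap / 2) - h * al') by field.
have -> : - ((Q - 2 * (h * al') + h ^+ 2 * kap) / 2) = - (Q / 2) + (- (h ^+ 2 * kap / 2) + h * al') by field.
by rewrite !(expRD (- (Q / 2))); set q := 2 / h ^+ 2; field.
Qed.

Let Rintegral_kern h v : h != 0 -> \int[P]_w kern h v w <= dot v v.
Proof.
move=> h0.
have c0 : \int[P]_w cos (h * dot v (Z w)) = expR (- (h ^+ 2 * dot v v / 2)).
  have := gaussian_vector_cos mZ (psdmx_scalar ler01) gZ (h *: v) 0.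
  rewrite cos0 mul1r qf_scalar mul1r dot_scale => <-.
  by apply: eq_Rintegral => w _; rewrite addr0 dotZl.
have -> : \int[P]_w kern h v w = wdiff h (dot v v) 0.
  rewrite RintegralZl//; last first.
    apply: (@integrable_bounded _ _ _ _ _ 2).
      apply: measurable_funB => //; apply: measurable_cos; apply: measurable_funM => //.
      by apply: measurable_dot => //; exact: measurable_cst.
    move=> w; rewrite (le_trans (ler_normB _ _))// normr1.
    by have := normr_cos_le1 (h * dot v (Z w)); lra.
  rewrite RintegralB//; last 2 first.
  - by apply: (@integrable_bounded _ _ _ _ _ 1) => // w; rewrite normr1.
  - apply: (@integrable_bounded _ _ _ _ _ 1) => [|w]; last exact: normr_cos_le1.
    apply: measurable_cos; apply: measurable_funM => //.
    by apply: measurable_dot => //; exact: measurable_cst.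
  rewrite c0 Rintegral_prob_cst /wdiff mulr0 subr0 addr0; congr (_ * (1 - _)).
  by field.
exact: wdiff0_le.
Qed.

(** In the limit h -> 0 the mean of f(x + B Z) against the weight is |v|^2 F(x) + D^2 F(x)[y, y],
    with y = B v. Between a and b this mean varies by at most D |v|^2, because the weight is
    nonnegative with mean at most |v|^2, and |v|^2 F varies by as much. Hence the factor 2; |v|^2 <=
    |y|^2 / s^2 gives the rest. *)
Lemma tD2_lipschitz f M (s D : R) a b y : 0 < s -> psdmx M ->
  (forall u, s ^+ 2 * dot u u <= qf M u) ->
  (forall z, `|tF f 0 (a + z) - tF f 0 (b + z)| <= D) ->
  `|tD2 f M a (y *m y^T) - tD2 f M b (y *m y^T)| <= 2 * D * (dot y y / s ^+ 2).
Proof.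
move=> s0 Mp Ms hD.
have [B [v [Bs BM Bv vy]]] := coercive_sqrt s0 Mp Ms y.
have D0 : 0 <= D by apply: le_trans (hD 0); exact: normr_ge0.
set kap := dot v v.
pose A h := \sum_(k <- f) tcoef M k * (cos (dot k.1.2 a + k.2) - cos (dot k.1.2 b + k.2)) *
    wdiff h kap (dot k.1.2 y).
pose A0 := \sum_(k <- f) tcoef M k * (cos (dot k.1.2 a + k.2) - cos (dot k.1.2 b + k.2)) *
    (kap - dot k.1.2 y ^+ 2).
have ik h c : P.-integrable setT (EFin \o (fun w => tF f 0 (c + B *m Z w) * kern h v w)).
  apply: (@integrable_bounded _ _ _ _ _ (tnorm f * (2 / h ^+ 2 * 2))) => [|w].
    exact: measurable_funM.
  by rewrite normrM; apply: ler_pM => //; exact: normr_tF psdmx0.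
have AE h : A h = \int[P]_w ((tF f 0 (a + B *m Z w) - tF f 0 (b + B *m Z w)) * kern h v w).
  transitivity (\int[P]_w (tF f 0 (a + B *m Z w) * kern h v w - tF f 0 (b + B *m Z w) * kern h v w)).
    rewrite RintegralB// !(tF_wdiff _ _ _ _ Bs BM) -sumrB Bv.
    by apply: eq_bigr => k _; rewrite -/kap; ring.
  by apply: eq_Rintegral => w _; rewrite mulrBl.
have Ale h : h != 0 -> `|A h| <= D * kap.
  move=> h0; rewrite AE.
  have mdiff : measurable_fun setT (fun w => (tF f 0 (a + B *m Z w) - tF f 0 (b + B *m Z w)) * kern h v w).
    by apply: measurable_funM => //; apply: measurable_funB.
  have idiff : P.-integrable setT (EFin \o (fun w => (tF f 0 (a + B *m Z w) - tF f 0 (b + B *m Z w)) * kern h v w)).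
    apply: (@integrable_bounded _ _ _ _ _ (D * (2 / h ^+ 2 * 2))) => // w.
    by rewrite normrM; apply: ler_pM.
  rewrite (le_trans (le_normr_Rintegral _ idiff))//.
  have ikern : P.-integrable setT (EFin \o kern h v) by apply: integrable_bounded.
  apply: (@le_trans _ _ (\int[P]_w (D * kern h v w))).
    apply: le_RintegralT.
    - apply: (@integrable_bounded _ _ _ _ _ (D * (2 / h ^+ 2 * 2))).
        exact: measurableT_comp.
      by move=> w; rewrite normr_id normrM; apply: ler_pM.
    - exact: integrable_EFinZ.
    - by move=> w; rewrite normrM (ger0_norm (kern_ge0 _ _ _)) ler_wpM2r// kern_ge0.
  by rewrite RintegralZl// ler_wpM2l// Rintegral_kern.
have Acvg : A n.+1%:R^-1 @[n --> \oo] --> A0.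
  by apply: cvg_sumr => k; apply: cvgM; [exact: cvg_cst|exact: cvg_wdiff].
have A0le : `|A0| <= D * kap.
  have cn : `|A n.+1%:R^-1| @[n --> \oo] --> `|A0| by exact: cvg_norm.
  rewrite -(cvg_lim _ cn)//.
  apply: limr_le; first by apply/cvg_ex; eexists; exact: cn.
  by apply: nearW => n; apply: Ale; rewrite invr_eq0 pnatr_eq0.
have FE : A0 = kap * (tF f M a - tF f M b) +
    (tD2 f M a (y *m y^T) - tD2 f M b (y *m y^T)).
  rewrite /tF /tD2 -!sumrB mulr_sumr -big_split; apply: eq_bigr => k _ /=.
  by rewrite qf_outer; ring.
have Fle : `|tF f M a - tF f M b| <= D.
  have ab c : \int[P]_w tF f 0 (c + B *m Z w) = tF f M c.
    by rewrite (tF_semigroup (measurable_BZ B) Mp (gaussian_BZ Bs BM)) add0r.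
  rewrite -!ab -RintegralB//; last 2 first.
  - exact: integrable_tF (measurable_BZ B) _ _ _ psdmx0.
  - exact: integrable_tF (measurable_BZ B) _ _ _ psdmx0.
  by apply: normr_Rintegral_le => //; apply: measurable_funB.
have kap0 : 0 <= kap := dot_ge0 v.
have kapy : kap <= dot y y / s ^+ 2 by rewrite ler_pdivlMr ?exprn_gt0// mulrC.
apply: (@le_trans _ _ (2 * D * kap)); last by rewrite ler_wpM2l// mulr_ge0.
have -> : tD2 f M a (y *m y^T) - tD2 f M b (y *m y^T) = A0 - kap * (tF f M a - tF f M b).
  by rewrite FE; ring.
rewrite (le_trans (ler_normB _ _))// normrM (ger0_norm kap0).
have : kap * `|tF f M a - tF f M b| <= kap * D by rewrite ler_wpM2l.
lra.
Qed.

(** Taylor along the segment from x to x + y. The second derivatives at x + t y and at x are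
    compared by [tD2_lipschitz], so only the variation of f under shifts by t y enters. *)
Lemma tF_taylor f M (s D : R) x y : 0 < s -> psdmx M ->
  (forall u, s ^+ 2 * dot u u <= qf M u) ->
  (forall (t : R) z, 0 <= t <= 1 -> `|tF f 0 (z + t *: y) - tF f 0 z| <= D) ->
  `|tF f M (x + y) - tF f M x - tD1 f M x y - tD2 f M x (y *m y^T) / 2| <=
  2 * D * (dot y y / s ^+ 2).
Proof.
move=> s0 Mp Ms hD.
pose g t := tF f M (x + t *: y).
pose g1 t := tD1 f M (x + t *: y) y.
pose g2 t := tD2 f M (x + t *: y) (y *m y^T).
have dph (k : R * 'cV[R]_d.+1 * R) (t : R) : is_derive t (1 : R) (fun t => dot k.1.2 (x + t *: y) + k.2) (dot k.1.2 y).
  have -> : (fun t => dot k.1.2 (x + t *: y) + k.2) = (fun t => dot k.1.2 x + t * dot k.1.2 y + k.2).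
    by apply/funext => r; rewrite dotDr dotZr.
  by apply: is_derive_eq; rewrite /GRing.scale/=; ring.
have dg t : is_derive t (1 : R) g (g1 t).
  apply: (@is_derive_sumr _ _ f (fun k t => tcoef M k * cos (dot k.1.2 (x + t *: y) + k.2))
    (fun k t => tcoef M k * (- sin (dot k.1.2 (x + t *: y) + k.2)) * dot k.1.2 y)) => k.
  have dk := dph k t.
  by apply: is_derive_eq; rewrite /GRing.scale/=; ring.
have dg1 t : is_derive t (1 : R) g1 (g2 t).
  apply: (@is_derive_sumr _ _ f
    (fun k t => tcoef M k * (- sin (dot k.1.2 (x + t *: y) + k.2)) * dot k.1.2 y)
    (fun k t => tcoef M k * (- cos (dot k.1.2 (x + t *: y) + k.2)) * qf (y *m y^T) k.1.2)) => k.
  have dk := dph k t.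
  by apply: is_derive_eq; rewrite /GRing.scale/= qf_outer; ring.
have := taylor2_bound dg dg1 (K := 2 * D * (dot y y / s ^+ 2)).
rewrite /g /g1 /g2 scale1r !scale0r !addr0; apply => t t01.
apply: (@tD2_lipschitz f M s D (x + t *: y) x y s0 Mp Ms) => z.
by rewrite addrAC; exact: hD.
Qed.

End GaussianSmoothing.

(** * Trigonometric approximation of indicators *)
Section Fejer.
Context {R : realType}.

(** The double sum displays the Fejer kernel as a cosine sum; [fejerE] is the equivalent sum of two
    squares, from which positivity is read. *)
Definition fejer (m : nat) (t : R) : R :=
  m%:R^-1 * \sum_(a < m) \sum_(b < m) cos ((a%:R - b%:R) * t).

Lemma fejerE m t : fejer m t = m%:R^-1 *
  ((\sum_(a < m) cos (a%:R * t)) ^+ 2 + (\sum_(a < m) sin (a%:R * t)) ^+ 2).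
Proof.
rewrite /fejer; congr (_ * _); rewrite !expr2 !mulr_suml -big_split.
apply: eq_bigr => a _ /=; rewrite !mulr_sumr -big_split.
by apply: eq_bigr => b _ /=; rewrite mulrBl cosB.
Qed.

Lemma fejer_ge0 m t : 0 <= fejer m t.
Proof. by rewrite fejerE mulr_ge0 ?invr_ge0// addr_ge0// sqr_ge0. Qed.

(** Real and imaginary parts of (C + i S)(1 - e^(i t)) = 1 - e^(i m t), then squared moduli with |1
    - e^(i t)|^2 = 2 (1 - cos t). It shows concentration at 0: the kernel times 1 - cos t is at most
    2 / m. *)
Lemma fejer_1Bcos m t : fejer m t * (1 - cos t) = m%:R^-1 * (1 - cos (m%:R * t)).
Proof.
rewrite fejerE -mulrA; congr (_ * _).
set C := \sum_(a < m) cos _; set S := \sum_(a < m) sin _.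
have hC : C * (1 - cos t) + S * sin t = 1 - cos (m%:R * t).
  rewrite /C /S; elim: m {C S} => [|m ih]; first by rewrite !big_ord0 !mul0r cos0 addr0 subrr.
  rewrite !big_ord_recr/= !mulrDl addrACA ih -natr1 mulrDl mul1r cosD; ring.
have hS : S * (1 - cos t) - C * sin t = - sin (m%:R * t).
  rewrite /C /S {hC}; elim: m {C S} => [|m ih]; first by rewrite !big_ord0 !mul0r sin0 oppr0 addr0.
  rewrite !big_ord_recr/= !mulrDl opprD addrACA ih -natr1 mulrDl mul1r sinD; ring.
have e1 := cos2Dsin2 t; have e2 := cos2Dsin2 (m%:R * t).
have e3 : (C * (1 - cos t) + S * sin t) ^+ 2 + (S * (1 - cos t) - C * sin t) ^+ 2 =
   (C ^+ 2 + S ^+ 2) * (1 - 2 * cos t + (cos t ^+ 2 + sin t ^+ 2)) by ring.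
rewrite hC hS e1 in e3.
have e4 : (1 - cos (m%:R * t)) ^+ 2 + (- sin (m%:R * t)) ^+ 2 =
  1 - 2 * cos (m%:R * t) + (cos (m%:R * t) ^+ 2 + sin (m%:R * t) ^+ 2) by ring.
rewrite e2 in e4; rewrite e4 in e3; lra.
Qed.

(** Multiplied by 2 sin(h / 2) the sum telescopes, and its end terms agree by periodicity; 0 < n < M
    keeps h / 2 strictly between 0 and pi. *)
Lemma sum_cos_grid (M n : nat) (th : R) : (0 < n < M)%N ->
  \sum_(i < M) cos (th - n%:R * (pi *+ 2) / M%:R * i%:R) = 0.
Proof.
move=> /andP[n0 nM]; have M0 : (0 < M)%N by rewrite (leq_trans _ nM).
have M0' : M%:R != 0 :> R by rewrite pnatr_eq0 -lt0n.
set h := n%:R * (pi *+ 2) / M%:R.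
have hh : h / 2 = pi * (n%:R / M%:R) by rewrite /h mulr2n; field.
have s0 : 0 < sin (h / 2).
  apply: sin_gt0_pi; rewrite hh mulr_gt0 ?pi_gt0 ?divr_gt0 ?ltr0n//=.
  by rewrite gtr_pMr ?pi_gt0// ltr_pdivrMr ?ltr0n// mul1r ltr_nat.
pose s (i : nat) := sin (th - h * i%:R + h / 2).
have e k : 2 * sin (h / 2) * \sum_(i < k) cos (th - h * i%:R) = s 0%N - s k.
  elim: k => [|k ih]; first by rewrite big_ord0 mulr0 subrr.
  rewrite big_ord_recr/= mulrDr ih /s.
  have -> : th - h * k.+1%:R + h / 2 = th - h * k%:R - h / 2 by rewrite -natr1; field.
  by rewrite (sinD (th - h * k%:R)) (sinB (th - h * k%:R)); ring.
have sM : s M = s 0%N.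
  rewrite /s mulr0 subr0; have -> : h * M%:R = (pi *+ 2) *+ n.
    by rewrite /h divfK// mulr_natl.
  by rewrite -[LHS](periodicn (@sinD2pi R) n) addrAC subrK.
have := e M; rewrite sM subrr => /eqP; rewrite !mulf_eq0 pnatr_eq0/= (gt_eqF s0)/=.
by move=> /eqP.
Qed.

(** Summing over M equidistant points annihilates each nonzero frequency a - b, as |a - b| < M; the
    diagonal remains. This discrete normalization replaces an integral over the period. *)
Lemma sum_fejer_grid (M m : nat) (t : R) : (0 < m < M)%N ->
  \sum_(i < M) fejer m (t - (pi *+ 2) / M%:R * i%:R) = M%:R.
Proof.
move=> /andP[m0 mM]; rewrite /fejer -mulr_sumr exchange_big/=.
have ab (a b : 'I_m) : \sum_(i < M) cos ((a%:R - b%:R) * (t - (pi *+ 2) / M%:R * i%:R)) = (M * (a == b))%:R :> R.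
  have wl (a' b' : 'I_m) : (a' < b')%N ->
      \sum_(i < M) cos ((b'%:R - a'%:R) * (t - (pi *+ 2) / M%:R * i%:R)) = 0 :> R.
    move=> ab; rewrite -[RHS](@sum_cos_grid M (b' - a') ((b' - a')%N%:R * t)); last first.
      by rewrite subn_gt0 ab (leq_ltn_trans (leq_subr _ _))// (ltn_trans (ltn_ord b')).
    by apply: eq_bigr => i _; congr cos; rewrite natrB ?(ltnW ab)//; ring.
  have [lt|gt|/val_inj->] := ltngtP a b.
  - rewrite (_ : (a == b) = false) ?muln0; last by apply/negbTE; rewrite neq_ltn lt.
    rewrite -[RHS](wl _ _ lt); apply: eq_bigr => i _; rewrite -cosN; congr cos; ring.
  - by rewrite (_ : (a == b) = false) ?muln0 ?(wl _ _ gt)//; apply/negbTE; rewrite neq_ltn gt orbT.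
  - rewrite eqxx muln1 -[in RHS](card_ord M) -sumr_const.
    by apply: eq_bigr => i _; rewrite subrr mul0r cos0.
have -> : \sum_(a < m) \sum_(i < M) \sum_(b < m) cos ((a%:R - b%:R) * (t - (pi *+ 2) / M%:R * i%:R)) = \sum_(a < m) M%:R.
  apply: eq_bigr => a _; rewrite exchange_big/= (bigD1 a)//= ab eqxx muln1 big1 ?addr0// => b ba.
  by rewrite ab eq_sym (negbTE ba) muln0.
rewrite sumr_const card_ord; have -> : M%:R *+ m = m%:R * M%:R :> R by rewrite mulr_natl.
by rewrite mulrA mulVf ?mul1r// pnatr_eq0 -lt0n.
Qed.

End Fejer.

Section TrigAlgebra.
Context {R : realType} {d : nat}.
Implicit Types (F G : 'cV[R]_d -> R).

Definition is_trig F := exists f : @trig R d, forall x, tF f 0 x = F x.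

Lemma is_trig_ext F G : is_trig F -> F =1 G -> is_trig G.
Proof. by move=> [f fF] FG; exists f => x; rewrite fF FG. Qed.

Lemma is_trig_cos (u : 'cV[R]_d) (th : R) : is_trig (fun x => cos (dot u x + th)).
Proof.
by exists [:: (1, u, th)] => x; rewrite tF0E big_cons big_nil/= mul1r addr0.
Qed.

Lemma is_trigD F G : is_trig F -> is_trig G -> is_trig (fun x => F x + G x).
Proof.
by move=> [f fF] [g gG]; exists (f ++ g) => x; rewrite -fF -gG !tF0E big_cat.
Qed.

Lemma is_trigZ (c : R) F : is_trig F -> is_trig (fun x => c * F x).
Proof.
move=> [f fF]; exists [seq (c * k.1.1, k.1.2, k.2) | k <- f] => x.
by rewrite -fF !tF0E big_map mulr_sumr; apply: eq_bigr => k _; rewrite /= mulrA.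
Qed.

Lemma is_trig_cst (c : R) : is_trig (fun=> c).
Proof.
apply: is_trig_ext (is_trigZ c (is_trig_cos 0 0)) _ => x.
by rewrite dot0l addr0 cos0 mulr1.
Qed.

Lemma is_trig_sum (I : Type) (r : seq I) (F : I -> 'cV[R]_d -> R) :
  (forall i, is_trig (F i)) -> is_trig (fun x => \sum_(i <- r) F i x).
Proof.
move=> tr; elim: r => [|i r ih].
  by apply: is_trig_ext (is_trig_cst 0) _ => x; rewrite big_nil.
by apply: is_trig_ext (is_trigD (tr i) ih) _ => x; rewrite big_cons.
Qed.

Lemma is_trigM F G : is_trig F -> is_trig G -> is_trig (fun x => F x * G x).
Proof.
move=> [f fF] [g gG].
have cc (k l : R * 'cV[R]_d * R) :
    is_trig (fun x => cos (dot k.1.2 x + k.2) * cos (dot l.1.2 x + l.2)).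
  have h := is_trigZ 2^-1 (is_trigD (is_trig_cos (k.1.2 + l.1.2) (k.2 + l.2))
                              (is_trig_cos (k.1.2 - l.1.2) (k.2 - l.2))).
  apply: is_trig_ext h _ => x; rewrite !dotDl dotNl.
  set a := dot k.1.2 x; set b := dot l.1.2 x.
  have -> : a + b + (k.2 + l.2) = (a + k.2) + (b + l.2) by ring.
  have -> : a - b + (k.2 - l.2) = (a + k.2) - (b + l.2) by ring.
  by rewrite (cosD (a + k.2)) (cosB (a + k.2)); field.
have h := is_trig_sum f (fun k => is_trig_sum g (fun l => is_trigZ (k.1.1 * l.1.1) (cc k l))).
apply: is_trig_ext h _ => x; rewrite -fF -gG !tF0E mulr_suml.
by apply: eq_bigr => k _; rewrite mulr_sumr; apply: eq_bigr => l _; ring.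
Qed.

Lemma is_trig_prod (I : Type) (r : seq I) (F : I -> 'cV[R]_d -> R) :
  (forall i, is_trig (F i)) -> is_trig (fun x => \prod_(i <- r) F i x).
Proof.
move=> tr; elim: r => [|i r ih].
  by apply: is_trig_ext (is_trig_cst 1) _ => x; rewrite big_nil.
by apply: is_trig_ext (is_trigM (tr i) ih) _ => x; rewrite big_cons.
Qed.

Lemma is_trig_fejer (m : nat) (i : 'I_d) (w c : R) :
  is_trig (fun x => fejer m (w * (x i 0) - c)).
Proof.
have h (a b : 'I_m) : is_trig (fun x => cos ((a%:R - b%:R) * (w * (x i 0) - c))).
  apply: is_trig_ext (is_trig_cos (((a%:R - b%:R) * w) *: delta_mx i 0) (- ((a%:R - b%:R) * c))) _ => x.
  by rewrite dotZl dot_delta; congr cos; ring.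
by apply: is_trigZ; apply: is_trig_sum => a; apply: is_trig_sum.
Qed.

End TrigAlgebra.

(** * Uniform approximation of periodic Lipschitz functions *)

Section TrigApprox.
Context {R : realType}.

Lemma cosD_2piz (x : R) (k : int) : cos (x + (pi *+ 2) * k%:~R) = cos x.
Proof.
have h (n : nat) (y : R) : cos (y + (pi *+ 2) * n%:R) = cos y.
  by rewrite mulr_natr (periodicn (@cosD2pi R)).
case: (intP k) => [|n|n]; first by rewrite mulr0 addr0.
  exact: h.
by rewrite mulrNz mulrN -[LHS](h n.+1) subrK.
Qed.

Lemma periodic_reduce (L x : R) : 0 < L -> exists k : int, `|x - L * k%:~R| <= L / 2.
Proof.
move=> L0; exists (Num.floor (x / L + 1 / 2)); set k := Num.floor _.
have h1 : k%:~R <= x / L + 1 / 2 by exact: floor_le_tmp.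
have h2 : x / L + 1 / 2 < k%:~R + 1 by rewrite -intrD1; exact: floorD1_gt.
have xE : x = L * (x / L) by rewrite mulrC divfK ?gt_eqF.
rewrite [in `|_|]xE -mulrBr normrM gtr0_norm// ler_pM2l// ler_norml; lra.
Qed.

(** The Fejer weights control 1 - cos, whereas a Lipschitz bound involves |r|. Either |r| <= del, or
    1 - cos is larger at r than at del and the second term already exceeds L / 2. *)
Lemma abs_le_1Bcos (L del r : R) : 0 < L -> 0 < del -> del <= L / 2 -> `|r| <= L / 2 ->
  `|r| <= del + L / 2 / (1 - cos ((pi *+ 2) / L * del)) * (1 - cos ((pi *+ 2) / L * r)).
Proof.
move=> L0 del0 delL rL; set w := (pi *+ 2) / L.
have w0 : 0 < w by rewrite divr_gt0// pmulrn_lgt0// pi_gt0.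
have wL : w * (L / 2) = pi by rewrite /w mulr2n; field; rewrite gt_eqF.
have pi2 : 0 <= w * del <= pi by rewrite mulr_ge0 ?(ltW w0) ?(ltW del0)//= -wL ler_pM2l.
have c0 : 0 < 1 - cos (w * del).
  rewrite subr_gt0 -(@cos0 R) ltr_cos ?in_itv//= ?lexx ?pi_ge0//.
  by rewrite mulr_gt0.
have [rdel|rdel] := leP `|r| del.
  rewrite (le_trans rdel)// lerDl; apply: mulr_ge0; last by rewrite subr_ge0 cos_le1.
  by apply: divr_ge0 (ltW c0); rewrite divr_ge0// ltW.
apply: (@le_trans _ _ (L / 2)) => //.
rewrite -[leLHS]add0r lerD ?(ltW del0)// -mulrA -[leLHS]mulr1.
rewrite ler_wpM2l ?divr_ge0 ?(ltW L0)// mulrC ler_pdivlMr// mul1r lerD2l lerN2.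
have -> : cos (w * r) = cos (w * `|r|).
  by have [r0|r0] := ger0P r; rewrite // mulrN cosN.
have pi1 : 0 <= w * `|r| <= pi by rewrite mulr_ge0 ?(ltW w0)//= -wL ler_pM2l.
by apply: ltW; rewrite ltr_cos ?in_itv//= ltr_pM2l.
Qed.

(** A discrete Fejer mean: the values of g on a finite grid of the period cell are averaged with
    weights that are products of one-dimensional kernels. Grid sums replace convolution
    integrals. *)
Lemma trig_approx (d : nat) (g : 'cV[R]_d -> R) (La L : R) : 0 <= La -> 0 < L ->
  (forall x y, `|g x - g y| <= La * \sum_i `|x i 0 - y i 0|) ->
  (forall x (k : 'I_d -> int), g (x + \col_i (L * (k i)%:~R)) = g x) ->
  forall eps, 0 < eps -> exists f : @trig R d, forall x, `|tF f 0 x - g x| <= eps.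
Proof.
move=> La0 L0 glip gper eps eps0.
pose w := (pi *+ 2) / L.
(* The summand 1 keeps A positive, so that it can be divided by even when La or d is 0. *)
pose A := La * d%:R + 1.
have A0 : 0 < A by rewrite /A ltr_wpDl// mulr_ge0.
pose del := Num.min (L / 2) (eps / 2 / A).
have del0 : 0 < del by rewrite /del lt_min !divr_gt0.
have delL : del <= L / 2 by rewrite /del ge_min lexx.
have delA : A * del <= eps / 2.
  by rewrite mulrC -ler_pdivlMr// /del ge_min lexx orbT.
pose C := L / 2 / (1 - cos (w * del)).
have C0 : 0 <= C by rewrite divr_ge0 ?subr_ge0 ?cos_le1// divr_ge0// ltW.
have [m m0 mC] : exists2 m : nat, (0 < m)%N & A * (C * (2 / m%:R)) <= eps / 2.
  pose q := A * (C * 2) / (eps / 2).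
  exists (Num.truncn q).+1 => //.
  have q0 : 0 <= q by rewrite divr_ge0 ?mulr_ge0// ltW// divr_gt0.
  rewrite !mulrA ler_pdivrMr ?ltr0n// [leRHS]mulrC -ler_pdivrMr ?divr_gt0//.
  have /andP[_ h] := truncn_itv q0; rewrite (le_trans _ (ltW h))// /q !mulrA; lra.
(* One grid point more than m per coordinate, since [sum_fejer_grid] asks for m < M. *)
pose M := m.+1.
have M0 : (0 : R) < M%:R by rewrite ltr0n.
pose t (x : 'cV[R]_d) (i : 'I_d) (j : 'I_M) := w * x i 0 - (pi *+ 2) / M%:R * j%:R.
pose kap x i j := M%:R^-1 * fejer m (t x i j).
pose pt (y : {ffun 'I_d -> 'I_M}) : 'cV[R]_d := \col_i (L / M%:R * (y i)%:R).
pose W (y : {ffun 'I_d -> 'I_M}) x := \prod_i kap x i (y i).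
have kap0 x i j : 0 <= kap x i j by rewrite mulr_ge0 ?invr_ge0// fejer_ge0.
have kap1 x i : \sum_j kap x i j = 1.
  by rewrite -mulr_sumr sum_fejer_grid ?m0 ?ltnSn// mulVf// gt_eqF.
have kapc x i : \sum_j kap x i j * (1 - cos (t x i j)) <= 2 / m%:R.
  have h j : kap x i j * (1 - cos (t x i j)) <= M%:R^-1 * (2 / m%:R).
    rewrite /kap -mulrA fejer_1Bcos ler_wpM2l ?invr_ge0// mulrC ler_wpM2r ?invr_ge0//.
    by have := cos_geN1 (m%:R * t x i j); lra.
  apply: le_trans (ler_sum _ (fun j _ => h j)) _.
  by rewrite sumr_const card_ord -[leLHS]mulr_natl mulVKf ?gt_eqF.
have W0 y x : 0 <= W y x by apply: prodr_ge0 => i _.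
have W1 x : \sum_y W y x = 1.
  by rewrite /W -(bigA_distr_bigA (fun i j => kap x i j))/= big1.
(* The factor 1 - cos sits in coordinate i; the sum over the grid factors, and every other
   coordinate contributes 1. *)
have Wc x i : \sum_y W y x * (1 - cos (t x i (y i))) <= 2 / m%:R.
  pose F i' j := kap x i' j * (if i' == i then 1 - cos (t x i' j) else 1).
  have -> : \sum_y W y x * (1 - cos (t x i (y i))) = \sum_(y : {ffun 'I_d -> 'I_M}) \prod_i' F i' (y i').
    apply: eq_bigr => y _; rewrite /F big_split/=; congr (_ * _).
    by rewrite (bigD1 i)//= eqxx big1 ?mulr1// => i' /negbTE->.
  rewrite -(bigA_distr_bigA F)/= (bigD1 i)//=.
  have o1 : \prod_(i' < d | i' != i) \sum_j F i' j = 1.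
    apply: big1 => i' i'i; rewrite -[RHS](kap1 x i').
    by apply: eq_bigr => j _; rewrite /F (negbTE i'i) mulr1.
  rewrite o1 mulr1 (eq_bigr (fun j => kap x i j * (1 - cos (t x i j))))// => j _.
  by rewrite /F eqxx.
(* Periodicity of g moves x to within half a period of the grid point in each coordinate before the
   Lipschitz bound is applied. *)
have gW y x : `|g (pt y) - g x| <= La * \sum_i (del + C * (1 - cos (t x i (y i)))).
  have hk i := periodic_reduce (pt y i 0 - x i 0) L0.
  pose k i := sval (cid (hk i)).
  have kP i : `|pt y i 0 - x i 0 - L * (k i)%:~R| <= L / 2 by rewrite /k; case: cid.
  rewrite -(gper x k) (le_trans (glip _ _))// ler_wpM2l// ler_sum// => i _.
  have -> : (x + \col_j (L * (k j)%:~R)) i 0 = x i 0 + L * (k i)%:~R by rewrite !mxE.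
  rewrite opprD addrA.
  rewrite (le_trans (abs_le_1Bcos L0 del0 delL (kP i)))// -/w -/C lerD2l ler_wpM2l// lerD2l lerN2.
  rewrite le_eqVlt; apply/orP; left; apply/eqP.
  rewrite -cosN -(cosD_2piz _ (- k i)); congr cos.
  by rewrite /t /w [pt y i 0]mxE mulrNz; field; rewrite !gt_eqF.
have tr : is_trig (fun x => \sum_y g (pt y) * W y x).
  apply: is_trig_sum => y; apply: is_trigZ; apply: is_trig_prod => i.
  by apply: is_trigZ; exact: is_trig_fejer.
have [f fE] := tr; exists f => x; rewrite fE.
have -> : \sum_y g (pt y) * W y x - g x = \sum_y (g (pt y) - g x) * W y x.
  rewrite -[g x in LHS]mulr1 -(W1 x) mulr_sumr -sumrB.
  by apply: eq_bigr => y _; rewrite mulrBl.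
rewrite (le_trans (ler_norm_sum _ _ _))//.
apply: (@le_trans _ _ (\sum_(y : {ffun 'I_d -> 'I_M}) (La * \sum_i (del + C * (1 - cos (t x i (y i))))) * W y x)).
  by apply: ler_sum => y _; rewrite normrM (ger0_norm (W0 _ _)) ler_wpM2r.
have -> : \sum_(y : {ffun 'I_d -> 'I_M}) (La * \sum_i (del + C * (1 - cos (t x i (y i))))) * W y x =
   La * \sum_i (del + C * \sum_y W y x * (1 - cos (t x i (y i)))).
  under eq_bigr do rewrite -mulrA mulr_suml.
  rewrite -mulr_sumr exchange_big/=; congr (_ * _); apply: eq_bigr => i _.
  under eq_bigr do rewrite mulrDl; rewrite big_split/= -mulr_sumr W1 mulr1; congr (_ + _).
  by rewrite mulr_sumr; apply: eq_bigr => y _; ring.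
have sl : \sum_(i < d) (del + C * \sum_y W y x * (1 - cos (t x i (y i)))) <= d%:R * (del + C * (2 / m%:R)).
  apply: (@le_trans _ _ (\sum_(i < d) (del + C * (2 / m%:R)))).
    by apply: ler_sum => i _; rewrite lerD2l ler_wpM2l.
  by rewrite sumr_const card_ord -[leLHS]mulr_natl.
rewrite (le_trans (ler_wpM2l La0 sl))// mulrA.
apply: (@le_trans _ _ (A * (del + C * (2 / m%:R)))).
  apply: ler_wpM2r; last by rewrite /A lerDl ler01.
  by rewrite addr_ge0 ?(ltW del0)// mulr_ge0// divr_ge0.
by rewrite mulrDr [leRHS](splitr eps) lerD.
Qed.

End TrigApprox.

(** * Smoothed indicators of periodized sets *)

Section TrigIndicator.
Context {R : realType} {d : nat}.
Implicit Types (x y : 'cV[R]_d) (p : \bar R).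

Let clamp (u : R) : R := Num.min 1 (Num.max 0 u).

Let clamp01 u : 0 <= clamp u <= 1.
Proof. by rewrite /clamp le_min ge_min ler01 lexx/= le_max lexx. Qed.

Let clamp_lip u v : `|clamp u - clamp v| <= `|u - v|.
Proof.
have h s t : s <= t -> `|clamp s - clamp t| <= `|s - t|.
  move=> st; rewrite (ler0_norm (_ : s - t <= 0)) ?subr_le0// ler_norml.
  have cE u' : [\/ u' <= 0 /\ clamp u' = 0, 0 <= u' <= 1 /\ clamp u' = u' | 1 <= u' /\ clamp u' = 1].
    rewrite /clamp; have [u0|u0] := leP u' 0.
      by apply: Or31; split => //; rewrite min_r.
    have [u1|u1] := leP 1 u'; first by apply: Or33.
    by apply: Or32; split => //; rewrite !ltW.
  have [[s1 ->]|[s1 ->]|[s1 ->]] := cE s; have [[t1 ->]|[t1 ->]|[t1 ->]] := cE t; lra.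
by have [uv|/ltW vu] := leP u v; [exact: h|rewrite (distrC (clamp u)) (distrC u); exact: h].
Qed.

Let shiftL (L : R) (k : 'I_d -> int) : 'cV[R]_d := \col_i (L * (k i)%:~R).

Let periodize (L : R) (A : set 'cV[R]_d) : set 'cV[R]_d :=
  [set y | exists k : 'I_d -> int, A (y - shiftL L k)].

Let dist p x (A : set 'cV[R]_d) : R := inf [set lpnorm p (x - y) | y in A].

Let has_inf_dist p x (A : set 'cV[R]_d) : A !=set0 ->
  has_inf [set lpnorm p (x - y) | y in A].
Proof.
move=> [y Ay]; split; first by exists (lpnorm p (x - y)), y.
by exists 0 => _ [z _ <-]; exact: lpnorm_ge0.
Qed.

Let dist_le p x y (A : set 'cV[R]_d) : A y -> dist p x A <= lpnorm p (x - y).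
Proof.
move=> Ay; apply: ge_inf; last by exists y.
by have [] := @has_inf_dist p x A (ex_intro _ y Ay).
Qed.

Let dist_lip p x y (A : set 'cV[R]_d) : (1 <= p)%E -> A !=set0 ->
  dist p x A <= dist p y A + lpnorm p (x - y).
Proof.
move=> p1 A0; rewrite -lerBlDr; apply: lb_le_inf; first by have [] := has_inf_dist p y A0.
move=> _ [z Az <-]; rewrite lerBlDr (le_trans (dist_le p x Az))//.
have -> : x - z = (y - z) + (x - y) by rewrite [RHS]addrC addrA subrK.
exact: ler_lpnormD.
Qed.

(** The approximated function is clamp((a + b - dist(x, A')) / b), where A' is the union of the
    translates of A by the period lattice: 1 within a of A', 0 beyond a + b, and 1 / b-Lipschitz.
    The margins a and c pay for a shift y, later a Gaussian noise. Inside the box of half side L / 4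
    the other translates of A are too far away to be seen. *)
Lemma trig_indicator p (A : set 'cV[R]_d) (a b c L eps : R) : (1 <= p)%E ->
  0 < a -> 0 < b -> 0 <= c -> A !=set0 ->
  (forall x, A x -> forall j, `|x j 0| <= L / 4) -> a + b + c <= L / 2 -> 0 < eps ->
  exists f : @trig R d, [/\
    forall x y, `|tF f 0 x - tF f 0 y| <= lpnorm p (x - y) / b + 2 * eps,
    forall x y, A x -> lpnorm p y <= a -> 1 - eps <= tF f 0 (x + y),
    forall x, - eps <= tF f 0 x <= 1 + eps &
    forall x y, (forall j, `|x j 0| <= L / 4) -> lpnorm p y <= c ->
      ~ enlarge p (a + b + c) A x -> tF f 0 (x + y) <= eps].
Proof.
move=> p1 a0 b0 c0 A0 AL abcL eps0.
have L0 : 0 < L by move: abcL; lra.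
pose A' := periodize L A.
have AA' x : A x -> A' x.
  move=> Ax; exists (fun=> 0); have -> : shiftL L (fun=> 0) = 0.
    by apply/matrixP => i j; rewrite !mxE mulr0.
  by rewrite subr0.
have A'0 : A' !=set0 by have [x Ax] := A0; exists x; exact: AA'.
pose g x := clamp ((a + b - dist p x A') / b).
have glip x y : `|g x - g y| <= lpnorm p (x - y) / b.
  rewrite (le_trans (clamp_lip _ _))//.
  have -> : (a + b - dist p x A') / b - (a + b - dist p y A') / b = (dist p y A' - dist p x A') / b.
    by field; rewrite gt_eqF.
  rewrite normrM (gtr0_norm (_ : 0 < b^-1)) ?invr_gt0// ler_wpM2r ?invr_ge0 ?(ltW b0)//.
  have h1 := dist_lip x y p1 A'0; have h2 := dist_lip y x p1 A'0.
  by rewrite -(lpnormN (y - x)) ?opprB// in h2; rewrite ler_norml; lra.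
have gper x (k : 'I_d -> int) : g (x + shiftL L k) = g x.
  rewrite /g; congr (clamp ((a + b - inf _) / b)).
  apply/seteqP; split => _ [y [l Ay] <-].
    exists (y - shiftL L k); last by rewrite opprB addrA.
    exists (fun i => l i - k i); congr A: Ay; rewrite -addrA; congr (_ + _).
    by apply/matrixP => i j; rewrite !mxE intrB; ring.
  exists (y + shiftL L k); last by rewrite opprD addrACA subrr addr0.
  exists (fun i => l i + k i); congr A: Ay; rewrite -addrA; congr (_ + _).
  by apply/matrixP => i j; rewrite !mxE intrD; ring.
have glip1 x y : `|g x - g y| <= (1 + d%:R) / b * \sum_i `|x i 0 - y i 0|.
  rewrite (le_trans (glip x y))// mulrAC ler_wpM2r ?invr_ge0 ?(ltW b0)//.
  rewrite (le_trans (lpnorm_le_sum _ p1))// ler_wpM2l// ?addr_ge0//.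
  by apply: ler_sum => i _; rewrite !mxE.
have La0 : 0 <= (1 + d%:R) / b by rewrite divr_ge0 ?addr_ge0// ltW.
have [f fg] := trig_approx La0 L0 glip1 gper eps0.
have fg' x : g x - eps <= tF f 0 x <= g x + eps.
  by have := fg x; rewrite ler_norml; lra.
exists f; split.
- move=> x y; have := fg x; have := fg y; have := glip x y.
  rewrite !ler_norml; lra.
- move=> x y Ax ya.
  have g1 : g (x + y) = 1.
    rewrite /g /clamp; apply/min_idPl; rewrite le_max; apply/orP; right.
    rewrite ler_pdivlMr// mul1r.
    have := dist_le p (x + y) (AA' _ Ax); rewrite addrAC subrr add0r; lra.
  by have := fg' (x + y); rewrite g1 => /andP[].
- move=> x; have := fg' x; have := clamp01 ((a + b - dist p x A') / b).
  by rewrite -/(g x); lra.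
- move=> x y xL yc nx.
  have := fg' (x + y); suff -> : g (x + y) = 0 by rewrite !add0r => /andP[].
  rewrite /g /clamp; have [h|h] := leP ((a + b - dist p (x + y) A') / b) 0.
    by rewrite min_r.
  exfalso; apply: nx.
  have h' : dist p (x + y) A' < a + b by move: h; rewrite pmulr_lgt0 ?invr_gt0// subr_gt0.
  have [_ [z [k Az] <-] zlt] := inf_lt (has_inf_dist p (x + y) A'0).1 h'.
  have xz : lpnorm p (x - z) < a + b + c.
    have -> : x - z = (x + y - z) - y by rewrite addrAC addrK.
    by rewrite (le_lt_trans (ler_lpnormB _ _ p1))// ltr_leD.
  (* A nonzero k_i would give L <= |L k_i| <= |x_i - z_i| + |x_i| + |z_i - L k_i| < (a + b + c) + L
     / 4 + L / 4 <= L. *)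
  have k0 i : k i = 0.
    apply/eqP; apply: contraT => ki.
    have := le_lt_trans (lpnorm_coord (x - z) i p1) xz.
    have := AL _ Az i; rewrite !mxE => h1.
    have := xL i => h2.
    have h3 : L <= `|L * (k i)%:~R|.
      by rewrite normrM (gtr0_norm L0) ler_peMr ?(ltW L0)// -intr_norm ler1z -gtz0_ge1 normr_gt0.
    have h4 : `|L * (k i)%:~R| <= `|x i 0 - z i 0| + (`|x i 0| + `|z i 0 - L * (k i)%:~R|).
      have e : L * (k i)%:~R = - (x i 0 - z i 0) + (x i 0 - (z i 0 - L * (k i)%:~R)) by ring.
      rewrite [X in `|X| <= _]e.
      by apply: le_trans (ler_normD _ _) _; rewrite normrN lerD2l ler_normB.
    move=> h5; exfalso; move: h1 h2 h3 h4 h5 abcL.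
    by move: `|x i 0 - z i 0| `|z i 0 - L * _| `|x i 0| `|L * _| => t1 t2 t3 t4; lra.
  have Az' : A z.
    congr A: Az; rewrite -[RHS]subr0; congr (_ - _).
    by apply/matrixP => i j; rewrite !mxE k0 mulr0.
  apply: ereal_inf_le; exists (lpnorm p (x - z))%:E; first by exists z.
  by rewrite lee_fin ltW.
Qed.

End TrigIndicator.

(** * Gaussian tails *)

Section GaussianTail.
Context {R : realType} {d : nat}.

Lemma phi_gt0 (p : \bar R) : (1 <= p)%E -> (0 < d)%N -> 0 < phi p d.
Proof.
case: p => [r| |]//=.
- rewrite lee_fin => r1 d0; rewrite sqrtr_gt0 mulr_gt0//; first exact: lt_le_trans r1.
  by rewrite powR_gt0// ltr0n.
- move=> _ d0; rewrite sqrtr_gt0 mulr_gt0// ln_gt0// -natrM ltr1n.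
  by rewrite (leq_trans (_ : 2 <= 2 * 1)%N)// leq_mul2l.
Qed.

(** From exp(v / 4)^2 >= (1 + v / 4)^2 >= v with v = u^2 / r, raised to the power r / 2. *)
Lemma powR_le_expR_sqr (r u : R) : 1 <= r ->
  `|u| `^ r <= r `^ (r / 2) * expR (u ^+ 2 / 4).
Proof.
move=> r1; have r0 : 0 < r by exact: lt_le_trans r1.
have h : u ^+ 2 <= r * expR (u ^+ 2 / r / 2).
  rewrite -ler_pdivrMl// mulrC; set v := u ^+ 2 / r.
  have -> : v / 2 = v / 4 + v / 4 by field.
  rewrite expRD.
  have v0 : 0 <= v by rewrite divr_ge0 ?sqr_ge0// ltW.
  have h1 := expR_ge1Dx (v / 4).
  apply: le_trans (_ : (1 + v / 4) * (1 + v / 4) <= _); last first.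
    by apply: ler_pM => //; move: v0; lra.
  rewrite -subr_ge0.
  have -> : (1 + v / 4) * (1 + v / 4) - v = (1 - v / 4) ^+ 2 by field.
  exact: sqr_ge0.
have -> : `|u| `^ r = (u ^+ 2) `^ (r / 2).
  rewrite -(real_normK (num_real u)) -powR_mulrn// -powRrM.
  by congr (_ `^ _); field.
apply: le_trans (ge0_ler_powR _ _ _ h) _; rewrite ?nnegrE ?sqr_ge0//.
- by rewrite divr_ge0 ?ltW.
- by rewrite mulr_ge0 ?expR_ge0 ?ltW.
rewrite powRM ?expR_ge0 ?(ltW r0)//.
rewrite -expRM.
have -> : u ^+ 2 / r / 2 * (r / 2) = u ^+ 2 / 4 by field; rewrite gt_eqF.
exact: lexx.
Qed.

(** The deterministic half of a Markov argument: the right side will have Gaussian mean at most 2 d.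
    The form of [phi] is what the inequality asks for: phi_p^p = p^(p/2) d for finite p, and
    exp(phi_oo^2 / 2) = 2 d. *)
Lemma gaussian_tail_pointwise (p : \bar R) (lam a : R) (y : 'cV[R]_d) :
  (1 <= p)%E -> (0 < d)%N -> 0 < lam -> 0 < a -> 2 * (lam * phi p d) <= a ->
  a < lpnorm p y ->
  d%:R * (a / (lam * phi p d)) <= \sum_j expR (y j 0 ^+ 2 / (4 * lam ^+ 2)).
Proof.
move=> p1 d0 l0 a0; have f0 := phi_gt0 p1 d0.
have d0' : 0 < d%:R :> R by rewrite ltr0n.
move=> h; set t := a / (lam * phi p d).
have t2 : 2 <= t by rewrite ler_pdivlMr// mulr_gt0.
have t0 : 0 <= t by rewrite (le_trans _ t2).
have at' : a = t * (lam * phi p d) by rewrite divfK// gt_eqF// mulr_gt0.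
case: p p1 f0 h @t t2 t0 at' => [r| |]//.
- rewrite lee_fin => r1 f0 h t t2 t0 at' alt.
  have r0 : 0 < r by exact: lt_le_trans r1.
  have h1 : a `^ r < \sum_j `|y j 0| `^ r.
    have S0 : 0 <= \sum_j `|y j 0| `^ r by apply: sumr_ge0 => j _; exact: powR_ge0.
    have -> : \sum_j `|y j 0| `^ r = lpnorm r%:E y `^ r.
      by rewrite /lpnorm -powRrM mulVf ?gt_eqF// powRr1.
    by apply: gt0_ltr_powR => //; rewrite nnegrE ?lpnorm_ge0// ltW.
  have h2 : \sum_j `|y j 0| `^ r <=
      lam `^ r * r `^ (r / 2) * \sum_j expR (y j 0 ^+ 2 / (4 * lam ^+ 2)).
    rewrite mulr_sumr; apply: ler_sum => j _.
    have -> : `|y j 0| = lam * `|y j 0 / lam|.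
      by rewrite normrM normfV (gtr0_norm l0) mulrCA mulfV ?mulr1// gt_eqF.
    rewrite powRM ?(ltW l0)// -mulrA ler_wpM2l ?powR_ge0//.
    have := powR_le_expR_sqr (y j 0 / lam) r1.
    have -> // : (y j 0 / lam) ^+ 2 / 4 = y j 0 ^+ 2 / (4 * lam ^+ 2).
    by field; rewrite gt_eqF.
  have h3 : a `^ r = t `^ r * (lam `^ r * r `^ (r / 2)) * d%:R.
    rewrite {1}at' (powRM _ t0 (mulr_ge0 (ltW l0) (ltW f0))).
    rewrite (powRM _ (ltW l0) (ltW f0)) -!mulrA; congr (_ * (_ * _)).
    rewrite /phi -powR12_sqrt; last by rewrite mulr_ge0 ?powR_ge0// ltW.
    rewrite -powRrM powRM ?(ltW r0) ?powR_ge0// -powRrM.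
    have -> : (2 / r * (2^-1 * r)) = 1 by field; rewrite gt_eqF.
    by rewrite powRr1// (mulrC 2^-1).
  set K := lam `^ r * r `^ (r / 2) in h2 h3.
  have K0 : 0 < K by rewrite mulr_gt0 ?powR_gt0.
  have h4 : t <= t `^ r by apply: le1r_powR; rewrite // (le_trans _ t2)// ler1n.
  rewrite -(ler_pM2l K0); apply: le_trans h2; apply: le_trans (ltW h1).
  rewrite h3 mulrCA mulrC (mulrC K) ler_pM2r// ler_pM2r//.
- move=> _ f0 h t t2 t0 at' alt.
  (* For the maximum norm one large coordinate suffices: exp((t q)^2 / 4) >= 2 d (t^2 / 4 + 1 / 2)
     >= d t, where the first inequality uses q^2 >= 1 and t >= 2. *)
  have [j jy] : exists j, a < `|y j 0|.
    apply/existsP; rewrite -[X in is_true X]negbK negb_exists; apply/negP => /forallP hj.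
    move: alt; rewrite ltNge => /negP; apply; rewrite /lpnorm.
    by apply: bigmax_le => [|j _]; [exact: ltW|rewrite leNgt].
  apply: le_trans (_ : expR (y j 0 ^+ 2 / (4 * lam ^+ 2)) <= _); last first.
    rewrite (bigD1 j)//= lerDl sumr_ge0// => i _; exact: expR_ge0.
  set q := phi +oo d in f0 h t t2 t0 at' *.
  have q2 : q ^+ 2 = 2 * ln (2 * d%:R).
    rewrite sqr_sqrtr// mulr_ge0// ln_ge0// -natrM ler1n muln_gt0//.
  have e2d : expR (q ^+ 2 / 2) = 2 * d%:R.
    rewrite q2; have -> : 2 * ln (2 * d%:R) / 2 = ln (2 * d%:R) :> R by field.
    by rewrite lnK// posrE mulr_gt0.
  have q1 : 1 <= q ^+ 2.
    have hh : expR (2^-1 : R) <= 2 * d%:R.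
      apply: le_trans (_ : 2 <= _); last by rewrite ler_peMr// ler1n.
      rewrite -[2]invrK -lef_pV2 ?posrE ?invr_gt0 ?expR_gt0// invrK -expRN.
      by have := expR_ge1Dx (- 2^-1 : R); lra.
    by move: hh; rewrite -e2d ler_expR; lra.
  apply: le_trans (_ : expR ((t * q) ^+ 2 / 4) <= _); last first.
    rewrite ler_expR; have -> : (t * q) ^+ 2 / 4 = a ^+ 2 / (4 * lam ^+ 2).
      by rewrite at'; field; rewrite gt_eqF.
    rewrite ler_wpM2r ?invr_ge0 ?mulr_ge0 ?(ltW l0)//.
    by rewrite -(real_normK (num_real (y j 0))) lerXn2r ?nnegrE ?(ltW a0) ?(ltW jy).
  have -> : (t * q) ^+ 2 / 4 = q ^+ 2 / 2 + q ^+ 2 * (t ^+ 2 / 4 - 2^-1) by field.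
  rewrite expRD e2d.
  have h5 : t ^+ 2 / 4 + 2^-1 <= expR (q ^+ 2 * (t ^+ 2 / 4 - 2^-1)).
    apply: le_trans (expR_ge1Dx _); rewrite -lerBlDl.
    have -> : t ^+ 2 / 4 + 2^-1 - 1 = 1 * (t ^+ 2 / 4 - 2^-1) by field.
    apply: ler_wpM2r => //; nra.
  apply: le_trans (ler_wpM2l _ h5); last by rewrite mulr_ge0 ?(ltW d0').
  rewrite (mulrC 2) -mulrA ler_pM2l//; have := sqr_ge0 (t - 1); rewrite sqrrB1; lra.
Qed.

Context {dsp : measure_display} {W : measurableType dsp} (P : probability W R).

(** When a <= 2 lam phi the bound is at least 1. Otherwise Markov applies to the sum of
    exponentials, whose mean is computed one coordinate at a time. *)
Lemma gaussian_tail (Y : W -> 'cV[R]_d) (S : 'M[R]_d) (p : \bar R) (lam a : R) :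
  measurable_fun setT Y -> psdmx S -> gaussian_vector P S Y ->
  (forall j, S j j <= lam ^+ 2) ->
  (1 <= p)%E -> (0 < d)%N -> 0 < lam -> 0 < a ->
  (P [set w | (a < lpnorm p (Y w))%R] <= (2 * (lam * phi p d) / a)%:E)%E.
Proof.
move=> mY pS gY Sl p1 d0 l0 a0.
have f0 := phi_gt0 p1 d0.
have mA : measurable [set w | a < lpnorm p (Y w)].
  have := measurable_lpnorm p mY => /(_ measurableT `]a, +oo[%classic).
  rewrite setTI => /(_ (measurable_itv _)); congr measurable.
  by apply/seteqP; split => w /=; rewrite in_itv/= andbT.
have [h|h] := leP a (2 * (lam * phi p d)).
  apply: le_trans (probability_le1 P mA) _.
  by rewrite lee_fin ler_pdivlMr ?mul1r.
pose g w := (\sum_j expR (Y w j 0 ^+ 2 / (4 * lam ^+ 2)))%:E : \bar R.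
set t := d%:R * (a / (lam * phi p d)).
have t0 : 0 < t by rewrite mulr_gt0 ?ltr0n// divr_gt0// mulr_gt0.
have mj j : measurable_fun setT (fun w => (expR (Y w j 0 ^+ 2 / (4 * lam ^+ 2)))).
  apply: measurableT_comp => //; apply: measurable_funM => //.
  apply: (measurable_funX 2); exact: measurable_entry.
have mg : measurable_fun setT g.
  by apply/measurable_EFinP; apply: measurable_sum.
have g0 w : (0 <= g w)%E.
  by rewrite lee_fin; apply: sumr_ge0 => j _; exact: expR_ge0.
have Eg : (\int[P]_w g w <= (2 * d%:R)%:E)%E.
  under eq_integral do rewrite /g -sumEFin.
  rewrite ge0_integral_sum//; last 1 first.
  - by move=> j; apply/measurable_EFinP.
  apply: (@le_trans _ _ (\sum_(j < d) 2%:E)%E); last first.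
    by rewrite sumEFin lee_fin sumr_const card_ord mulr_natr.
  apply: lee_sum => j _.
  have mYj : measurable_fun setT (fun w => Y w j 0) by exact: measurable_entry.
  apply: (@gaussian_expR_sqr R _ W P (fun w => Y w j 0) (Num.sqrt (S j j)) mYj) => //.
  - move=> B mB; have := gY (delta_mx j 0) B mB.
    rewrite -/(qf _ _) qf_delta.
    have -> // : [set w | B (Y w j 0)] = [set w | B (dot (delta_mx j 0) (Y w))].
    by apply/seteqP; split => w /=; rewrite dot_delta.
  - by rewrite sqr_sqrtr// -qf_delta psdmx_ge0.
have := le_integral_abse P measurableT mg t0.
rewrite setTI.
under [X in (_ <= X)%E]eq_integral do rewrite gee0_abs//.
move=> /le_trans /(_ Eg) h1.
have h2 : (t%:E * P [set w | (a < lpnorm p (Y w))%R] <= (2 * d%:R)%:E)%E.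
  apply: le_trans h1; apply: lee_pmul => //; first by rewrite lee_fin ltW.
  apply: le_measure; rewrite ?inE//.
    rewrite -[X in measurable X]setTI; apply: emeasurable_fun_c_infty => //.
    exact: measurableT_comp.
  move=> w /= /(gaussian_tail_pointwise p1 d0 l0 a0 (ltW h)) hw.
  by rewrite ger0_norm ?lee_fin// -lee_fin; exact: g0.
have -> : 2 * (lam * phi p d) / a = t^-1 * (2 * d%:R).
  rewrite /t; field.
  by rewrite ?gt_eqF// ltr0n.
by rewrite EFinM lee_pdivlMl.
Qed.

End GaussianTail.

(** * Conditional moments *)

Section PsdMeasurability.
Context {R : realType}.

(** A failure is witnessed by one vector u with qf M u < 0 or by one asymmetric pair of entries, and
    either witness persists nearby. *)
Lemma closed_psdmx d : closed [set M : 'M[R]_d | psdmx M].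
Proof.
rewrite -[X in closed X]setCK; apply: open_closedC; rewrite openE => M /= nM.
have [sM|sM] := eqVneq M^T M.
  have [u qu] : exists u, qf M u < 0.
    apply: contrapT => h; apply: nM; split => // u; rewrite leNgt; apply/negP => qu.
    by apply: h; exists u.
  (* The summand 1 makes K positive and the perturbation bound strict. *)
  pose K := 1 + \sum_(i < d) \sum_(j < d) dot u u.
  have u0 := dot_ge0 u.
  have K0 : 0 < K.
    by rewrite ltr_pwDl//; apply: sumr_ge0 => i _; apply: sumr_ge0.
  apply/mx_nbhsP; exists (- qf M u / K); first by rewrite divr_gt0// oppr_gt0.
  move=> N MN [_ /(_ u)]; rewrite -/(qf _ _) => qN.
  have := normr_qf_le (N - M) u; rewrite qfB => h.
  have h2 : mxabs (N - M) * dot u u < - qf M u.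
    apply: le_lt_trans (_ : (- qf M u / K) * (K - 1) < _); last first.
      rewrite -mulrA gtr_pMr ?oppr_gt0// mulrC ltr_pdivrMr// mul1r.
      by rewrite gtrBl.
    have -> : K - 1 = \sum_(i < d) \sum_(j < d) dot u u by rewrite /K addrAC subrr add0r.
    rewrite /mxabs mulr_suml mulr_sumr; apply: ler_sum => i _.
    rewrite mulr_suml mulr_sumr; apply: ler_sum => j _.
    rewrite ler_wpM2r// !mxE distrC; apply: ltW; exact: MN.
  by have := le_lt_trans (ler_norm _) (le_lt_trans h h2); move: qN qu; lra.
have [i [j hij]] : exists i j, M^T i j != M i j.
  apply: contrapT => h; move/negP: sM; apply; apply/eqP/matrixP => i j.
  by apply: contrapT => hij; apply: h; exists i, j; apply/eqP.
apply/mx_nbhsP; exists (`|M j i - M i j| / 2).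
  by rewrite divr_gt0// normr_gt0 subr_eq0; move: hij; rewrite mxE.
move=> N MN [sN _]; have e : N j i = N i j by rewrite -[in RHS]sN mxE.
have h1 := MN i j; have h2 := MN j i.
have : `|M j i - M i j| <= `|M j i - N j i| + `|M i j - N i j|.
  have -> : M j i - M i j = (M j i - N j i) - (M i j - N i j) by rewrite e; ring.
  exact: ler_normB.
by move=> h3; have := le_lt_trans h3 (ltrD h2 h1); rewrite -splitr ltxx.
Qed.

Lemma measurable_psdmx d : measurable [set M : 'M[R]_d | psdmx M].
Proof. by apply: closed_measurable_mx; exact: closed_psdmx. Qed.

Lemma measurable_sqrt_approx d k :
  measurable_fun setT (fun M : 'M[R]_d.+1 => sqrt_approx M k).
Proof.
have mc i j : measurable_fun setT (fun M : 'M[R]_d.+1 => M i j) by exact: measurable_coord.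
have ms : measurable_fun setT (fun M : 'M[R]_d.+1 => sqrt_scale M).
  apply: measurable_funD => //; apply: measurable_sum => i; apply: measurable_sum => j.
  exact: measurableT_comp.
have mi : measurable_fun setT (fun M : 'M[R]_d.+1 => (sqrt_scale M)^-1).
  have -> : (fun M : 'M[R]_d.+1 => (sqrt_scale M)^-1) = (fun M => sqrt_scale M `^ (-1)).
    by apply/funext => M; rewrite powR_inv1// ltW// sqrt_scale_gt0.
  exact: (measurableT_comp (measurable_powR (-1)) ms).
have ma : measurable_fun setT (fun M : 'M[R]_d.+1 => sqrt_arg M).
  apply: measurable_addmx => //; apply: measurable_oppmx.
  by apply: measurable_scalemx => //; apply: measurable_mx.
apply: measurable_scalemx.
  apply: (measurableT_comp _ ms); apply: continuous_measurable_fun; exact: sqrt_continuous.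
apply: measurable_addmx => //; apply: measurable_oppmx.
elim: k => [|k IH].
  by under eq_fun do rewrite /sqrt_iter/= rmorph0; exact: measurable_cst.
under eq_fun do rewrite sqrt_iterS.
apply: measurable_scalemx => //; apply: measurable_addmx => //.
exact: measurable_mulmx.
Qed.

(** A pointwise limit of measurable approximants. They are cut off by the indicator of the
    semi-definite cone, since their convergence is known only there and [psd_sqrt] is 0
    elsewhere. *)
Lemma measurable_psd_sqrt d : measurable_fun setT (@psd_sqrt R d.+1).
Proof.
apply: measurable_mx => i j.
pose h k (M : 'M[R]_d.+1) := \1_[set M : 'M[R]_d.+1 | psdmx M] M * sqrt_approx M k i j.
apply: (measurable_fun_cvg (h := h)) => [k|M _].
  apply: measurable_funM.
    by apply: measurable_indic; exact: measurable_psdmx.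
  exact: (measurable_entry i j (@measurable_sqrt_approx d k)).
have [pM|nM] := pselect (psdmx M).
  have [_ _ /(_ i j)] := psd_sqrtP pM.
  have -> // : h ^~ M = (fun k => sqrt_approx M k i j).
  by apply/funext => k; rewrite /h indicE mem_set// mul1r.
rewrite psd_sqrt_notpsd// mxE.
have -> : h ^~ M = cst 0 by apply/funext => k; rewrite /h indicE memNset// mul0r.
exact: cvg_cst.
Qed.

End PsdMeasurability.

(** * Testing against the events of a sub-sigma-algebra *)

Section SubSigmaAlgebra.
Context {R : realType} {dsp : measure_display} {W : measurableType dsp}
  (P : probability W R) (G : set (set W)).
Hypothesis (sG : sigma_algebra setT G) (GM : G `<=` measurable).

Local Notation WG := (g_sigma_algebraType G).

Lemma measurable_wrtP {dsp'} {T : measurableType dsp'} (f : W -> T) :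
  measurable_wrt G f <-> measurable_fun (setT : set WG) (f : WG -> T).
Proof.
split=> [hf _ B mB|mf B mB].
  by rewrite setTI; apply: sub_sigma_algebra; exact: hf.
by have := mf measurableT B mB; rewrite setTI /measurable/= sigma_algebra_id.
Qed.

Lemma measurable_fun_sub {dsp'} {T : measurableType dsp'} (f : W -> T) :
  measurable_fun (setT : set WG) (f : WG -> T) -> measurable_fun setT f.
Proof.
move=> /measurable_wrtP hf _ B mB; rewrite setTI; apply: GM; exact: hf.
Qed.

Lemma measurable_sub (A : set W) : measurable (A : set WG) -> G A.
Proof. by rewrite /measurable/= sigma_algebra_id. Qed.

Lemma integrable_boundedM (f h : W -> R) (C : R) :
  P.-integrable setT (EFin \o f) -> measurable_fun setT h -> (forall w, `|h w| <= C) ->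
  P.-integrable setT (EFin \o (fun w => h w * f w)).
Proof.
move=> fi mh hC; have mf : measurable_fun setT f by apply/measurable_EFinP; case/integrableP : fi.
apply: (integrable_le (g := fun w => C * `|f w|)).
- exact: measurable_funM.
- by apply: integrable_EFinZ; exact: (integrable_norm fi).
- by move=> w; rewrite normrM ler_wpM2r.
Qed.

Let null (phi : W -> R) := forall A, G A -> \int[P]_w (\1_A w * phi w) = 0.

(* Removing the leading binary digit of h leaves the integral unchanged and halves the bound. *)
Let null_digits (phi : W -> R) k (h : W -> R) (C : R) : P.-integrable setT (EFin \o phi) -> null phi ->
  measurable_fun (setT : set WG) (h : WG -> R) -> (forall w, 0 <= h w <= C) ->
  `|\int[P]_w (h w * phi w)| <= C / 2 ^+ k * \int[P]_w `|phi w|.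
Proof.
move=> iphi nphi; elim: k h C => [|k IH] h C mh hC.
  have hC' w : `|h w| <= C by have /andP[h0 h1] := hC w; rewrite ger0_norm.
  have mh' := measurable_fun_sub mh.
  rewrite expr0 divr1; apply: le_trans (le_normr_Rintegral measurableT _) _.
    exact: integrable_boundedM hC'.
  rewrite -RintegralZl//; last exact: (integrable_norm iphi).
  apply: le_RintegralT.
  - exact: (integrable_norm (integrable_boundedM iphi mh' hC')).
  - by apply: integrable_EFinZ; exact: (integrable_norm iphi).
  - by move=> w; rewrite normrM ler_wpM2r.
pose A := [set w | C / 2 <= h w].
have GA : G A.
  apply: measurable_sub; have := mh measurableT `[C / 2, +oo[%classic (measurable_itv _).
  by rewrite setTI; congr measurable; apply/seteqP; split => w /=; rewrite in_itv/= andbT.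
have mA : measurable (A : set WG) by exact: sub_sigma_algebra.
pose h' w := h w - C / 2 * \1_A w.
have mh' : measurable_fun (setT : set WG) (h' : WG -> R).
  apply: measurable_funB => //; apply: measurable_funM => //; exact: measurable_indic.
have hC' w : 0 <= h' w <= C / 2.
  have := hC w; rewrite /h' indicE; have [wA|wA] := boolP (w \in A).
    by move: wA; rewrite inE /A/= mulr1n mulr1; lra.
  by move: wA; rewrite notin_setE /A/= mulr0n mulr0 => /negP; rewrite -ltNge; lra.
have b' w : `|h' w| <= C / 2 by have /andP[h0 h1] := hC' w; rewrite ger0_norm.
have b1 w : `|\1_A w| <= 1 :> R by rewrite indicE ger0_norm// lern1 leq_b1.
have -> : \int[P]_w (h w * phi w) = \int[P]_w (h' w * phi w).
  transitivity (\int[P]_w (h' w * phi w + C / 2 * (\1_A w * phi w))).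
    by apply: eq_Rintegral => w _; rewrite /h'; ring.
  have i1 : P.-integrable setT (EFin \o (fun w => h' w * phi w)).
    apply: integrable_boundedM b' => //; exact: measurable_fun_sub.
  have i2 : P.-integrable setT (EFin \o (fun w => \1_A w * phi w)).
    by apply: integrable_boundedM b1 => //; apply: measurable_indic; exact: GM.
  rewrite RintegralD//; last exact: integrable_EFinZ.
  by rewrite RintegralZl// nphi// mulr0 addr0.
apply: le_trans (IH _ _ mh' hC') _.
by rewrite exprS invfM mulrA.
Qed.

(** A shift by C makes h nonnegative, and [null_digits] then bounds the integral by 2 C |phi|_1 /
    2^k for every k. With it, conditional centering survives multiplication by bounded factors that
    depend on the past. *)
Lemma null_boundedM (phi h : W -> R) (C : R) : P.-integrable setT (EFin \o phi) ->
  (forall A, G A -> \int[P]_w (\1_A w * phi w) = 0) ->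
  measurable_fun (setT : set WG) (h : WG -> R) -> (forall w, `|h w| <= C) ->
  \int[P]_w (h w * phi w) = 0.
Proof.
move=> iphi nphi mh hC.
have hC' w : 0 <= h w + C <= 2 * C.
  by have := hC w; rewrite ler_norml; lra.
have mhC : measurable_fun (setT : set WG) ((fun w => h w + C) : WG -> R).
  exact: measurable_funD.
have e0 : \int[P]_w ((h w + C) * phi w) = 0.
  apply/eqP; rewrite -normr_le0; apply/ler_addgt0Pr => e e0; rewrite add0r.
  set I := \int[P]_w `|phi w|.
  have I0 : 0 <= I by apply: Rintegral_ge0.
  have [k hk] : exists k, `|2 * C * I| / e < 2 ^+ k.
    exists (Num.truncn (`|2 * C * I| / e)).+1; apply: lt_le_trans (truncnS_gt _) _.
    by rewrite -natrX ler_nat ltnW// ltn_expl.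
  apply: le_trans (null_digits k iphi nphi mhC hC') _.
  rewrite mulrAC ler_pdivrMr ?exprn_gt0//.
  move: hk; rewrite ltr_pdivrMr// => /ltW hk'.
  by rewrite (le_trans (ler_norm _))// [e * _]mulrC.
have nC : \int[P]_w (C * phi w) = 0.
  rewrite RintegralZl//.
  suff -> : \int[P]_w phi w = 0 by rewrite mulr0.
  have [h0 hCm hU] := sG; have GT : G setT by have := hCm _ h0; rewrite setD0.
  by rewrite -[RHS](nphi _ GT); apply: eq_Rintegral => w _; rewrite indicT mul1r.
have i1 : P.-integrable setT (EFin \o (fun w => (h w + C) * phi w)).
  apply: (integrable_boundedM (C := 2 * C)) => //; first exact: measurable_fun_sub.
  by move=> w; have /andP[a b] := hC' w; rewrite ger0_norm.
transitivity (\int[P]_w ((h w + C) * phi w - C * phi w)).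
  by apply: eq_Rintegral => w _; ring.
by rewrite RintegralB// ?e0 ?nC ?subrr//; exact: integrable_EFinZ.
Qed.

(** Tested on A = {f < 0}, where the integrand is not positive: its integral must vanish, so A is
    null. *)
Lemma ae_ge0_of_integrals (f : W -> R) : P.-integrable setT (EFin \o f) ->
  measurable_fun (setT : set WG) (f : WG -> R) ->
  (forall A, G A -> 0 <= \int[P]_w (\1_A w * f w)) -> {ae P, forall w, 0 <= f w}.
Proof.
move=> fi mf f0; pose A := [set w | f w < 0].
have GA : G A.
  apply: measurable_sub; have := mf measurableT `]-oo, 0[%classic (measurable_itv _).
  by rewrite setTI; congr measurable; apply/seteqP; split => w /=; rewrite in_itv.
have b1 w : `|\1_A w| <= 1 :> R by rewrite indicE ger0_norm// lern1 leq_b1.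
have i2 : P.-integrable setT (EFin \o (fun w => \1_A w * f w)).
  by apply: integrable_boundedM b1 => //; apply: measurable_indic; exact: GM.
have neg w : \1_A w * f w <= 0.
  rewrite indicE; have [wA|wA] := boolP (w \in A); last by rewrite mul0r.
  by move: wA; rewrite inE /A/= mul1r => /ltW.
have i0 : (\int[P]_w `|(\1_A w * f w)%:E| = 0)%E.
  apply/eqP; rewrite eq_le integral_ge0// andbT.
  have -> : (\int[P]_w `|(\1_A w * f w)%:E| = \int[P]_w (- (\1_A w * f w))%:E)%E.
    by apply: eq_integral => w _; rewrite abse_EFin ler0_norm.
  have iN : P.-integrable setT (EFin \o (fun w => - (\1_A w * f w))).
    by under eq_fun do rewrite -mulN1r; exact: integrable_EFinZ.
  rewrite -(fineK (integrable_fin_num measurableT iN)) lee_fin.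
  have -> : fine (\int[P]_w (- (\1_A w * f w))%R%:E)%E = - \int[P]_w (\1_A w * f w).
    rewrite -mulN1r -RintegralZl//; congr fine; apply: eq_integral => w _.
    by rewrite mulN1r.
  by rewrite oppr_le0; exact: f0.
have [N [mN PN hN]] := (ae_eq_integral_abs P measurableT (measurable_int P i2)).1 i0.
exists N; split => // w/= /negP; rewrite -ltNge => fw; apply: hN => /= /(_ I) [].
by rewrite indicE mem_set// mul1r => e; move: fw; rewrite e ltxx.
Qed.

End SubSigmaAlgebra.

Section ConditionalMoments.
Context {R : realType} {d : nat} {dsp : measure_display} {W : measurableType dsp}
  (P : probability W R) (G : set (set W)).
Hypothesis (sG : sigma_algebra setT G) (GM : G `<=` measurable).

Local Notation WG := (g_sigma_algebraType G).

Lemma Rintegral_indicM (A : set W) (f : W -> R) :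
  \int[P]_w (\1_A w * f w) = \int[P]_(w in A) f w.
Proof.
rewrite [RHS]Rintegral_mkcond; apply: eq_Rintegral => w _.
by rewrite patchE indicE; case: (w \in A); rewrite ?mul1r ?mul0r.
Qed.

Lemma is_cond_exp_Rintegral m n (X Y : W -> 'M[R]_(m, n)) i j :
  is_cond_exp P G X Y -> forall A, G A ->
  \int[P]_w (\1_A w * Y w i j) = \int[P]_w (\1_A w * X w i j).
Proof.
by move=> /(_ i j)[_ _ _ h] A GA; rewrite !Rintegral_indicM /Rintegral h.
Qed.

Lemma ae_eq0_of_integrals (f : W -> R) : P.-integrable setT (EFin \o f) ->
  measurable_fun (setT : set WG) (f : WG -> R) ->
  (forall A, G A -> \int[P]_w (\1_A w * f w) = 0) -> {ae P, forall w, f w = 0}.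
Proof.
move=> fi mf f0.
have h1 : {ae P, forall w, 0 <= f w}.
  by apply: (ae_ge0_of_integrals sG GM fi mf) => A GA; rewrite f0.
have fi' : P.-integrable setT (EFin \o (fun w => - f w)).
  have -> : EFin \o (fun w => - f w) = EFin \o (fun w => -1 * f w).
    by apply/funext => w /=; rewrite mulN1r.
  exact: integrable_EFinZ.
have h2 : {ae P, forall w, 0 <= - f w}.
  apply: (ae_ge0_of_integrals sG GM fi').
    exact: (measurableT_comp (@oppr_measurable R setT) mf).
  move=> A GA; have b1 w : `|\1_A w| <= 1 :> R by rewrite indicE ger0_norm// lern1 leq_b1.
  have -> : \int[P]_w (\1_A w * - f w) = \int[P]_w (-1 * (\1_A w * f w)).
    by apply: eq_Rintegral => w _; ring.
  rewrite RintegralZl//; first by rewrite f0// mulr0.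
  by apply: (integrable_boundedM _ _ b1) => //; apply: measurable_indic; exact: GM.
apply: filterS2 h1 h2 => w w1 w2; apply/eqP; rewrite eq_le w1 andbT.
by rewrite -oppr_ge0.
Qed.

Lemma ae_forall_count (I : countType) (Q : I -> W -> Prop) :
  (forall i, {ae P, forall w, Q i w}) -> {ae P, forall w, forall i, Q i w}.
Proof.
move=> h; have : {ae P, forall w, forall n, oapp (Q^~ w) True (unpickle n)}.
  apply: ae_foralln => n; case: (unpickle n) => [i|] /=; first exact: h.
  exact: aeW.
by apply: filterS => w hw i; have := hw (pickle i); rewrite pickleK.
Qed.

(** The null set excepted by an almost sure inequality depends on u; rational vectors are countable
    and dense, so a single null set serves all u. *)
Lemma psdmx_of_rat (M : 'M[R]_d) : M^T = M ->
  (forall u : 'cV[rat]_d, 0 <= qf M (map_mx ratr u)) -> psdmx M.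
Proof.
move=> sM h; apply: psdmxP => // u.
have ex i (k : nat) : {q : rat | u i 0 < ratr q < u i 0 + k.+1%:R^-1}.
  apply: cid; have [q] := @rat_in_itvoo R (u i 0) (u i 0 + k.+1%:R^-1) ltac:(by rewrite ltrDl invr_gt0).
  by rewrite in_itv/= => hq; exists q.
pose q k : 'cV[rat]_d := \col_i sval (ex i k).
have qu i : (ratr (q k i 0) : R) @[k --> \oo] --> u i 0.
  apply: (@squeeze_cvgr _ _ _ _ (fun=> u i 0) (fun k => u i 0 + k.+1%:R^-1)).
  - near=> k; rewrite mxE; case: (ex i k) => r /= /andP[r1 r2].
    by rewrite (ltW r1) (ltW r2).
  - exact: cvg_cst.
  - rewrite -[X in _ --> X]addr0; apply: cvgD; first exact: cvg_cst.
    exact: cvg_harmonic.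
have qc : qf M (map_mx ratr (q k)) @[k --> \oo] --> qf M u.
  rewrite (qf_coord M u).
  under eq_fun do rewrite qf_coord.
  apply: cvg_sumr => i; apply: cvg_sumr => j.
  apply: cvgM; last exact: cvg_cst.
  by apply: cvgM; under eq_fun do rewrite mxE; exact: qu.
rewrite -(cvg_lim _ qc)//; apply: limr_ge; first by apply/cvg_ex; exists (qf M u).
by near=> k.
Unshelve. all: by end_near.
Qed.

Context (X : W -> 'cV[R]_d) (V : W -> 'M[R]_d).
Hypothesis (mX : measurable_fun setT X)
  (X2 : ('E_P[fun w => (lpnorm 2%:E (X w) ^+ 2)%R] < +oo)%E)
  (X0 : is_cond_exp P G X (fun=> 0)) (XV : is_cond_cov P G X V).

Lemma martingale_coord i : P.-integrable setT (EFin \o (fun w => X w i 0)) /\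
  forall A, G A -> \int[P]_w (\1_A w * X w i 0) = 0.
Proof.
split=> [|A GA]; first by have [] := X0 i 0.
rewrite -(is_cond_exp_Rintegral i 0 X0 GA).
transitivity (\int[P]_w (0 : R)); last by rewrite Rintegral_prob_cst.
by apply: eq_Rintegral => w _; rewrite mxE mulr0.
Qed.

(** The centering in [is_cond_cov] is some version of the conditional mean. It vanishes almost
    surely by the martingale property, so V is a conditional expectation of X X^T itself. *)
Lemma cond_cov_coord i j :
  [/\ measurable_fun (setT : set WG) ((fun w => V w i j) : WG -> R),
      P.-integrable setT (EFin \o (fun w => V w i j)),
      P.-integrable setT (EFin \o (fun w => X w i 0 * X w j 0)) &
      forall A, G A -> \int[P]_w (\1_A w * (X w i 0 * X w j 0 - V w i j)) = 0].
Proof.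
have [M XM XMV] := XV.
have [_ Vi /(measurable_wrtP sG) mV _] := XMV i j.
have mXi k : measurable_fun setT (fun w => X w k 0) by exact: measurable_entry.
have Xij : P.-integrable setT (EFin \o (fun w => X w i 0 * X w j 0)).
  apply: (integrable_le (g := fun w => dot (X w) (X w))).
  - exact: measurable_funM.
  - apply/integrableP; split; first by apply/measurable_EFinP; exact: measurable_dot.
    apply: le_lt_trans X2; rewrite unlock le_eqVlt; apply/orP; left.
    by apply/eqP/eq_integral => w _; rewrite /= lpnorm2_sqr ger0_norm ?dot_ge0.
  - move=> w; rewrite normrM.
    have h1 := sqr_coord_le_dot (X w) i; have h2 := sqr_coord_le_dot (X w) j.
    have := sqr_ge0 (`|X w i 0| - `|X w j 0|).
    rewrite sqrrB !real_normK ?num_real//; lra.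
split => // A GA.
have M0 k : {ae P, forall w, M w k 0 = 0}.
  have [_ Mi /(measurable_wrtP sG) mM _] := XM k 0.
  apply: ae_eq0_of_integrals => // B GB.
  by rewrite (is_cond_exp_Rintegral k 0 XM GB) (martingale_coord k).2.
have b1 w : `|\1_A w| <= 1 :> R by rewrite indicE ger0_norm// lern1 leq_b1.
have mA : measurable_fun setT (\1_A : W -> R) by apply: measurable_indic; exact: GM.
have i1 := integrable_boundedM Xij mA b1.
have i2 := integrable_boundedM Vi mA b1.
transitivity (\int[P]_w (\1_A w * (X w i 0 * X w j 0) - \1_A w * V w i j)).
  by apply: eq_Rintegral => w _; ring.
rewrite RintegralB//; apply/eqP; rewrite subr_eq0; apply/eqP.
rewrite (is_cond_exp_Rintegral i j XMV GA); congr fine.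
have [Yi _ _ _] := XMV i j.
have i3 := integrable_boundedM Yi mA b1.
apply: ae_eq_integral => //; [exact: measurable_int i1|exact: measurable_int i3|].
apply: filterS2 (M0 i) (M0 j) => w mi mj _ /=.
by rewrite !mxE big_ord1 !mxE mi mj !subr0.
Qed.

Lemma cond_cov_measurable : measurable_fun (setT : set WG) (V : WG -> 'M[R]_d).
Proof. by apply: measurable_mx => i j; have [] := cond_cov_coord i j. Qed.

(** On each event of G the integral of qf V u equals that of (u.X)^2, for every rational u; symmetry
    is tested entry by entry. *)
Lemma cond_cov_psd : {ae P, forall w, psdmx (V w)}.
Proof.
have b1 A (w : W) : `|\1_A w| <= 1 :> R by rewrite indicE ger0_norm// lern1 leq_b1.
have mA A : G A -> measurable_fun setT (\1_A : W -> R).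
  by move=> GA; apply: measurable_indic; exact: GM.
pose phi i j w := X w i 0 * X w j 0 - V w i j.
have iphi i j : P.-integrable setT (EFin \o phi i j).
  by have [_ ? ? _] := cond_cov_coord i j; exact: integrable_EFinB.
have iAphi A i j : G A -> P.-integrable setT (EFin \o (fun w => \1_A w * phi i j w)).
  by move=> GA; exact: (integrable_boundedM (iphi i j) (mA A GA) (b1 A)).
have phi0 A i j : G A -> \int[P]_w (\1_A w * phi i j w) = 0.
  by move=> GA; have [_ _ _ ->] := cond_cov_coord i j.
have sym : {ae P, forall w, forall ij : 'I_d * 'I_d, V w ij.1 ij.2 - V w ij.2 ij.1 = 0}.
  apply: ae_forall_count => -[i j] /=.
  have [mij iij _ _] := cond_cov_coord i j; have [mji iji _ _] := cond_cov_coord j i.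
  apply: ae_eq0_of_integrals; first exact: integrable_EFinB.
    exact: measurable_funB.
  move=> A GA; transitivity (\int[P]_w (\1_A w * phi j i w - \1_A w * phi i j w)).
    by apply: eq_Rintegral => w _; rewrite /phi; ring.
  by rewrite RintegralB ?phi0 ?subrr//; exact: iAphi.
have pos : {ae P, forall w, forall u : 'cV[rat]_d, 0 <= qf (V w) (map_mx ratr u)}.
  apply: ae_forall_count => q; set u := map_mx ratr q : 'cV[R]_d.
  have iqf : P.-integrable setT (EFin \o (fun w => qf (V w) u)).
    have -> : (fun w => qf (V w) u) = (fun w => \sum_i \sum_j u i 0 * u j 0 * V w i j).
      by apply/funext => w; rewrite qf_coord.
    apply: integrable_EFin_sum => i; apply: integrable_EFin_sum => j.
    by apply: integrable_EFinZ; have [] := cond_cov_coord i j.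
  apply: (ae_ge0_of_integrals sG GM iqf).
  - exact: measurable_qf cond_cov_measurable _.
  - move=> A GA.
    pose psi w := \sum_i \sum_j u i 0 * u j 0 * (\1_A w * phi i j w).
    have ipsi : P.-integrable setT (EFin \o psi).
      apply: integrable_EFin_sum => i; apply: integrable_EFin_sum => j.
      by apply: integrable_EFinZ; exact: iAphi.
    have psi0 : \int[P]_w psi w = 0.
      rewrite Rintegral_sum; last first.
        move=> i; apply: integrable_EFin_sum => j.
        by apply: integrable_EFinZ; exact: iAphi.
      rewrite big1// => i _; rewrite Rintegral_sum; last first.
        by move=> j; apply: integrable_EFinZ; exact: iAphi.
      rewrite big1// => j _; rewrite RintegralZl ?phi0 ?mulr0//.
      exact: iAphi.
    have e w : \1_A w * qf (V w) u = \1_A w * dot u (X w) ^+ 2 - psi w.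
      rewrite -qf_outer !qf_coord !mulr_sumr -sumrB; apply: eq_bigr => i _.
      rewrite !mulr_sumr -sumrB; apply: eq_bigr => j _.
      have -> : (X w *m (X w)^T) i j = X w i 0 * X w j 0 by rewrite !mxE big_ord1 !mxE.
      by rewrite /phi; ring.
    have iq : P.-integrable setT (EFin \o (fun w => \1_A w * qf (V w) u)).
      exact: (integrable_boundedM iqf (mA A GA) (b1 A)).
    have -> : \int[P]_w (\1_A w * qf (V w) u) = \int[P]_w (\1_A w * qf (V w) u + psi w).
      by rewrite RintegralD// psi0 addr0.
    by apply: Rintegral_ge0 => w _; rewrite e subrK mulr_ge0 ?sqr_ge0// indicE.
apply: filterS2 sym pos => w s1 s2; apply: psdmx_of_rat => //.
by apply/matrixP => i j; rewrite mxE; apply/eqP; rewrite -subr_eq0; apply/eqP; exact: (s1 (j, i)).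
Qed.

End ConditionalMoments.

(** * Lindeberg telescoping *)

Section Cubic.
Context {R : realType} {d : nat} (p : \bar R).
Implicit Type y : 'cV[R]_d.

Definition cubic y : R := dot y y * lpnorm p y.

Lemma cubic_ge0 y : 0 <= cubic y.
Proof. by rewrite mulr_ge0 ?dot_ge0 ?lpnorm_ge0. Qed.

Lemma measurable_cubic {dsp} {W : measurableType dsp} (f : W -> 'cV[R]_d) :
  measurable_fun setT f -> measurable_fun setT (fun w => cubic (f w)).
Proof.
by move=> mf; apply: measurable_funM; [exact: measurable_dot|exact: measurable_lpnorm].
Qed.

End Cubic.

Section LindebergStep.
Context {R : realType} {d : nat} {dsp : measure_display} {W' : measurableType dsp}
  (P' : probability W' R) (Z : W' -> 'cV[R]_d.+1).
Hypothesis (mZ : measurable_fun setT Z) (gZ : gaussian_vector P' 1%:M Z).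
Context (p : \bar R) (f : @trig R d.+1) (s K K' : R).
Hypothesis (K0 : 0 <= K) (K'0 : 0 <= K').
Hypothesis taylor : forall U x y, psdmx U ->
  `|tF f (U + (s ^+ 2)%:M) (x + y) - tF f (U + (s ^+ 2)%:M) x
    - tD1 f (U + (s ^+ 2)%:M) x y - tD2 f (U + (s ^+ 2)%:M) x (y *m y^T) / 2|
  <= K * cubic p y + K'.

Lemma psdmx_add_scalar (U : 'M[R]_d.+1) : psdmx U -> psdmx (U + (s ^+ 2)%:M).
Proof. by move=> pU; apply: psdmxD => //; apply: psdmx_scalar; exact: sqr_ge0. Qed.

Lemma measurable_gaussian_cubic {dsp0} {T : measurableType dsp0} (V : T -> 'M[R]_d.+1) :
  measurable_fun setT V ->
  measurable_fun setT (fun w =>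
    \int[P']_z (K * cubic p (psd_sqrt (V w) *m Z z) + K')%:E)%E.
Proof.
move=> mV.
pose F (wz : T * W') := (K * cubic p (psd_sqrt (V wz.1) *m Z wz.2) + K')%:E.
apply: (@measurable_fun_fubini_tonelli_F _ _ _ _ _ P' F); last first.
  by move=> wz; rewrite lee_fin addr_ge0// mulr_ge0// cubic_ge0.
apply/measurable_EFinP; apply: measurable_funD => //; apply: measurable_funM => //.
apply: measurable_cubic; apply: measurable_mulmx.
  have mVf : measurable_fun setT (V \o (fst : T * W' -> T)) by exact: measurableT_comp mV _.
  exact: (measurableT_comp (@measurable_psd_sqrt R d) mVf).
exact: measurableT_comp mZ _.
Qed.

(** Taylor at the increment V^(1/2) Z, averaged over Z: the main term becomes F at covariance M + V,
    the first-order term vanishes, and the second-order term becomes [tD2] at V. Adding V to the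
    covariance thus mimics a random shift up to second order. *)
Lemma gaussian_step U V x : psdmx U -> psdmx V ->
  (`|tF f (U + (s ^+ 2)%:M + V) x - tF f (U + (s ^+ 2)%:M) x
     - tD2 f (U + (s ^+ 2)%:M) x V / 2|%:E <=
   \int[P']_z (K * cubic p (psd_sqrt V *m Z z) + K')%:E)%E.
Proof.
move=> pU pV; set M := U + _.
have pM : psdmx M := psdmx_add_scalar pU.
have [pB BB _] := psd_sqrtP pV; set B := psd_sqrt V in pB BB *.
have mY : measurable_fun setT (fun z => B *m Z z).
  by apply: measurable_mulmx => //; exact: measurable_cst.
have gY : gaussian_vector P' V (fun z => B *m Z z).
  by have := gaussian_vector_mulmx B gZ; rewrite mulmx1 pB.1 BB.
have [i1 e1] := gaussian_vector_tD1 mY gY f M x.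
have [i2 e2] := gaussian_vector_tD2 mY pV gY f M x.
have i0 := integrable_tF P' mY f x pM.
have e0 := tF_semigroup mY pV gY f M x.
pose err z := tF f M (x + B *m Z z) - tF f M x - tD1 f M x (B *m Z z)
  - tD2 f M x ((B *m Z z) *m (B *m Z z)^T) / 2.
have ic (a : R) : P'.-integrable setT (EFin \o (fun=> a)).
  by apply: finite_measure_integrable_cst.
have ia := integrable_EFinB i0 (ic (tF f M x)).
have ib := integrable_EFinB ia i1.
have i2' : P'.-integrable setT
    (EFin \o (fun z => tD2 f M x ((B *m Z z) *m (B *m Z z)^T) / 2)).
  by under eq_fun do rewrite mulrC; exact: integrable_EFinZ.
have ierr : P'.-integrable setT (EFin \o err) by exact: integrable_EFinB.
have <- : \int[P']_z err z = tF f (M + V) x - tF f M x - tD2 f M x V / 2.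
  rewrite RintegralB// RintegralB// RintegralB// e0 e1 subr0 Rintegral_prob_cst.
  by rewrite RintegralZr// e2.
apply: le_trans (_ : (\int[P']_z `|(err z)%:E| <= _)%E).
  rewrite EFin_normr_Rintegral//; apply: le_abse_integral => //.
  exact: measurable_int ierr.
apply: ge0_le_integral => //.
- by apply: measurableT_comp => //; exact: measurable_int ierr.
- apply/measurable_EFinP; apply: measurable_funD => //; apply: measurable_funM => //.
  exact: measurable_cubic.
- by move=> z _; rewrite abse_EFin lee_fin; exact: taylor.
Qed.

End LindebergStep.

Section LindebergStep.
Context {R : realType} {d : nat} {dsp' : measure_display} {W' : measurableType dsp'}
  (P' : probability W' R) (Z : W' -> 'cV[R]_d.+1).
Hypothesis (mZ : measurable_fun setT Z) (gZ : gaussian_vector P' 1%:M Z).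
Context (p : \bar R) (f : @trig R d.+1) (s K K' : R).
Hypothesis (p1 : (1 <= p)%E) (K0 : 0 <= K) (K'0 : 0 <= K').
Hypothesis taylor : forall U x y, psdmx U ->
  `|tF f (U + (s ^+ 2)%:M) (x + y) - tF f (U + (s ^+ 2)%:M) x
    - tD1 f (U + (s ^+ 2)%:M) x y - tD2 f (U + (s ^+ 2)%:M) x (y *m y^T) / 2|
  <= K * cubic p y + K'.

Context {dsp : measure_display} {W : measurableType dsp} (P : probability W R)
  (G : set (set W)).
Hypothesis (sG : sigma_algebra setT G) (GM : G `<=` measurable).
Local Notation WG := (g_sigma_algebraType G).

Context (S0 X : W -> 'cV[R]_d.+1) (U V : W -> 'M[R]_d.+1) (E : set W).
Hypothesis (mS : measurable_fun (setT : set WG) (S0 : WG -> 'cV[R]_d.+1))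
  (mU : measurable_fun (setT : set WG) (U : WG -> 'M[R]_d.+1))
  (mV : measurable_fun (setT : set WG) (V : WG -> 'M[R]_d.+1))
  (mX : measurable_fun setT X) (GE : G E)
  (psdU : forall w, psdmx (U w))
  (psdE : forall w, E w -> psdmx (V w) /\ psdmx (U w - V w))
  (iX : forall i, P.-integrable setT (EFin \o (fun w => X w i 0)))
  (X0 : forall i A, G A -> \int[P]_w (\1_A w * X w i 0) = 0)
  (iXV : forall i j, P.-integrable setT (EFin \o (fun w => X w i 0 * X w j 0 - V w i j)))
  (XV0 : forall i j A, G A -> \int[P]_w (\1_A w * (X w i 0 * X w j 0 - V w i j)) = 0).

Let e w : R := \1_E w.
Let U' w := U w - e w *: V w.
Let M w := U' w + (s ^+ 2)%:M.

Let me : measurable_fun (setT : set WG) (e : WG -> R).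
Proof. by apply: measurable_indic; exact: sub_sigma_algebra. Qed.

Let e01 w : e w * e w = e w.
Proof. by rewrite /e indicE; case: (_ \in _); rewrite ?mulr1 ?mulr0. Qed.

Let e1 w : `|e w| <= 1.
Proof. by rewrite /e indicE ger0_norm// lern1 leq_b1. Qed.

Lemma psdmx_truncated w : psdmx (U w - (\1_E w : R) *: V w).
Proof.
rewrite indicE; have [wE|wE] := boolP (w \in E).
  by rewrite scale1r; move: wE; rewrite inE => /psdE[].
by rewrite scale0r subr0.
Qed.

Let psdM w : psdmx (M w).
Proof. by apply: psdmx_add_scalar; exact: psdmx_truncated. Qed.

Let mU' : measurable_fun (setT : set WG) (U' : WG -> 'M[R]_d.+1).
Proof.
by apply: measurable_addmx => //; apply: measurable_oppmx; exact: measurable_scalemx.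
Qed.

Let mM : measurable_fun (setT : set WG) (M : WG -> 'M[R]_d.+1).
Proof. by apply: measurable_addmx => //; exact: measurable_cst. Qed.

Let msub {dspT} {T : measurableType dspT} (g : W -> T) :
  measurable_fun (setT : set WG) (g : WG -> T) -> measurable_fun setT g.
Proof. exact: measurable_fun_sub. Qed.

(** The coefficients [hS] of X in the first-order term and [hC] of X X^T - V in the second are
    bounded and measurable for the past, so [null_boundedM] removes both terms. *)
Let hS k w : R := tcoef (M w) k * (- sin (dot k.1.2 (S0 w) + k.2)) * e w.
Let hC k w : R := tcoef (M w) k * (- cos (dot k.1.2 (S0 w) + k.2)) * e w.

Let h_bound (k : R * 'cV[R]_d.+1 * R) w (a : R) : `|a| <= 1 ->
  `|tcoef (M w) k * - a * e w| <= `|k.1.1|.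
Proof.
move=> a1; rewrite 2!normrM normrN -mulrA -[leRHS]mulr1 ler_pM ?normr_ge0//.
- by apply: normr_tcoef; exact: psdM.
- by rewrite -[leRHS]mulr1 ler_pM.
Qed.

Let mhS k : measurable_fun (setT : set WG) (hS k : WG -> R).
Proof.
apply: measurable_funM => //; apply: measurable_funM; first exact: measurable_tcoef.
apply: measurableT_comp => //; apply: measurable_sin; exact: measurable_tphase.
Qed.

Let mhC k : measurable_fun (setT : set WG) (hC k : WG -> R).
Proof.
apply: measurable_funM => //; apply: measurable_funM; first exact: measurable_tcoef.
apply: measurableT_comp => //; apply: measurable_cos; exact: measurable_tphase.
Qed.

Let D1 w := tD1 f (M w) (S0 w) (e w *: X w).

Let D1E : D1 = fun w => \sum_(k <- f) \sum_i k.1.2 i 0 * (hS k w * X w i 0).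
Proof.
apply/funext => w; rewrite /D1 /tD1; apply: eq_bigr => k _.
rewrite dotZr (dotE k.1.2 (X w)) !mulr_sumr; apply: eq_bigr => i _; rewrite /hS; ring.
Qed.

Let iS k i : P.-integrable setT (EFin \o (fun w => hS k w * X w i 0)).
Proof.
apply: (integrable_boundedM (C := `|k.1.1|) (iX i)); first exact: msub.
by move=> w; apply: h_bound; exact: normr_sin_le1.
Qed.

Let iD1 : P.-integrable setT (EFin \o D1).
Proof.
rewrite D1E; apply: integrable_EFin_sum => k; apply: integrable_EFin_sum => i.
exact: integrable_EFinZ.
Qed.

Let D10 : \int[P]_w D1 w = 0.
Proof.
rewrite D1E Rintegral_sum; last first.
  by move=> k; apply: integrable_EFin_sum => i; exact: integrable_EFinZ.
rewrite big1// => k _; rewrite Rintegral_sum; last by move=> i; exact: integrable_EFinZ.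
rewrite big1// => i _; rewrite RintegralZl//.
rewrite (null_boundedM sG GM (C := `|k.1.1|))// ?mulr0//.
  exact: X0.
by move=> w; apply: h_bound; exact: normr_sin_le1.
Qed.

Let DD w := tD2 f (M w) (S0 w) ((e w *: X w) *m (e w *: X w)^T)
  - tD2 f (M w) (S0 w) (e w *: V w).

(** The indicator satisfies e^2 = e, so the truncated X X^T and the truncated V carry the same
    factor and combine into X X^T - V. *)
Let DDE : DD = fun w => \sum_(k <- f) \sum_i \sum_j
  k.1.2 i 0 * k.1.2 j 0 * (hC k w * (X w i 0 * X w j 0 - V w i j)).
Proof.
apply/funext => w; rewrite /DD /tD2 -sumrB; apply: eq_bigr => k _.
rewrite -mulrBr !qf_coord -sumrB mulr_sumr; apply: eq_bigr => i _.
rewrite -sumrB mulr_sumr; apply: eq_bigr => j _.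
have -> : ((e w *: X w) *m (e w *: X w)^T) i j = e w * (X w i 0 * X w j 0).
  by rewrite !mxE big_ord1 !mxE -[in RHS]e01; ring.
by rewrite /hC mxE; ring.
Qed.

Let iC k i j : P.-integrable setT
  (EFin \o (fun w => hC k w * (X w i 0 * X w j 0 - V w i j))).
Proof.
apply: (integrable_boundedM (C := `|k.1.1|) (iXV i j)); first exact: msub.
by move=> w; apply: h_bound; exact: normr_cos_le1.
Qed.

Let iDD : P.-integrable setT (EFin \o DD).
Proof.
rewrite DDE; apply: integrable_EFin_sum => k; apply: integrable_EFin_sum => i.
apply: integrable_EFin_sum => j; exact: integrable_EFinZ.
Qed.

Let DD0 : \int[P]_w DD w = 0.
Proof.
rewrite DDE Rintegral_sum; last first.
  move=> k; apply: integrable_EFin_sum => i; apply: integrable_EFin_sum => j.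
  exact: integrable_EFinZ.
rewrite big1// => k _; rewrite Rintegral_sum; last first.
  by move=> i; apply: integrable_EFin_sum => j; exact: integrable_EFinZ.
rewrite big1// => i _; rewrite Rintegral_sum; last by move=> j; exact: integrable_EFinZ.
rewrite big1// => j _; rewrite RintegralZl//.
rewrite (null_boundedM sG GM (C := `|k.1.1|))// ?mulr0//.
  exact: XV0.
by move=> w; apply: h_bound; exact: normr_cos_le1.
Qed.

Let F1 w := tF f (M w) (S0 w + e w *: X w).
Let F0 w := tF f (U w + (s ^+ 2)%:M) (S0 w).

Let iF1 : P.-integrable setT (EFin \o F1).
Proof.
apply: (@integrable_bounded _ _ _ _ _ (tnorm f)); last by move=> w; apply: normr_tF; exact: psdM.
apply: measurable_tF; first exact: msub.
apply: measurable_addmx; first exact: msub.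
by apply: measurable_scalemx => //; exact: msub.
Qed.

Let iF0 : P.-integrable setT (EFin \o F0).
Proof.
apply: (@integrable_bounded _ _ _ _ _ (tnorm f)).
  apply: measurable_tF; last exact: msub.
  by apply: measurable_addmx; [exact: msub|exact: measurable_cst].
by move=> w; apply: normr_tF; exact: psdmx_add_scalar.
Qed.

Let err w := F1 w - F0 w - D1 w - 2^-1 * DD w.

(** The old and the new value are both expanded around the pair (S0, M): the error is the Taylor
    error of the shift by e X minus the averaged error of a Gaussian shift with covariance e V. *)
Let err_le w : (`|(err w)%:E| <= (K * cubic p (X w) + K')%:E +
  \int[P']_z (K * cubic p (psd_sqrt (V w) *m Z z) + K')%:E)%E.
Proof.
pose x := e w *: X w; pose v := e w *: V w.
pose a := tF f (M w) (S0 w + x) - tF f (M w) (S0 w) - tD1 f (M w) (S0 w) x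
  - tD2 f (M w) (S0 w) (x *m x^T) / 2.
pose b := tF f (M w + v) (S0 w) - tF f (M w) (S0 w) - tD2 f (M w) (S0 w) v / 2.
have -> : err w = a - b.
  rewrite /err /F1 /F0 /D1 /DD /a /b -/x -/v.
  have -> : U w + (s ^+ 2)%:M = M w + v by rewrite /M /U' addrAC subrK.
  by field.
apply: (@le_trans _ _ (`|a|%:E + `|b|%:E)%E).
  by rewrite abse_EFin -EFinD lee_fin ler_normB.
apply: leeD.
  rewrite lee_fin; apply: le_trans (taylor _ _ (psdmx_truncated w)) _.
  have e0 : 0 <= e w by rewrite /e indicE.
  rewrite lerD2r ler_wpM2l// /cubic /x dot_scale lpnormZ// (ger0_norm e0) expr2 e01.
  rewrite mulrACA e01 ler_piMl ?mulr_ge0 ?dot_ge0 ?lpnorm_ge0//.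
  by have := e1 w; rewrite ger0_norm.
have [wE|wE] := boolP (w \in E).
  have -> : b = tF f (M w + V w) (S0 w) - tF f (M w) (S0 w) - tD2 f (M w) (S0 w) (V w) / 2.
    by rewrite /b /v /e indicE wE scale1r.
  have pV : psdmx (V w) by move: wE; rewrite inE => /psdE[].
  have hh := gaussian_step mZ gZ taylor (S0 w) (psdmx_truncated w) pV.
  exact hh.
have -> : b = 0.
  rewrite /b /v /e indicE (negbTE wE) scale0r addr0 subrr sub0r.
  rewrite /tD2 big1 ?mul0r ?oppr0// => k _; by rewrite qf0 mulr0.
rewrite normr0; apply: integral_ge0 => z _.
by rewrite lee_fin addr_ge0// mulr_ge0// cubic_ge0.
Qed.

(** In F1 - F0 = D1 + DD / 2 + err, the integrals of D1 and DD vanish. *)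
Lemma lindeberg_step :
  ((\int[P]_w tF f (U w - (\1_E w : R) *: V w + (s ^+ 2)%:M)
      (S0 w + (\1_E w : R) *: X w))%:E <=
   (\int[P]_w tF f (U w + (s ^+ 2)%:M) (S0 w))%:E +
   (\int[P]_w (K * cubic p (X w) + K')%:E +
    \int[P]_w \int[P']_z (K * cubic p (psd_sqrt (V w) *m Z z) + K')%:E))%E.
Proof.
rewrite -[X in (X%:E <= _)%E]/(\int[P]_w F1 w) -[X in (_ <= X%:E + _)%E]/(\int[P]_w F0 w).
have ierr : P.-integrable setT (EFin \o err).
  apply: integrable_EFinB; last exact: integrable_EFinZ.
  by apply: integrable_EFinB => //; exact: integrable_EFinB.
have -> : \int[P]_w F1 w = \int[P]_w F0 w + \int[P]_w err w.
  rewrite RintegralB//; last 2 first.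
  - by apply: integrable_EFinB => //; exact: integrable_EFinB.
  - exact: integrable_EFinZ.
  rewrite RintegralB//; last exact: integrable_EFinB.
  by rewrite RintegralB// RintegralZl// D10 DD0 mulr0 !subr0 addrC subrK.
rewrite EFinD leeD2l//.
apply: (@le_trans _ _ (\int[P]_w `|(err w)%:E|)%E).
  apply: (@le_trans _ _ (`|\int[P]_w err w|%:E)%E); first by rewrite lee_fin ler_norm.
  rewrite EFin_normr_Rintegral//; apply: le_abse_integral => //.
  exact: measurable_int ierr.
have mg := measurable_gaussian_cubic P' mZ p K0 K'0 (msub mV).
have mc : measurable_fun setT (fun w => (K * cubic p (X w) + K')%:E).
  apply/measurable_EFinP; apply: measurable_funD => //; apply: measurable_funM => //.
  exact: measurable_cubic.
have c0 w : (0 <= (K * cubic p (X w) + K')%:E)%E.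
  by rewrite lee_fin addr_ge0// mulr_ge0// cubic_ge0.
have g0 w : (0 <= \int[P']_z (K * cubic p (psd_sqrt (V w) *m Z z) + K')%:E)%E.
  apply: integral_ge0 => z _; by rewrite lee_fin addr_ge0// mulr_ge0// cubic_ge0.
rewrite -ge0_integralD//.
apply: ge0_le_integral => //.
- by apply: measurableT_comp => //; exact: measurable_int ierr.
- exact: emeasurable_funD.
Qed.

End LindebergStep.

Section Lindeberg.
Context {R : realType} {d : nat} {dsp' : measure_display} {W' : measurableType dsp'}
  (P' : probability W' R) (Z : nat -> W' -> 'cV[R]_d.+1).
Context {dsp : measure_display} {W : measurableType dsp} (P : probability W R)
  (n : nat) (H : nat -> set (set W)).
Context (X : nat -> W -> 'cV[R]_d.+1) (V : nat -> W -> 'M[R]_d.+1) (U0 : 'M[R]_d.+1).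

Definition admissible (U : W -> 'M[R]_d.+1) (V : W -> 'M[R]_d.+1) : set W :=
  [set w | psdmx (V w) /\ psdmx (U w - V w)].

(* The conditional covariance still available: a summand is discarded when
   subtracting its V would leave the cone of positive semi-definite matrices. *)
Fixpoint budget k : W -> 'M[R]_d.+1 :=
  if k is k'.+1 then fun w => budget k' w - (\1_(admissible (budget k') (V k')) w : R) *: V k' w
  else fun=> U0.

Fixpoint truncated_sum k : W -> 'cV[R]_d.+1 :=
  if k is k'.+1 then
    fun w => truncated_sum k' w + (\1_(admissible (budget k') (V k')) w : R) *: X k' w
  else fun=> 0.

Lemma budget_psd k w : psdmx U0 -> psdmx (budget k w).
Proof.
move=> p0; elim: k w => [//|k IH] w /=.
by apply: psdmx_truncated => // w' [].
Qed.

(** Every earlier budget exceeds the final one by a sum of semi-definite matrices, so a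
    semi-definite final budget means that no summand was discarded. *)
Lemma admissible_path w : (forall k, (k < n)%N -> psdmx (V k w)) ->
  psdmx (U0 - \sum_(k < n) V k w) -> forall k, (k <= n)%N ->
  budget k w = U0 - \sum_(j < k) V j w /\ truncated_sum k w = \sum_(j < k) X j w.
Proof.
move=> pV pU; elim=> [|k IH] kn; first by rewrite !big_ord0 subr0.
have [IH1 IH2] := IH (ltnW kn).
have adm : w \in admissible (budget k) (V k).
  rewrite inE; split; first exact: pV.
  rewrite IH1 -addrA -opprD -(big_ord_recr k (fun j => V j w)) /=.
  have -> : U0 - \sum_(j < k.+1) V j w =
      U0 - \sum_(j < n) V j w + \sum_(k.+1 <= j < n) V j w.
    have -> : \sum_(j < n) V j w = \sum_(j < k.+1) V j w + \sum_(k.+1 <= j < n) V j w.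
      by rewrite -!(big_mkord xpredT (fun j => V j w)) -big_cat_nat.
    by rewrite opprD addrA subrK.
  apply: psdmxD => //; rewrite big_nat_cond.
  apply: (big_ind (fun M : 'M[R]_d.+1 => psdmx M)); first exact: psdmx0.
    by move=> ? ?; exact: psdmxD.
  by move=> j /andP[/andP[_ jn] _]; exact: pV.
rewrite /= indicE adm !scale1r IH1 IH2 !big_ord_recr/=; split => //.
by rewrite opprD addrA.
Qed.

Hypothesis (mZ : forall k, measurable_fun setT (Z k))
  (gZ : forall k, gaussian_vector P' 1%:M (Z k)).
Context (p : \bar R) (f : @trig R d.+1) (s K K' : R).
Hypothesis (p1 : (1 <= p)%E) (K0 : 0 <= K) (K'0 : 0 <= K').
Hypothesis taylor : forall U x y, psdmx U ->
  `|tF f (U + (s ^+ 2)%:M) (x + y) - tF f (U + (s ^+ 2)%:M) x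
    - tD1 f (U + (s ^+ 2)%:M) x y - tD2 f (U + (s ^+ 2)%:M) x (y *m y^T) / 2|
  <= K * cubic p y + K'.
Hypothesis (sH : forall k, (k <= n)%N -> sigma_algebra setT (H k))
  (HM : forall k, (k <= n)%N -> H k `<=` measurable)
  (HS : forall k, (k < n)%N -> H k `<=` H k.+1).
Hypothesis (psdU0 : psdmx U0)
  (aX : forall k, (k < n)%N -> measurable_wrt (H k.+1) (X k))
  (aV : forall k, (k < n)%N -> measurable_wrt (H k) (V k)).
Hypothesis (mX : forall k, measurable_fun setT (X k))
  (iX : forall k i, (k < n)%N -> P.-integrable setT (EFin \o (fun w => X k w i 0)))
  (X0 : forall k i A, (k < n)%N -> H k A -> \int[P]_w (\1_A w * X k w i 0) = 0)
  (iXV : forall k i j, (k < n)%N ->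
     P.-integrable setT (EFin \o (fun w => X k w i 0 * X k w j 0 - V k w i j)))
  (XV0 : forall k i j A, (k < n)%N -> H k A ->
     \int[P]_w (\1_A w * (X k w i 0 * X k w j 0 - V k w i j)) = 0).

(** [V k] is known at time k, one step before [X k]. Whether summand k is kept is therefore decided
    within [H k], as the conditional cancellation requires. *)
Lemma budget_adapted k : (k <= n)%N ->
  measurable_wrt (H k) (budget k) /\ measurable_wrt (H k) (truncated_sum k).
Proof.
elim: k => [|k IH] kn.
  by split; apply/(measurable_wrtP (sH kn)) => /=; exact: measurable_cst.
have [mU mS] := IH (ltnW kn).
have up dspT (T : measurableType dspT) (g : W -> T) :
    measurable_wrt (H k) g -> measurable_wrt (H k.+1) g.
  by move=> mg B mB; apply: HS => //; exact: mg.
have HE : H k.+1 (admissible (budget k) (V k)).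
  apply: HS => //; have sk := sH (ltnW kn); apply: (measurable_sub sk).
  move: (mU) (aV kn) => /(measurable_wrtP sk) mU' /(measurable_wrtP sk) mV'.
  have h1 := mV' measurableT _ (@measurable_psdmx R d.+1).
  have mUV : measurable_fun [set: g_sigma_algebraType (H k)]
      ((fun w => budget k w - V k w) : g_sigma_algebraType (H k) -> 'M[R]_d.+1).
    by apply: measurable_addmx => //; exact: measurable_oppmx.
  have h2 := mUV measurableT _ (@measurable_psdmx R d.+1).
  by move: (measurableI _ _ h1 h2); rewrite !setTI.
have sk1 := sH kn.
have m1 : measurable_fun [set: g_sigma_algebraType (H k.+1)]
    ((\1_(admissible (budget k) (V k)) : W -> R) : g_sigma_algebraType (H k.+1) -> R).
  by apply: measurable_indic; exact: sub_sigma_algebra.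
move: mU mS (aV kn) (aX kn) => /up/(measurable_wrtP sk1) mU /up/(measurable_wrtP sk1) mS.
move=> /up/(measurable_wrtP sk1) mV /(measurable_wrtP sk1) mX'.
split; apply/(measurable_wrtP sk1) => /=.
- by apply: measurable_addmx => //; apply: measurable_oppmx; exact: measurable_scalemx.
- by apply: measurable_addmx => //; exact: measurable_scalemx.
Qed.

Definition lindeberg_error k : \bar R :=
  (\int[P]_w (K * cubic p (X k w) + K')%:E +
   \int[P]_w \int[P']_z (K * cubic p (psd_sqrt (V k w) *m Z k z) + K')%:E)%E.

Lemma lindeberg_sum k : (k <= n)%N ->
  ((\int[P]_w tF f (budget k w + (s ^+ 2)%:M) (truncated_sum k w))%:E <=
   (tF f (U0 + (s ^+ 2)%:M) 0)%:E + \sum_(j < k) lindeberg_error j)%E.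
Proof.
elim: k => [|k IH] kn.
  by rewrite big_ord0 adde0 /= Rintegral_prob_cst.
have kn' := ltnW kn; have sk := sH kn'.
rewrite big_ord_recr/= addeA; apply: le_trans (leeD2r _ (IH kn')).
have [/(measurable_wrtP sk) mU /(measurable_wrtP sk) mS] := budget_adapted kn'.
have /(measurable_wrtP sk) mV := aV kn.
apply: (lindeberg_step (mZ k) (gZ k) p1 K0 K'0 taylor sk (HM kn')) => //.
- have h1 := mV measurableT _ (@measurable_psdmx R d.+1).
  have mUV : measurable_fun [set: g_sigma_algebraType (H k)]
      ((fun w => budget k w - V k w) : g_sigma_algebraType (H k) -> 'M[R]_d.+1).
    by apply: measurable_addmx => //; exact: measurable_oppmx.
  have h2 := mUV measurableT _ (@measurable_psdmx R d.+1).
  apply: (measurable_sub sk).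
  by move: (measurableI _ _ h1 h2); rewrite !setTI.
- by move=> w; exact: budget_psd.
- by move=> i; exact: iX.
- by move=> i A HA; exact: X0.
- by move=> i j; exact: iXV.
- by move=> i j A HA; exact: XV0.
Qed.

End Lindeberg.

(** * Independence of the Gaussian weights from the past *)

Section IndependentIntegral.
Context {R : realType} {dsp : measure_display} {W : measurableType dsp}
  (P : probability W R) {dsp1 dsp2 : measure_display}
  {T1 : measurableType dsp1} {T2 : measurableType dsp2}.

(** The joint law agrees with the product of the two laws on rectangles, hence everywhere; then
    Tonelli. *)
Lemma integral_independent (Y : W -> T1) (Z : W -> T2) (F : T1 * T2 -> \bar R) :
  measurable_fun setT Y -> measurable_fun setT Z ->
  (forall A B, measurable A -> measurable B ->
    P (Y @^-1` A `&` Z @^-1` B) = (P (Y @^-1` A) * P (Z @^-1` B))%E) ->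
  measurable_fun setT F -> (forall y, (0 <= F y)%E) ->
  (\int[P]_w F (Y w, Z w) = \int[P]_w \int[P]_z F (Y w, Z z))%E.
Proof.
move=> mY mZ ind mF F0.
have mYZ : measurable_fun setT (fun w => (Y w, Z w)) by exact: measurable_fun_pair.
pose Y' : {mfun W >-> T1} := HB.pack Y (isMeasurableFun.Build _ _ _ _ Y mY).
pose Z' : {mfun W >-> T2} := HB.pack Z (isMeasurableFun.Build _ _ _ _ Z mZ).
pose YZ' : {mfun W >-> (T1 * T2)%type} :=
  HB.pack (fun w => (Y w, Z w)) (isMeasurableFun.Build _ _ _ _ (fun w => (Y w, Z w)) mYZ).
have -> : (\int[P]_w F (Y w, Z w) = \int[distribution P YZ']_y F y)%E.
  by rewrite ge0_integral_pushforward.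
have -> : (\int[distribution P YZ']_y F y =
    \int[(distribution P Y' \x distribution P Z')%E]_y F y)%E.
  apply: eq_measure_integral => A mA _; symmetry.
  exact: product_measure_unique.
rewrite fubini_tonelli1// ge0_integral_pushforward//; last 2 first.
- exact: measurable_fun_fubini_tonelli_F.
- by move=> y _; apply: integral_ge0.
apply: eq_integral => w _ /=; rewrite /fubini_F ge0_integral_pushforward//.
exact: measurableT_comp mF _.
Qed.

End IndependentIntegral.

Lemma integral_measure_preserving {R : realType} {dsp dsp' : measure_display}
    {W : measurableType dsp} {W' : measurableType dsp'} (P : probability W R)
    (P' : probability W' R) (proj : W' -> W) (F : W -> \bar R) :
  measure_preserving P P' proj -> measurable_fun setT F -> (forall y, (0 <= F y)%E) ->
  (\int[P']_w F (proj w) = \int[P]_w F w)%E.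
Proof.
move=> [mproj hproj] mF F0.
rewrite -[LHS](@ge0_integral_pushforward _ _ W' W R proj mproj P' setT F)//.
by apply: eq_measure_integral => A mA _; exact: hproj.
Qed.

Section Beta2.
Context {R : realType} {d n : nat} {dsp dsp' : measure_display}
  {W : measurableType dsp} {W' : measurableType dsp'}
  (P : probability W R) (P' : probability W' R) (proj : W' -> W).
Context (G : set (set W)) (X : 'I_n -> W -> 'cV[R]_d.+1) (V : 'I_n -> W -> 'M[R]_d.+1)
  (Z : 'I_n -> W' -> 'cV[R]_d.+1) (p : \bar R).
Hypothesis (hproj : measure_preserving P P' proj)
  (mX : forall i, measurable_fun setT (X i)) (mV : forall i, measurable_fun setT (V i))
  (aV : forall i, measurable_wrt G (V i))
  (mZ : forall i, measurable_fun setT (Z i))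
  (ind : independent2 P' <<s \bigcup_i sigma_rv (Z i) >> (preimage_set_system setT proj G)).

(** The definition takes a joint expectation on the enlarged space, while the Lindeberg error is an
    iterated integral with V frozen. Independence of Z from the past identifies the two. *)
Lemma beta2E : beta2 P' proj X V Z p =
  (\sum_(i < n) (\int[P]_w (cubic p (X i w))%:E +
    \int[P]_w \int[P']_z (cubic p (psd_sqrt (V i w) *m Z i z))%:E))%E.
Proof.
apply: eq_bigr => i _; rewrite unlock.
have c0 (y : 'cV[R]_d.+1) : (0 <= (cubic p y)%:E)%E by rewrite lee_fin cubic_ge0.
have [mp _] := hproj.
have mVp : measurable_fun setT (V i \o proj) by exact: measurableT_comp (mV i) mp.
have mXp : measurable_fun setT (X i \o proj) by exact: measurableT_comp (mX i) mp.
transitivity (\int[P']_w ((cubic p (X i (proj w)))%:E +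
    (cubic p (psd_sqrt (V i (proj w)) *m Z i w))%:E))%E.
  by apply: eq_integral => w _; rewrite -EFinD /cubic -!lpnorm2_sqr.
have mc : measurable_fun setT (fun y : 'cV[R]_d.+1 => (cubic p y)%:E).
  by apply/measurable_EFinP; exact: (measurable_cubic p (@measurable_id _ _ setT)).
rewrite ge0_integralD//; last 2 first.
- exact: (measurableT_comp mc mXp).
- apply: (measurableT_comp mc); apply: measurable_mulmx => //.
  exact: (measurableT_comp (@measurable_psd_sqrt R d) mVp).
congr (_ + _)%E.
  apply: (integral_measure_preserving (F := fun w => (cubic p (X i w))%:E) hproj) => //.
  exact: (measurableT_comp mc (mX i)).
pose F (vz : 'M[R]_d.+1 * 'cV[R]_d.+1) := (cubic p (psd_sqrt vz.1 *m vz.2))%:E.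
have mF : measurable_fun setT F.
  apply: (measurableT_comp mc); apply: measurable_mulmx => //.
  exact: (measurableT_comp (@measurable_psd_sqrt R d) measurable_fst).
have -> := @integral_independent _ _ _ P' _ _ _ _ (V i \o proj) (Z i) F mVp (mZ i) _ mF _.
- have h := @measurable_gaussian_cubic R d _ W' P' (Z i) (mZ i) p 1 0 ler01 (lexx 0) _ _ (V i) (mV i).
  have h' : measurable_fun setT (fun w => \int[P']_z F (V i w, Z i z))%E.
    congr (measurable_fun setT _): h; apply/funext => w; apply: eq_integral => z _.
    by rewrite mul1r addr0.
  apply: (integral_measure_preserving (F := fun w => \int[P']_z F (V i w, Z i z))%E hproj) => //.
  by move=> w; apply: integral_ge0 => z _; exact: c0.
- move=> A B mA mB; rewrite setIC muleC; apply: ind.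
    by apply: sub_sigma_algebra; exists i => //; exists B => //; rewrite setTI.
  exists (V i @^-1` A); first exact: aV.
  by rewrite setTI.
- by move=> y; exact: c0.
Qed.

End Beta2.

(** * From smoothed values back to probabilities *)

Section Smoothing.
Context {R : realType} {d : nat} {dsp : measure_display} {W : measurableType dsp}
  (P : probability W R) (Z : W -> 'cV[R]_d.+1).
Hypothesis (mZ : measurable_fun setT Z) (gZ : gaussian_vector P 1%:M Z).
Context (p : \bar R).
Hypothesis (p1 : (1 <= p)%E).

(** If |y|_p >= 1 the cubic term is the larger one; otherwise each coordinate is at most 1 in
    absolute value. *)
Lemma dot_le_cubic (y : 'cV[R]_d.+1) : dot y y <= cubic p y + d.+1%:R.
Proof.
rewrite /cubic; have [h|h] := leP 1 (lpnorm p y).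
  by rewrite -[leLHS]addr0 lerD// ler_peMr// dot_ge0.
rewrite -[leLHS]add0r lerD ?mulr_ge0 ?dot_ge0 ?lpnorm_ge0// dotE.
apply: (@le_trans _ _ (\sum_(i < d.+1) (1 : R))); last by rewrite sumr_const card_ord.
apply: ler_sum => i _; rewrite -expr2 -(real_normK (num_real (y i 0))) expr_le1//.
exact: le_trans (lpnorm_coord y i p1) (ltW h).
Qed.

(** The Lipschitz defect 2 eps produces a multiple of eps |y|_2^2, which [dot_le_cubic] divides
    between the cubic coefficient and an additive constant. *)
Lemma trig_taylor_cubic (f : @trig R d.+1) (s b eps : R) U x y : 0 < s -> 0 < b -> 0 <= eps ->
  (forall x y, `|tF f 0 x - tF f 0 y| <= lpnorm p (x - y) / b + 2 * eps) ->
  psdmx U ->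
  `|tF f (U + (s ^+ 2)%:M) (x + y) - tF f (U + (s ^+ 2)%:M) x
    - tD1 f (U + (s ^+ 2)%:M) x y - tD2 f (U + (s ^+ 2)%:M) x (y *m y^T) / 2|
  <= 2 / s ^+ 2 * (b^-1 + 2 * eps) * cubic p y + 2 / s ^+ 2 * (2 * eps) * d.+1%:R.
Proof.
move=> s0 b0 eps0 flip pU.
have h : forall (t : R) z, 0 <= t <= 1 ->
    `|tF f 0 (z + t *: y) - tF f 0 z| <= lpnorm p y / b + 2 * eps.
  move=> t z /andP[t0 t1]; apply: le_trans (flip _ _) _.
  rewrite addrAC subrr add0r lpnormZ// ger0_norm// lerD2r ler_wpM2r ?invr_ge0 ?(ltW b0)//.
  by rewrite ler_piMl// lpnorm_ge0.
have co u : s ^+ 2 * dot u u <= qf (U + (s ^+ 2)%:M) u.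
  by rewrite qfD qf_scalar lerDr psdmx_ge0.
apply: le_trans (tF_taylor mZ gZ x s0 (psdmx_add_scalar s pU) co h) _.
have -> : 2 * (lpnorm p y / b + 2 * eps) * (dot y y / s ^+ 2) =
    2 / s ^+ 2 * (b^-1 * cubic p y + 2 * eps * dot y y).
  by rewrite /cubic; field; rewrite !gt_eqF.
have -> : 2 / s ^+ 2 * (b^-1 + 2 * eps) * cubic p y + 2 / s ^+ 2 * (2 * eps) * d.+1%:R =
    2 / s ^+ 2 * (b^-1 * cubic p y + 2 * eps * (cubic p y + d.+1%:R)) by ring.
rewrite ler_wpM2l ?divr_ge0 ?sqr_ge0// lerD2l ler_wpM2l ?mulr_ge0//.
exact: dot_le_cubic.
Qed.

(** Pointwise g(Y) is at least m minus the indicator of |Y|_p > a, whose mean is the Gaussian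
    tail. *)
Lemma gaussian_mean_ge (Y : W -> 'cV[R]_d.+1) (S : 'M[R]_d.+1) (g : 'cV[R]_d.+1 -> R)
    (m lam a C : R) :
  measurable_fun setT Y -> psdmx S -> gaussian_vector P S Y ->
  (forall j, S j j <= lam ^+ 2) -> 0 < lam -> 0 < a ->
  measurable_fun setT (fun w => g (Y w)) -> (forall y, `|g y| <= C) ->
  (forall y, m - 1 <= g y) -> (forall y, lpnorm p y <= a -> m <= g y) ->
  m - 2 * (lam * phi p d.+1) / a <= \int[P]_w g (Y w).
Proof.
move=> mY pS gY Sl l0 a0 mg gC g1 g2.
pose A := [set w | a < lpnorm p (Y w)].
have mA : measurable A.
  have := measurable_lpnorm p mY => /(_ measurableT `]a, +oo[%classic).
  rewrite setTI => /(_ (measurable_itv _)); congr measurable.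
  by apply/seteqP; split => w /=; rewrite in_itv/= andbT.
have iA : P.-integrable setT (EFin \o (\1_A : W -> R)).
  apply: (@integrable_bounded _ _ _ _ _ 1); first exact: measurable_indic.
  by move=> w; rewrite indicE ger0_norm// lern1 leq_b1.
have PA : \int[P]_w (\1_A w : R) <= 2 * (lam * phi p d.+1) / a.
  have := gaussian_tail mY pS gY Sl p1 (ltn0Sn d) l0 a0.
  rewrite /Rintegral integral_indic// setIT -/A => h.
  by rewrite -lee_fin fineK// fin_num_measure.
apply: (@le_trans _ _ (\int[P]_w (m - \1_A w))).
  rewrite RintegralB//; last exact: finite_measure_integrable_cst.
  by rewrite Rintegral_prob_cst lerD2l lerN2.
apply: le_RintegralT.
- apply: integrable_EFinB => //; exact: finite_measure_integrable_cst.
- exact: (@integrable_bounded _ _ _ _ _ C).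
- move=> w; rewrite indicE; have [wA|wA] := boolP (w \in A); first exact: g1.
  rewrite subr0; apply: g2; move: wA; rewrite notin_setE /A/= => /negP.
  by rewrite -leNgt.
Qed.

Section TrigSmoothing.
Context (f : @trig R d.+1) (M : 'M[R]_d.+1) (lam a : R).
Hypothesis (pM : psdmx M) (Ml : forall j, M j j <= lam ^+ 2) (l0 : 0 < lam) (a0 : 0 < a).

Let Y w := psd_sqrt M *m Z w.
Let mY : measurable_fun setT Y.
Proof. by apply: measurable_mulmx => //; exact: measurable_cst. Qed.

Let gY : gaussian_vector P M Y.
Proof.
have [pB BB _] := psd_sqrtP pM.
by have := gaussian_vector_mulmx (psd_sqrt M) gZ; rewrite mulmx1 pB.1 BB.
Qed.

Let meanE x : tF f M x = \int[P]_w tF f 0 (x + Y w).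
Proof. by rewrite (tF_semigroup mY pM gY) add0r. Qed.

Let mF x : measurable_fun setT (fun w => tF f 0 (x + Y w)).
Proof.
apply: measurable_tF; first exact: measurable_cst.
by apply: measurable_addmx => //; exact: measurable_cst.
Qed.

Lemma tF_smooth_ge x m : (forall y, m - 1 <= tF f 0 y) ->
  (forall y, lpnorm p y <= a -> m <= tF f 0 (x + y)) ->
  m - 2 * (lam * phi p d.+1) / a <= tF f M x.
Proof.
move=> h1 h2; rewrite meanE.
apply: (@gaussian_mean_ge Y M (fun y => tF f 0 (x + y)) m lam a (tnorm f)) => //.
by move=> y; apply: normr_tF; exact: psdmx0.
Qed.

Lemma tF_smooth_le x m : (forall y, tF f 0 y <= m + 1) ->
  (forall y, lpnorm p y <= a -> tF f 0 (x + y) <= m) ->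
  tF f M x <= m + 2 * (lam * phi p d.+1) / a.
Proof.
move=> h1 h2; rewrite meanE -lerN2 opprD.
have iF : P.-integrable setT (EFin \o (fun w => tF f 0 (x + Y w))).
  by apply: (@integrable_bounded _ _ _ _ _ (tnorm f)) => // w; apply: normr_tF; exact: psdmx0.
have -> : - (\int[P]_w tF f 0 (x + Y w)) = \int[P]_w (- tF f 0 (x + Y w)).
  rewrite -mulN1r -RintegralZl//; apply: eq_Rintegral => w _; exact: mulN1r.
apply: (@gaussian_mean_ge Y M (fun y => - tF f 0 (x + y)) (- m) lam a (tnorm f)) => //.
- exact: (measurableT_comp (@oppr_measurable R setT) (mF x)).
- by move=> y; rewrite normrN; apply: normr_tF; exact: psdmx0.
- by move=> y; rewrite -opprD lerN2.
- by move=> y /h2; rewrite lerN2.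
Qed.

Lemma tF_smooth_lb m x : (forall y, m <= tF f 0 y) -> m <= tF f M x.
Proof.
move=> h; rewrite meanE -[leLHS](Rintegral_prob_cst P m); apply: le_RintegralT => //.
  exact: finite_measure_integrable_cst.
by apply: (@integrable_bounded _ _ _ _ _ (tnorm f)) => // w; apply: normr_tF; exact: psdmx0.
Qed.

Lemma tF_smooth_ub m x : (forall y, tF f 0 y <= m) -> tF f M x <= m.
Proof.
move=> h; rewrite meanE -[leRHS](Rintegral_prob_cst P m); apply: le_RintegralT => //.
  by apply: (@integrable_bounded _ _ _ _ _ (tnorm f)) => // w; apply: normr_tF; exact: psdmx0.
exact: finite_measure_integrable_cst.
Qed.

End TrigSmoothing.

End Smoothing.

(** * Smoothing bound with free parameters *)

Section Enlargement.
Context {R : realType} {d : nat} (p : \bar R) (eta : R).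
Hypothesis (p1 : (1 <= p)%E).

(** A point outside keeps a margin e, and a perturbation of l_p-norm at most e / 2 does not exhaust
    it. Closedness makes the enlargement of any set measurable. *)
Lemma closed_enlarge (A : set 'cV[R]_d) : closed (enlarge p eta A).
Proof.
rewrite -[X in closed X]setCK; apply: open_closedC; rewrite openE => x /= nx.
have [e e0 he] : exists2 e : R, 0 < e & forall y, A y -> eta + e <= lpnorm p (x - y).
  apply: contrapT => h; apply: nx; apply/lee_addgt0Pr => e e0.
  have [y [Ay ye]] : exists y, A y /\ lpnorm p (x - y) < eta + e.
    apply: contrapT => h2; apply: h; exists e => // y Ay.
    by rewrite leNgt; apply/negP => ye; apply: h2; exists y.
  apply: (@le_trans _ _ (lpnorm p (x - y))%:E); first by apply: ereal_inf_lbound; exists y.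
  by rewrite -EFinD lee_fin ltW.
pose D : R := 1 + d%:R.
have D0 : 0 < D by rewrite ltr_pwDl.
apply/mx_nbhsP; exists (e / 2 / D); first by rewrite !divr_gt0.
move=> N xN; apply/negP; rewrite -ltNge.
apply: (@lt_le_trans _ _ (eta + e / 2)%:E); first by rewrite lte_fin ltrDl divr_gt0.
apply: le_ereal_inf_tmp => _ [y Ay <-]; rewrite lee_fin.
have h1 := he y Ay.
have h2 : lpnorm p (x - N) <= e / 2.
  have -> : e / 2 = D * (e / 2 / D) by field; rewrite gt_eqF.
  apply: lpnorm_coord_bound => //; first by rewrite !divr_ge0// ltW.
  by move=> i; rewrite !mxE ltW.
have h3 : lpnorm p (x - y) <= lpnorm p (x - N) + lpnorm p (N - y).
  have -> : x - y = (x - N) + (N - y) by rewrite addrA subrK.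
  exact: ler_lpnormD.
by move: h1 h2 h3; lra.
Qed.

Lemma measurable_enlarge (A : set 'cV[R]_d) : measurable (enlarge p eta A).
Proof. by apply: closed_measurable_mx; exact: closed_enlarge. Qed.

Lemma sub_enlarge (A B : set 'cV[R]_d) : A `<=` B -> enlarge p eta A `<=` enlarge p eta B.
Proof.
move=> AB x; apply: le_trans; apply: ereal_inf_le_tmp => _ [y Ay <-]; exists y => //; exact: AB.
Qed.

End Enlargement.

Import HBNNSimple.

(** The integral of a nonnegative function is a supremum over simple functions below it, and t times
    the indicator of B is one of them. In this form the inequality applies to [opnorm2] with no
    study of its measurability. *)
Lemma markov_indic {R : realType} {dsp : measure_display} {W : measurableType dsp}
    (P : probability W R) (f : W -> R) (B : set W) (t : R) : measurable B -> 0 <= t ->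
  (forall w, 0 <= f w) -> (forall w, B w -> t <= f w) ->
  (t%:E * P B <= \int[P]_w (f w)%:E)%E.
Proof.
move=> mB t0 f0 fB; rewrite [leRHS]ge0_integralTE; last by move=> w; rewrite lee_fin.
pose h : {nnsfun W >-> R} := scale_nnsfun (indic_nnsfun R mB) t0.
have -> : (t%:E * P B = sintegral P h)%E.
  have := integral_nnsfun P measurableT h; rewrite patch_setT => <-.
  transitivity (\int[P]_w (t%:E * (\1_B w)%:E))%E.
    rewrite ge0_integralZl//; last by apply/measurable_EFinP; exact: measurable_indic.
    by rewrite integral_indic// setIT.
  by apply: eq_integral => w _.
apply: ereal_sup_ubound; exists h => // w; rewrite lee_fin.
have -> : h w = t * \1_B w by [].
have [wB|wB] := boolP (w \in B).
  by rewrite indicE wB mulr1; apply: fB; rewrite -inE.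
by rewrite indicE (negbTE wB) mulr0.
Qed.

Lemma measurable_forall {dsp : measure_display} {W : measurableType dsp} (I : finType)
    (Q : I -> set W) : (forall i, measurable (Q i)) -> measurable [set w | forall i, Q i w].
Proof.
move=> mQ; have -> : [set w | forall i, Q i w] = \bigcap_(i in [set: I]) Q i.
  by apply/seteqP; split => w h i //; exact: h.
by apply: fin_bigcap_measurable => //; exact: finite_finset.
Qed.

Definition box {R : realType} {d : nat} (L : R) : set 'cV[R]_d :=
  [set x | forall j, `|x j 0| <= L].

Lemma measurable_box {R : realType} {d : nat} (L : R) : measurable (@box R d L).
Proof.
apply: measurable_forall => j.
have := @measurable_coord R d 1 j 0 measurableT `[- L, L]%classic (measurable_itv _).
by rewrite setTI; congr measurable; apply/seteqP; split => x /=; rewrite in_itv/= ler_norml.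
Qed.

Lemma measurable_set_pre {dsp dsp' : measure_display} {W : measurableType dsp}
    {T : measurableType dsp'} (f : W -> T) (A : set T) :
  measurable_fun setT f -> measurable A -> measurable (f @^-1` A).
Proof. by move=> mf mA; rewrite -[X in measurable X]setTI; exact: mf. Qed.

Lemma box_tail {R : realType} {d : nat} {dsp : measure_display} {W : measurableType dsp}
    (P : probability W R) (Y : W -> 'cV[R]_d) (eps : R) : measurable_fun setT Y -> 0 < eps ->
  exists L0, forall L, L0 <= L -> fine (P (Y @^-1` ~` box L)) <= eps.
Proof.
move=> mY eps0; pose B k := Y @^-1` ~` box k%:R.
have mB k : measurable (B k).
  by apply: measurable_set_pre => //; apply: measurableC; exact: measurable_box.
have cB : P (B k) @[k --> \oo] --> P (\bigcap_k B k).
  apply: nonincreasing_cvg_mu => //.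
  - by rewrite ltey_eq fin_num_measure.
  - exact: bigcapT_measurable.
  - move=> m k mk; apply/subsetPset => w /= nw h; apply: nw => j.
    by apply: le_trans (h j) _; rewrite ler_nat.
have B0 : \bigcap_k B k = set0.
  apply/seteqP; split => // w /= h.
  have /= := h (Num.truncn (\sum_j `|Y w j 0|)).+1 Logic.I; apply => j.
  apply: le_trans (ltW (truncnS_gt _)).
  by rewrite (bigD1 j)//= lerDl sumr_ge0.
rewrite B0 measure0 in cB.
have cB' : fine (P (B k)) @[k --> \oo] --> (0 : R) by exact: (fine_cvg cB).
have /cvgrPdist_lt/(_ _ eps0)[N _ hN] := cB'.
exists N%:R => L NL; apply: le_trans (ltW (hN N (leqnn N))).
rewrite sub0r normrN ger0_norm ?fine_ge0//.
apply: fine_le; rewrite ?fin_num_measure//.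
  by apply: measurable_set_pre => //; apply: measurableC; exact: measurable_box.
apply: le_measure; rewrite ?inE//.
  by apply: measurable_set_pre => //; apply: measurableC; exact: measurable_box.
by move=> w /= nw h; apply: nw => j; apply: le_trans (h j) NL.
Qed.

Section Sides.
Context {R : realType} {d : nat} {dsp : measure_display} {W : measurableType dsp}
  (P : probability W R) (Z : W -> 'cV[R]_d.+1).
Hypothesis (mZ : measurable_fun setT Z) (gZ : gaussian_vector P 1%:M Z).
Context (p : \bar R) (f : @trig R d.+1) (eps : R) (A : set 'cV[R]_d.+1).
Hypothesis (p1 : (1 <= p)%E) (fb : forall x, - eps <= tF f 0 x <= 1 + eps).

Let fb1 x : - eps <= tF f 0 x. Proof. by have /andP[] := fb x. Qed.
Let fb2 x : tF f 0 x <= 1 + eps. Proof. by have /andP[] := fb x. Qed.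

Let Rintegral_indicT dsp1 (W1 : measurableType dsp1) (P1 : probability W1 R) (B : set W1) :
  measurable B -> P1.-integrable setT (EFin \o (\1_B : W1 -> R)) /\
  \int[P1]_w (\1_B w : R) = fine (P1 B).
Proof.
move=> mB; split; last by rewrite /Rintegral integral_indic// setIT.
apply: (@integrable_bounded _ _ _ _ _ 1); first exact: measurable_indic.
by move=> w; rewrite indicE ger0_norm// lern1 leq_b1.
Qed.

(** By [tF_semigroup] the left side is the mean over T of f smoothed with covariance (nu^2 + s^2) I,
    whose standard deviation is at most s + nu. The losses come from T in the enlargement, T outside
    the box, and a noise larger than c. *)
Lemma gaussian_side (T : W -> 'cV[R]_d.+1) (Sigma : 'M[R]_d.+1) (s nu c eta L : R) :
  measurable_fun setT T -> psdmx Sigma -> gaussian_vector P Sigma T ->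
  0 < s -> 0 < nu -> 0 < c ->
  (forall x y, box L x -> lpnorm p y <= c -> ~ enlarge p eta A x -> tF f 0 (x + y) <= eps) ->
  tF f (Sigma + (nu ^+ 2)%:M + (s ^+ 2)%:M) 0 <=
    eps + 2 * ((s + nu) * phi p d.+1) / c +
    fine (P (T @^-1` enlarge p eta A)) + fine (P (T @^-1` ~` box L)).
Proof.
move=> mT pS gT s0 nu0 c0 fE.
pose M : 'M[R]_d.+1 := (nu ^+ 2 + s ^+ 2)%:M.
have pM : psdmx M by apply: psdmx_scalar; rewrite addr_ge0 ?sqr_ge0.
have -> : Sigma + (nu ^+ 2)%:M + (s ^+ 2)%:M = M + Sigma.
  by rewrite -addrA -raddfD addrC.
set q := 2 * _ / c.
have f0 := phi_gt0 p1 (ltn0Sn d).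
have q0 : 0 <= q by rewrite divr_ge0 ?mulr_ge0 ?addr_ge0 ?ltW.
rewrite -(tF_semigroup mT pS gT).
have mE : measurable (T @^-1` enlarge p eta A).
  by apply: measurable_set_pre => //; exact: measurable_enlarge.
have mB : measurable (T @^-1` ~` box L).
  by apply: measurable_set_pre => //; apply: measurableC; exact: measurable_box.
have [iE <-] := Rintegral_indicT P mE; have [iB <-] := Rintegral_indicT P mB.
have ic : P.-integrable setT (EFin \o (fun=> eps + q)) by exact: finite_measure_integrable_cst.
rewrite -[X in X + _ + _](Rintegral_prob_cst P) -RintegralD// -RintegralD//; last first.
  exact: integrable_EFinD.
apply: le_RintegralT; first exact: integrable_tF.
  by apply: integrable_EFinD => //; exact: integrable_EFinD.
move=> w; rewrite add0r.
have ub1 : tF f M (T w) <= 1 + eps by exact: (tF_smooth_ub mZ gZ pM).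
have i0 (B : set W) : 0 <= \1_B w :> R by rewrite indicE.
have iE0 := i0 (T @^-1` enlarge p eta A); have iB0 := i0 (T @^-1` ~` box L).
have [wE|wE] := pselect (enlarge p eta A (T w)).
  have e1 : \1_(T @^-1` enlarge p eta A) w = 1 :> R by rewrite indicE mem_set.
  by rewrite e1; move: ub1 q0 iB0; lra.
have [wB|wB] := pselect (box L (T w)); last first.
  have e1 : \1_(T @^-1` ~` box L) w = 1 :> R by rewrite indicE mem_set.
  by rewrite e1; move: ub1 q0 iE0; lra.
have h : tF f M (T w) <= eps + q.
  apply: (tF_smooth_le mZ gZ p1 pM) => //.
  - by move=> j; rewrite mxE eqxx mulr1n; have := mulr_gt0 s0 nu0; nra.
  - by rewrite addr_gt0.
  - by move=> y; rewrite addrC.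
  - by move=> y yc; exact: fE.
by move: h iE0 iB0; lra.
Qed.

(** On B the point lies in A and the remaining covariance has diagonal at most lam^2, so the
    smoothed value is at least 1 - eps - q; elsewhere it is at least - eps. *)
Lemma sum_side {dsp1} {W1 : measurableType dsp1} (P1 : probability W1 R)
    (x : W1 -> 'cV[R]_d.+1) (M : W1 -> 'M[R]_d.+1) (B : set W1) (lam a : R) :
  measurable_fun setT x -> measurable_fun setT M -> (forall w, psdmx (M w)) ->
  measurable B -> (forall w, B w -> A (x w)) ->
  (forall w, B w -> forall j, M w j j <= lam ^+ 2) -> 0 < lam -> 0 < a ->
  (forall x y, A x -> lpnorm p y <= a -> 1 - eps <= tF f 0 (x + y)) ->
  fine (P1 B) <= \int[P1]_w tF f (M w) (x w) + (eps + 2 * (lam * phi p d.+1) / a).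
Proof.
move=> mx mM pM mB BA Bl l0 a0 fE; set q := 2 * _ / a.
have f0 := phi_gt0 p1 (ltn0Sn d).
have q0 : 0 <= q by rewrite divr_ge0 ?mulr_ge0 ?ltW.
have [iB <-] := Rintegral_indicT P1 mB.
have iF : P1.-integrable setT (EFin \o (fun w => tF f (M w) (x w))).
  apply: (@integrable_bounded _ _ _ _ _ (tnorm f)); first exact: measurable_tF.
  by move=> w; exact: normr_tF.
have ic : P1.-integrable setT (EFin \o (fun=> eps + q)) by exact: finite_measure_integrable_cst.
rewrite -[X in _ <= _ + X](Rintegral_prob_cst P1) -RintegralD//.
apply: le_RintegralT => //; first exact: integrable_EFinD.
move=> w.
have lb1 : - eps <= tF f (M w) (x w) by exact: (tF_smooth_lb mZ gZ (pM w)).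
rewrite indicE; have [wB|wB] := boolP (w \in B); last by rewrite mulr0n; move: lb1 q0; lra.
rewrite inE in wB.
have h : 1 - eps - q <= tF f (M w) (x w).
  apply: (tF_smooth_ge mZ gZ p1 (pM w) (Bl w wB)) => //.
  - by move=> y; rewrite addrAC subrr add0r.
  - by move=> y ya; apply: fE => //; exact: BA.
by rewrite mulr1n; move: h; lra.
Qed.

End Sides.

Section GoodEvent.
Context {R : realType} {d n : nat} {dsp : measure_display} {W : measurableType dsp}
  (P : probability W R) (V : 'I_n -> W -> 'M[R]_d) (Sigma : 'M[R]_d) (nu Wt : R).
Hypothesis (mV : forall i, measurable_fun setT (V i))
  (pV : forall i, {ae P, forall w, psdmx (V i w)}) (pS : psdmx Sigma) (nu0 : 0 < nu)
  (EW : ('E_P[fun w => opnorm2 (OmegaV V Sigma w)] = Wt%:E)%E).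

(** What the telescoping takes from |Omega|_2 <= nu^2: no summand is discarded, and the leftover
    Sigma + nu^2 I - sum V has diagonal at most 2 nu^2. Phrased this way the event is visibly
    measurable. *)
Definition good_event : set W := [set w | [/\ forall i, psdmx (V i w),
  psdmx (Sigma + (nu ^+ 2)%:M - \sum_i V i w) &
  forall j, (Sigma - \sum_i V i w) j j <= nu ^+ 2]].

Let mSV : measurable_fun setT (fun w => \sum_i V i w).
Proof. exact: measurable_summx. Qed.

Let mallV : measurable [set w | forall i, psdmx (V i w)].
Proof.
apply: (measurable_forall (Q := fun i => V i @^-1` [set M | psdmx M])) => i.
by apply: measurable_set_pre => //; exact: measurable_psdmx.
Qed.

Lemma measurable_good_event : measurable good_event.
Proof.
have m2 : measurable ((fun w => Sigma + (nu ^+ 2)%:M - \sum_i V i w) @^-1` [set M | psdmx M]).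
  apply: measurable_set_pre; last exact: measurable_psdmx.
  by apply: measurable_addmx; [exact: measurable_cst|exact: measurable_oppmx].
have m3 : measurable [set w | forall j, (Sigma - \sum_i V i w) j j <= nu ^+ 2].
  apply: (measurable_forall (Q := fun j => (fun w => (Sigma - \sum_i V i w) j j) @^-1`
    `]-oo, nu ^+ 2]%classic)) => j; apply: measurable_set_pre => //.
  apply: measurable_entry; apply: measurable_addmx; first exact: measurable_cst.
  exact: measurable_oppmx.
have -> : good_event = [set w | forall i, psdmx (V i w)] `&`
    ((fun w => Sigma + (nu ^+ 2)%:M - \sum_i V i w) @^-1` [set M | psdmx M] `&`
     [set w | forall j, (Sigma - \sum_i V i w) j j <= nu ^+ 2]).
  by apply/seteqP; split => w /=; [case|case=> ? []].
by apply: measurableI => //; exact: measurableI.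
Qed.

Lemma opnorm2_ge0 (M : 'M[R]_d) : 0 <= opnorm2 M.
Proof.
rewrite /opnorm2; set E := [set _ | _ in _].
have l0 : lpnorm 2%:E (0 : 'cV[R]_d) = 0 by apply: lpnorm0; rewrite lee_fin ler1n.
have E0 : E 0 by exists 0; [rewrite /mkset l0|rewrite mulmx0].
have [hE|hE] := pselect (has_ubound E); first by apply: ub_le_sup.
by rewrite sup_out// => -[].
Qed.

(** The bound |qf Omega u| <= nu^2 |u|^2 makes nu^2 I - Omega semi-definite and, at basis vectors,
    bounds its diagonal. *)
Lemma good_event_of_opnorm2 w : (forall i, psdmx (V i w)) ->
  opnorm2 (OmegaV V Sigma w) <= nu ^+ 2 -> good_event w.
Proof.
move=> pVw; set Om := OmegaV V Sigma w => h.
have q u : `|qf Om u| <= nu ^+ 2 * dot u u.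
  by rewrite (le_trans (normr_qf_opnorm2 _ _))// ler_wpM2r// dot_ge0.
have e : Sigma - \sum_i V i w = - Om by rewrite /Om /OmegaV opprB.
split => //.
- have sV : (\sum_i V i w)^T = \sum_i V i w.
    by rewrite raddf_sum; apply: eq_bigr => i _; case: (pVw i).
  apply: psdmxP; first by rewrite !linearD/= linearN/= sV pS.1 tr_scalar_mx.
  move=> u; rewrite addrAC e qfD qfN qf_scalar.
  by have := q u; rewrite ler_norml; lra.
- move=> j; rewrite e -qf_delta qfN.
  have := q (delta_mx j 0); rewrite dot_delta mxE !eqxx mulr1 ler_norml; lra.
Qed.

(** Up to the null set where some V is not semi-definite, leaving the good event forces |Omega|_2
    above nu^2, and Markov applies. *)
Lemma good_event_prob : fine (P (~` good_event)) <= Wt / nu ^+ 2.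
Proof.
have mG := measurable_good_event.
pose A := [set w | forall i, psdmx (V i w)].
have PA : P (~` A) = 0%E.
  have [N [mN PN hN]] : {ae P, forall w, forall i, psdmx (V i w)} by exact: ae_forall_count.
  apply/eqP; rewrite eq_le measure_ge0 andbT -PN; apply: le_measure; rewrite ?inE//.
  exact: measurableC.
have le1 : (P (~` good_event) <= P (A `&` ~` good_event))%E.
  apply: (@le_trans _ _ (P (~` A `|` A `&` ~` good_event))%E).
    apply: le_measure; rewrite ?inE//; first exact: measurableC.
      apply: measurableU; first exact: measurableC.
      by apply: measurableI => //; exact: measurableC.
    by move=> w ng; have [wA|wA] := pselect (A w); [right|left].
  rewrite -[leRHS]add0e -PA; apply: measureU2; first exact: measurableC.
  by apply: measurableI => //; exact: measurableC.
have mB : measurable (A `&` ~` good_event) by apply: measurableI => //; exact: measurableC.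
have := markov_indic P mB (sqr_ge0 nu) (fun w => opnorm2_ge0 (OmegaV V Sigma w)).
move: EW; rewrite unlock => -> h.
have {}h : (((nu ^+ 2)%:E * P (A `&` ~` good_event))%E <= Wt%:E)%E.
  apply: h => w [wA ng]; rewrite leNgt; apply/negP => /ltW hw; apply: ng.
  exact: good_event_of_opnorm2.
rewrite ler_pdivlMr ?exprn_gt0// -lee_fin; apply: le_trans h.
rewrite EFinM fineK ?fin_num_measure//; last exact: measurableC.
by rewrite muleC lee_pmul2l// ?lte_fin ?exprn_gt0// .
Qed.

End GoodEvent.

Lemma le_prob3 {R : realType} {dsp : measure_display} {W : measurableType dsp}
    (P : probability W R) (C B1 B2 B3 : set W) :
  measurable C -> measurable B1 -> measurable B2 -> measurable B3 ->
  C `<=` B1 `|` B2 `|` B3 -> fine (P C) <= fine (P B1) + fine (P B2) + fine (P B3).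
Proof.
move=> mC m1 m2 m3 sub; have mU := measurableU _ _ m1 m2.
rewrite -lee_fin !EFinD !fineK ?fin_num_measure//.
apply: (@le_trans _ _ (P (B1 `|` B2 `|` B3))).
  by apply: le_measure; rewrite ?inE//; exact: measurableU.
apply: le_trans (measureU2 _ _ _) _ => //; apply: leeD2r; exact: measureU2.
Qed.

Lemma le_prob {R : realType} {dsp : measure_display} {W : measurableType dsp}
    (P : probability W R) (C B : set W) :
  measurable C -> measurable B -> C `<=` B -> fine (P C) <= fine (P B).
Proof.
by move=> mC mB sub; apply: fine_le; rewrite ?fin_num_measure//; apply: le_measure; rewrite ?inE.
Qed.

Section LindebergError.
Context {R : realType} {d : nat} {dsp' : measure_display} {W' : measurableType dsp'}
  (P' : probability W' R) (Z : nat -> W' -> 'cV[R]_d.+1).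
Context {dsp : measure_display} {W : measurableType dsp} (P : probability W R).
Context (X : nat -> W -> 'cV[R]_d.+1) (V : nat -> W -> 'M[R]_d.+1) (p : \bar R) (K K' : R).
Hypothesis (K0 : 0 <= K) (K'0 : 0 <= K').
Hypothesis (mX : forall k, measurable_fun setT (X k)) (mV : forall k, measurable_fun setT (V k))
  (mZ : forall k, measurable_fun setT (Z k)).

Let affine dsp1 (W1 : measurableType dsp1) (P1 : probability W1 R) (g : W1 -> \bar R) :
  measurable_fun setT g -> (forall w, 0 <= g w)%E ->
  (\int[P1]_w (K%:E * g w + K'%:E) = K%:E * \int[P1]_w g w + K'%:E)%E.
Proof.
move=> mg g0; rewrite ge0_integralD//; last 2 first.
- by move=> w _; rewrite mule_ge0// lee_fin.
- exact: measurable_funeM.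
rewrite ge0_integralZl ?lee_fin//; congr (_ + _)%E.
by rewrite integral_cst// [X in (_ * X)%E]probability_setT mule1.
Qed.

Lemma lindeberg_errorE k : lindeberg_error P' Z P X V p K K' k =
  (K%:E * (\int[P]_w (cubic p (X k w))%:E +
    \int[P]_w \int[P']_z (cubic p (psd_sqrt (V k w) *m Z k z))%:E) + (2 * K')%:E)%E.
Proof.
have mc : measurable_fun setT (fun y : 'cV[R]_d.+1 => (cubic p y)%:E).
  by apply/measurable_EFinP; exact: (measurable_cubic p (@measurable_id _ _ setT)).
have c0 (y : 'cV[R]_d.+1) : (0 <= (cubic p y)%:E)%E by rewrite lee_fin cubic_ge0.
rewrite /lindeberg_error.
under eq_integral do rewrite EFinD EFinM.
rewrite (affine P (measurableT_comp mc (mX k))); last by move=> w; exact: c0.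
have mg : measurable_fun setT
    (fun w => \int[P']_z (cubic p (psd_sqrt (V k w) *m Z k z))%:E)%E.
  have h := measurable_gaussian_cubic P' (mZ k) p ler01 (lexx 0) (mV k).
  congr (measurable_fun setT _): h; apply/funext => w; apply: eq_integral => z _.
  by rewrite mul1r addr0.
have -> : (\int[P]_w \int[P']_z (K * cubic p (psd_sqrt (V k w) *m Z k z) + K')%:E =
    \int[P]_w (K%:E * \int[P']_z (cubic p (psd_sqrt (V k w) *m Z k z))%:E + K'%:E))%E.
  apply: eq_integral => w _; rewrite -(affine P')//.
  apply: (measurableT_comp mc); apply: measurable_mulmx => //; exact: measurable_cst.
rewrite (affine P mg); last by move=> w; apply: integral_ge0.
rewrite [in RHS]ge0_muleDr; last 2 first.
- by apply: integral_ge0 => w _; exact: c0.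
- by apply: integral_ge0 => w _; apply: integral_ge0 => z _; exact: c0.
by rewrite addeACA -EFinD -mulr2n mulr_natl.
Qed.

End LindebergError.

Section ParametricBound.
Context {R : realType} {n d : nat} {dsp : measure_display} {Omega : measurableType dsp}
  (P : probability Omega R) (H : nat -> set (set Omega)) (hH : filtration n.+1 H)
  (X : 'I_n.+1 -> {RV P >-> 'cV[R]_d.+1})
  (hX2 : forall i, ('E_P[fun w => (lpnorm 2%:E (X i w) ^+ 2)%R] < +oo)%E)
  (hXadapted : forall i : 'I_n.+1, measurable_wrt (H i.+1) (X i))
  (hXmart : forall i : 'I_n.+1, is_cond_exp P (H i) (X i) (fun=> 0))
  (Sigma : 'M[R]_d.+1) (hSigma : psdmx Sigma)
  (V : 'I_n.+1 -> Omega -> 'M[R]_d.+1)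
  (hV : forall i : 'I_n.+1, is_cond_cov P (H i) (X i) (V i))
  {dsp' : measure_display} {Omega' : measurableType dsp'}
  (P' : probability Omega' R) (proj : Omega' -> Omega) (hproj : measure_preserving P P' proj)
  (Z : 'I_n.+1 -> {RV P' >-> 'cV[R]_d.+1})
  (hZ : iid_std_gaussian_indep P' Z (preimage_set_system setT proj (H n.+1)))
  (T : {RV P' >-> 'cV[R]_d.+1}) (hT : gaussian_vector P' Sigma T).
Context (p : \bar R) (p1 : (1 <= p)%E) (B Wt : R)
  (hB : (beta2 P' proj X V Z p = B%:E)%E)
  (hW : ('E_P[fun w => opnorm2 (OmegaV V Sigma w)] = Wt%:E)%E).

Let S w := \sum_(i < n.+1) X i w.

Let mX i : measurable_fun setT (X i). Proof. by []. Qed.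
Let mZ i : measurable_fun setT (Z i). Proof. by []. Qed.
Let mT : measurable_fun setT T. Proof. by []. Qed.
Let mS : measurable_fun setT S. Proof. exact: measurable_summx. Qed.

Let sH k : (k <= n.+1)%N -> sigma_algebra setT (H k).
Proof. by move=> kn; have [/(_ _ kn)[]] := hH. Qed.
Let HM k : (k <= n.+1)%N -> H k `<=` measurable.
Proof. by move=> kn; have [/(_ _ kn)[]] := hH. Qed.
Let HS k : (k < n.+1)%N -> H k `<=` H k.+1.
Proof. by have [_] := hH; apply. Qed.

Let HSn k : (k <= n.+1)%N -> H k `<=` H n.+1.
Proof.
move=> kn; rewrite -(subnK kn); move: (n.+1 - k)%N (subnK kn) => m.
elim: m k kn => [|m IH] k kn e; first by rewrite add0n.
have kn1 : (k.+1 <= n.+1)%N by rewrite -e addSn ltnS leq_addl.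
apply: subset_trans (HS kn1) _.
by have := IH k.+1 kn1; rewrite addnS => /(_ e).
Qed.

Let ile (i : 'I_n.+1) : (i <= n.+1)%N. Proof. exact: ltnW. Qed.

Let aV (i : 'I_n.+1) : measurable_wrt (H i) (V i).
Proof.
apply/(measurable_wrtP (sH (ile i))).
exact: (cond_cov_measurable (sH (ile i)) (HM (ile i)) (mX i) (hX2 i) (hXmart i) (hV i)).
Qed.

Let mV i : measurable_fun setT (V i).
Proof.
by apply: (measurable_fun_sub (sH (ile i)) (HM (ile i))); apply/(measurable_wrtP (sH (ile i))).
Qed.

Let pV i : {ae P, forall w, psdmx (V i w)}.
Proof. exact: (cond_cov_psd (sH (ile i)) (HM (ile i)) (mX i) (hX2 i) (hXmart i) (hV i)). Qed.

Let betaE : (\sum_(i < n.+1) (\int[P]_w (cubic p (X i w))%:E +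
    \int[P]_w \int[P']_z (cubic p (psd_sqrt (V i w) *m Z i z))%:E) = B%:E)%E.
Proof.
rewrite -hB; have [_ _ ind] := hZ; rewrite (beta2E (G := H n.+1) (P := P))//.
by move=> i A mA; apply: (HSn (ile i)); exact: aV.
Qed.

Let Xn k := X (inord k).
Let Vn k := V (inord k).
Let Zn k := Z (inord k).

Let gaussian_Zn k : gaussian_vector P' 1%:M (Zn k).
Proof. by have [h _ _] := hZ; exact: h. Qed.

Let inordn k : (k < n.+1)%N -> (inord k : 'I_n.+1) = k :> nat.
Proof. exact: inordK. Qed.

(** Families indexed by ordinals become sequences through [inord]. Each step costs K' twice, for the
    shift by X and for the Gaussian shift. *)
Lemma telescoped_bound (f : @trig R d.+1) (U0 : 'M[R]_d.+1) (s K K' : R) :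
  0 <= K -> 0 <= K' -> psdmx U0 ->
  (forall U x y, psdmx U ->
    `|tF f (U + (s ^+ 2)%:M) (x + y) - tF f (U + (s ^+ 2)%:M) x
      - tD1 f (U + (s ^+ 2)%:M) x y - tD2 f (U + (s ^+ 2)%:M) x (y *m y^T) / 2|
    <= K * cubic p y + K') ->
  \int[P]_w tF f (budget Vn U0 n.+1 w + (s ^+ 2)%:M) (truncated_sum Xn Vn U0 n.+1 w) <=
  tF f (U0 + (s ^+ 2)%:M) 0 + (K * B + n.+1%:R * (2 * K')).
Proof.
move=> K0 K'0 pU taylor.
have cv k := cond_cov_coord (sH (ile (inord k))) (HM (ile (inord k))) (mX (inord k))
  (hX2 (inord k)) (hXmart (inord k)) (hV (inord k)).
have := @lindeberg_sum R d _ _ P' Zn _ _ P n.+1 H Xn Vn U0 (fun k => mZ (inord k)) gaussian_Zn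
  p f s K K' p1 K0 K'0 taylor sH HM HS pU.
move=> /(_ _ _ _ _ _ _ _ n.+1 (leqnn _)) h.
rewrite -lee_fin EFinD; apply: le_trans (h _ _ _ _ _ _ _) _.
- by move=> k kn; have := hXadapted (inord k); rewrite inordn.
- by move=> k kn; have := aV (inord k); rewrite inordn.
- by move=> k; exact: mX.
- by move=> k i kn; have [] := martingale_coord (hXmart (inord k)) i.
- move=> k i A kn HA; have [_] := martingale_coord (hXmart (inord k)) i.
  by apply; rewrite inordn.
- by move=> k i j kn; have [_ iV iXX _] := cv k i j; exact: integrable_EFinB.
- by move=> k i j A kn HA; have [_ _ _] := cv k i j; apply; rewrite inordn.
apply: leeD2l; rewrite le_eqVlt; apply/orP; left; apply/eqP.
under eq_bigr => i _ do rewrite (lindeberg_errorE _ _ _ K0 K'0 (fun k => mX (inord k))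
  (fun k => mV (inord k)) (fun k => mZ (inord k))) /Xn /Vn /Zn inord_val.
rewrite big_split/= -ge0_sume_distrr; last first.
  move=> i _; rewrite adde_ge0//; first by apply: integral_ge0 => w _; rewrite lee_fin cubic_ge0.
  by apply: integral_ge0 => w _; apply: integral_ge0 => z _; rewrite lee_fin cubic_ge0.
by rewrite betaE sumEFin sumr_const card_ord -EFinM -EFinD -(mulr_natl (2 * K')).
Qed.

(** The three thirds of eta go to the noise at the S end, the slope of f and the noise at the T end.
    At the S end the leftover variances are at most 2 nu^2 + s^2 <= (s + 3/2 nu)^2. The term 4 eps
    collects one eps from each end of the comparison and one from each box tail. *)
Lemma parametric_bound (A : set 'cV[R]_d.+1) (s nu eps eta : R) : measurable A ->
  0 < s -> 0 < nu -> 0 < eps -> 0 < eta ->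
  fine (P (S @^-1` A)) <= fine (P' (T @^-1` enlarge p eta A)) +
    (Wt / nu ^+ 2 + 2 * ((s + 3 / 2 * nu) * phi p d.+1) / (eta / 3) +
     2 * ((s + nu) * phi p d.+1) / (eta / 3) +
     2 / s ^+ 2 * ((eta / 3)^-1 + 2 * eps) * B +
     n.+1%:R * (2 * (2 / s ^+ 2 * (2 * eps) * d.+1%:R)) + 4 * eps).
Proof.
move=> mA s0 nu0 eps0 eta0.
have f0 := phi_gt0 p1 (ltn0Sn d).
have [L1 hL1] := box_tail P mS eps0; have [L2 hL2] := box_tail P' mT eps0.
(* The period is 4 Lq; the lower bound eta / 2 ensures that the three margins, eta in total, fit
   into half a period. *)
pose Lq := Num.max (Num.max L1 L2) (eta / 2).
have /hL1 tS : L1 <= Lq by rewrite !le_max lexx.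
have /hL2 tT : L2 <= Lq by rewrite !le_max lexx orbT.
have Le : eta / 2 <= Lq by rewrite le_max lexx orbT.
clearbody Lq.
have L4 : Lq = 4 * Lq / 4 by field.
pose AK := A `&` box Lq.
have mG := measurable_good_event Sigma nu mV.
have PG := good_event_prob mV pV hSigma nu0 hW.
have mbS : measurable (S @^-1` ~` box Lq).
  by apply: measurable_set_pre => //; apply: measurableC; exact: measurable_box.
have mSA : measurable (S @^-1` A) by exact: measurable_set_pre.
have mAK : measurable AK by apply: measurableI => //; exact: measurable_box.
pose Bs := (S @^-1` AK) `&` good_event V Sigma nu.
have mBs : measurable Bs by apply: measurableI => //; exact: measurable_set_pre.
have split3 : fine (P (S @^-1` A)) <=
    fine (P Bs) + fine (P (S @^-1` ~` box Lq)) + fine (P (~` good_event V Sigma nu)).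
  apply: le_prob3 => //; first exact: measurableC.
  move=> w Aw; have [gw|gw] := pselect (good_event V Sigma nu w); last by right.
  have [bw|bw] := pselect (box Lq (S w)); last by left; right.
  by left; left.
have eta30 : 0 < eta / 3 by rewrite divr_gt0.
set q1 := 2 * _ / (eta / 3); set q2 := 2 * _ / (eta / 3).
set K := 2 / s ^+ 2 * ((eta / 3)^-1 + 2 * eps).
set K' := 2 / s ^+ 2 * (2 * eps) * d.+1%:R.
have s20 : 0 <= 2 / s ^+ 2 by rewrite divr_ge0 ?sqr_ge0.
have K0 : 0 <= K.
  apply: mulr_ge0 => //; apply: addr_ge0; first by rewrite invr_ge0 ltW.
  by apply: mulr_ge0 => //; exact: ltW.
have K'0 : 0 <= K'.
  by apply: mulr_ge0 => //; apply: mulr_ge0 => //; apply: mulr_ge0 => //; exact: ltW.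
have q10 : 0 <= q1.
  apply: divr_ge0; last exact: ltW.
  apply: mulr_ge0 => //; apply: mulr_ge0; last exact: ltW.
  by move: s0 nu0; lra.
have q20 : 0 <= q2.
  apply: divr_ge0; last exact: ltW.
  apply: mulr_ge0 => //; apply: mulr_ge0; last exact: ltW.
  by move: s0 nu0; lra.
have B0 : 0 <= B.
  rewrite -lee_fin -betaE; apply: sume_ge0 => i _; rewrite adde_ge0//.
    by apply: integral_ge0 => w _; rewrite lee_fin cubic_ge0.
  by apply: integral_ge0 => w _; apply: integral_ge0 => z _; rewrite lee_fin cubic_ge0.
have KB0 : 0 <= K * B by exact: mulr_ge0.
have nK0 : 0 <= n.+1%:R * (2 * K') by apply: mulr_ge0 => //; exact: mulr_ge0.
have PE0 : 0 <= fine (P' (T @^-1` enlarge p eta A)) by rewrite fine_ge0.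
(* The smoothed indicator requires a nonempty set. If A misses the box, the tail of S and the bad
   event already cover S in A. *)
have [AK0|/set0P AK0] := eqVneq AK set0.
  have B0' : fine (P Bs) = 0 by rewrite /Bs AK0 preimage_set0 set0I measure0.
  by move: split3 tS PG; rewrite B0'; lra.
have [f [flip fge fb fle]] : exists f : @trig R d.+1, [/\
    forall x y, `|tF f 0 x - tF f 0 y| <= lpnorm p (x - y) / (eta / 3) + 2 * eps,
    forall x y, AK x -> lpnorm p y <= eta / 3 -> 1 - eps <= tF f 0 (x + y),
    forall x, - eps <= tF f 0 x <= 1 + eps &
    forall x y, box Lq x -> lpnorm p y <= eta / 3 -> ~ enlarge p eta AK x ->
      tF f 0 (x + y) <= eps].
  have e3 : eta / 3 + eta / 3 + eta / 3 = eta by field.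
  have := @trig_indicator R d.+1 p AK (eta / 3) (eta / 3) (eta / 3) (4 * Lq) eps
    p1 eta30 eta30 (ltW eta30) AK0.
  rewrite e3 -L4; apply => //; first by move=> x [].
  by move: Le; lra.
pose U0 : 'M[R]_d.+1 := Sigma + (nu ^+ 2)%:M.
have pU0 : psdmx U0 by exact: psdmx_add_scalar.
have taylor U x y (pU : psdmx U) :=
  trig_taylor_cubic (mZ (inord 0)) (gaussian_Zn 0) p1 x y s0 eta30 (ltW eps0) flip pU.
have tele := telescoped_bound K0 K'0 pU0 taylor.
have side1 := gaussian_side (mZ (inord 0)) (gaussian_Zn 0) p1 fb mT hSigma hT s0 nu0 eta30 fle.
have encl : fine (P' (T @^-1` enlarge p eta AK)) <= fine (P' (T @^-1` enlarge p eta A)).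
  apply: le_prob; try by apply: measurable_set_pre => //; exact: measurable_enlarge.
  by move=> w; apply: sub_enlarge => x [].
have path w : good_event V Sigma nu w ->
    budget Vn U0 n.+1 w = U0 - \sum_i V i w /\ truncated_sum Xn Vn U0 n.+1 w = S w.
  move=> [g1 g2 g3].
  have eV : \sum_(k < n.+1) Vn k w = \sum_i V i w.
    by apply: eq_bigr => i _; rewrite /Vn inord_val.
  have eX : \sum_(k < n.+1) Xn k w = S w by apply: eq_bigr => i _; rewrite /Xn inord_val.
  have := admissible_path Xn (V := Vn) (U0 := U0) (w := w) (n := n.+1) _ _ (leqnn n.+1).
  rewrite eV eX; apply; last exact: g2.
  by move=> k _; exact: g1.
have [mU mTS] := budget_adapted U0 sH HS
  (fun k kn => ltac:(by have := hXadapted (inord k); rewrite inordn))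
  (fun k kn => ltac:(by have := aV (inord k); rewrite inordn)) (leqnn n.+1) (X := Xn) (V := Vn).
have side2 : fine (P Bs) <= \int[P]_w tF f (budget Vn U0 n.+1 w + (s ^+ 2)%:M)
    (truncated_sum Xn Vn U0 n.+1 w) + (eps + q1).
  have msub dspT (T1 : measurableType dspT) (g : Omega -> T1) :
      measurable_wrt (H n.+1) g -> measurable_fun setT g.
    move=> mg; apply: (measurable_fun_sub (sH (leqnn _)) (HM (leqnn _))).
    exact/(measurable_wrtP (sH (leqnn _))).
  apply: (sum_side (mZ (inord 0)) (gaussian_Zn 0) p1 fb) fge => //.
  - exact: msub.
  - by apply: measurable_addmx; [exact: msub|exact: measurable_cst].
  - by move=> w; apply: psdmx_add_scalar; exact: budget_psd.
  - by move=> w [Aw /path[_ ->]].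
  - move=> w [_ gw] j; have [-> _] := path w gw; have [_ _ /(_ j)] := gw.
    rewrite !mxE eqxx !mulr1n => h.
    by have := mulr_gt0 s0 nu0; have := sqr_ge0 nu; move: h; nra.
  - by rewrite addr_gt0// mulr_gt0.
move: split3 tS PG tele side1 encl side2 tT; rewrite -/q2 -/K -/K' -/U0; lra.
Qed.

End ParametricBound.

(** * Choice of the parameters *)

Lemma cbrt_sqr_bound {R : realType} (x del : R) : 0 <= x -> 0 < del ->
  x ^+ 3 / (x + del) ^+ 2 <= x.
Proof.
move=> x0 d0; rewrite ler_pdivrMr ?exprn_gt0 ?ltr_wpDl// exprS ler_wpM2l//.
by rewrite lerXn2r ?nnegrE// ?addr_ge0 ?lerDl ?(ltW d0).
Qed.

(** With x and y the two cube roots, the terms become 6 x (Taylor), 6 x + 9/2 y and 6 x + 3 y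
    (Gaussian tails) and 4 y (bad event): 18 x + 23/2 y in all, below 24 x + 17 y. *)
Lemma optimized_bound {R : realType} (a b B Wt f eta N D : R) :
  0 <= B -> 0 <= Wt -> 0 < f -> 0 < eta -> 0 <= N -> 0 <= D ->
  (forall s nu eps : R, 0 < s -> 0 < nu -> 0 < eps -> a <= b +
    (Wt / nu ^+ 2 + 2 * ((s + 3 / 2 * nu) * f) / (eta / 3) +
     2 * ((s + nu) * f) / (eta / 3) + 2 / s ^+ 2 * ((eta / 3)^-1 + 2 * eps) * B +
     N * (2 * (2 / s ^+ 2 * (2 * eps) * D)) + 4 * eps)) ->
  a <= b + (24 * (B * (f ^+ 2 / eta ^+ 3)) `^ 3^-1 + 17 * (Wt * (f ^+ 2 / eta ^+ 2)) `^ 3^-1).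
Proof.
move=> B0 W0 f0 eta0 N0 D0 h.
have cube (z : R) : 0 <= z -> (z `^ 3^-1) ^+ 3 = z.
  by move=> z0; rewrite -powR_mulrn ?powR_ge0// -powRrM mulVf ?powRr1.
set x := (B * _) `^ _; set y := (Wt * _) `^ _.
have x0 : 0 <= x by exact: powR_ge0.
have y0 : 0 <= y by exact: powR_ge0.
have xE : x ^+ 3 = B * (f ^+ 2 / eta ^+ 3).
  by rewrite cube// mulr_ge0// divr_ge0 ?exprn_ge0// ltW.
have yE : y ^+ 3 = Wt * (f ^+ 2 / eta ^+ 2).
  by rewrite cube// mulr_ge0// divr_ge0 ?exprn_ge0// ltW.
clearbody x y.
apply/ler_addgt0Pr => e e0.
(* The additions of del to x and y cost 6 + 9/2 + 6 + 3 times del, and the terms in eps cost one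
   more del: 41/2 del, below e. *)
pose del := e / 21; have d0 : 0 < del by rewrite divr_gt0.
have edel : e = 21 * del by rewrite /del; field.
clearbody del.
have xd : 0 < x + del by rewrite ltr_wpDl.
have yd : 0 < y + del by rewrite ltr_wpDl.
(* Adding del keeps s and nu positive when one of the two moments is zero. *)
pose s := eta * (x + del) / f; pose nu := eta * (y + del) / (2 * f).
have s0 : 0 < s by rewrite divr_gt0// mulr_gt0.
have nu0 : 0 < nu by rewrite divr_gt0 ?mulr_gt0.
(* Q collects the coefficients of eps, so that eps = del / Q makes the terms in eps add up to
   del. *)
pose Q := 4 * B / s ^+ 2 + 8 * N * D / s ^+ 2 + 4.
have Q0 : 0 < Q.
  rewrite ltr_wpDl//; apply: addr_ge0; apply: divr_ge0; rewrite ?sqr_ge0//; first exact: mulr_ge0.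
  by apply: mulr_ge0 => //; exact: mulr_ge0.
pose eps := del / Q; have eps0 : 0 < eps by rewrite divr_gt0.
have t1 : Wt / nu ^+ 2 <= 4 * y.
  have -> : Wt / nu ^+ 2 = 4 * (y ^+ 3 / (y + del) ^+ 2).
    by rewrite yE /nu; field; rewrite !gt_eqF.
  by rewrite ler_pM2l//; exact: cbrt_sqr_bound.
have t2 : 2 / s ^+ 2 * (eta / 3)^-1 * B <= 6 * x.
  have -> : 2 / s ^+ 2 * (eta / 3)^-1 * B = 6 * (x ^+ 3 / (x + del) ^+ 2).
    by rewrite xE /s; field; rewrite !gt_eqF.
  by rewrite ler_pM2l//; exact: cbrt_sqr_bound.
have t3 : 2 * ((s + 3 / 2 * nu) * f) / (eta / 3) = 6 * (x + del) + 9 / 2 * (y + del).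
  by rewrite /s /nu; field; rewrite !gt_eqF.
have t4 : 2 * ((s + nu) * f) / (eta / 3) = 6 * (x + del) + 3 * (y + del).
  by rewrite /s /nu; field; rewrite !gt_eqF.
have t5 : 2 / s ^+ 2 * (2 * eps) * B + N * (2 * (2 / s ^+ 2 * (2 * eps) * D)) + 4 * eps = del.
  transitivity (eps * Q); last by rewrite /eps divfK// gt_eqF.
  by rewrite /Q; ring.
have := h s nu eps s0 nu0 eps0.
have -> : 2 / s ^+ 2 * ((eta / 3)^-1 + 2 * eps) * B =
  2 / s ^+ 2 * (eta / 3)^-1 * B + 2 / s ^+ 2 * (2 * eps) * B by rewrite -mulrDl -mulrDr.
rewrite t3 t4 edel => hh.
move: hh t1 t2 t5 x0 y0 d0.
move: (Wt / _) (2 / s ^+ 2 * (eta / 3)^-1 * B) (2 / s ^+ 2 * (2 * eps) * B)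
  (N * _) (4 * eps) => u1 u2 u3 u4 u5; lra.
Qed.

Lemma beta2_ge0 {R : realType} {dsp dsp' : measure_display}
    {Omega : measurableType dsp} {Omega' : measurableType dsp'} {n d : nat}
    (P' : probability Omega' R) (proj : Omega' -> Omega) (X : 'I_n -> Omega -> 'cV[R]_d)
    (V : 'I_n -> Omega -> 'M[R]_d) (Z : 'I_n -> Omega' -> 'cV[R]_d) (p : \bar R) :
  (0 <= beta2 P' proj X V Z p)%E.
Proof.
apply: sume_ge0 => i _; rewrite unlock; apply: integral_ge0 => w _; cbv zeta.
have h (y : 'cV[R]_d) : 0 <= lpnorm 2%:E y ^+ 2 * lpnorm p y.
  by rewrite mulr_ge0 ?sqr_ge0 ?lpnorm_ge0.
rewrite lee_fin; exact: (addr_ge0 (h _) (h _)).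
Qed.

Unset Implicit Arguments.
Set Strict Implicit.

(* X i, V i, Z i (i < n) stand for X_{i+1}, V_{i+1}, Z_{i+1}. *)
Theorem propositionA1 (R : realType) (n d : nat) (hn : (1 <= n)%N) (hd : (1 <= d)%N)
  (dsp : measure_display) (Omega : measurableType dsp) (P : probability Omega R)
  (hP : measure_is_complete P)
  (H : nat -> set (set Omega)) (hH : filtration n H)
  (hHcg : forall i, (i <= n)%N -> countably_generated (H i))
  (X : 'I_n -> {RV P >-> 'cV[R]_d})
  (hX2 : forall i, ('E_P[fun w => (lpnorm 2%:E (X i w) ^+ 2)%R] < +oo)%E)
  (hXadapted : forall i : 'I_n, measurable_wrt (H i.+1) (X i))
  (hXmart : forall i : 'I_n, is_cond_exp P (H i) (X i) (fun=> 0))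
  (Sigma : 'M[R]_d) (hSigma : psdmx Sigma)
  (V : 'I_n -> Omega -> 'M[R]_d)
  (hV : forall i : 'I_n, is_cond_cov P (H i) (X i) (V i))
  (dsp' : measure_display) (Omega' : measurableType dsp')
  (P' : probability Omega' R)
  (proj : Omega' -> Omega) (hproj : measure_preserving P P' proj)
  (Z : 'I_n -> {RV P' >-> 'cV[R]_d})
  (hZ : iid_std_gaussian_indep P' Z (preimage_set_system setT proj (H n)))
  (T : {RV P' >-> 'cV[R]_d}) (hT : gaussian_vector P' Sigma T)
  (calA : set (set 'cV[R]_d)) (hA : calA `<=` measurable) :
  let S := fun w => \sum_(i < n) X i w in
  (ereal_sup [set `| P (S @^-1` A) - P' (T @^-1` A) | | A in calA] <=
   ereal_inf [set ereal_inf [set Gamma P P' proj X V Sigma Z p eta +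
                                 Delta P' T calA p eta
                            | eta in [set eta : R | (0 < eta)%R]]
             | p in [set p : \bar R | 1 <= p]])%E.
Proof.
case: n hn H hH hHcg X hX2 hXadapted hXmart V hV Z hZ => // n _ H hH _ X hX2 aX mtX V hV Z hZ.
case: d hd X hX2 aX mtX Sigma hSigma V hV Z hZ T hT calA hA => // d _ X hX2 aX mtX.
move=> Sigma hSigma V hV Z hZ T hT calA hA; cbv zeta.
set S := (fun w => \sum_(i < n.+1) X i w).
have mS : measurable_fun setT S by exact: measurable_summx.
have mT : measurable_fun setT T by [].
apply: ge_ereal_sup => _ [A cA <-]; have mA := hA _ cA.
apply: le_ereal_inf_tmp => _ [p p1 <-]; apply: le_ereal_inf_tmp => _ [eta eta0 <-].
have {}p1 : (1 <= p)%E := p1; have {}eta0 : 0 < eta := eta0.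
have f0 := phi_gt0 p1 (ltn0Sn d).
set g := Gamma _ _ _ _ _ _ _ _ _; set D := Delta _ _ _ _ _.
have DA : (maxe (P' (T @^-1` (enlarge p eta A `\` A))) (P' (T @^-1` (A `\` shrink p eta A)))
    <= D)%E by apply: ereal_sup_ubound; exists A.
have D1 : (P' (T @^-1` (enlarge p eta A `\` A)) <= D)%E.
  by apply: le_trans DA; rewrite le_max lexx.
have D2 : (P' (T @^-1` (A `\` shrink p eta A)) <= D)%E.
  by apply: le_trans DA; rewrite le_max lexx orbT.
have D0 : (0 <= D)%E by exact: le_trans D1.
have c1 : 0 < phi p d.+1 ^+ 2 / eta ^+ 3 by rewrite divr_gt0 ?exprn_gt0.
have c2 : 0 < phi p d.+1 ^+ 2 / eta ^+ 2 by rewrite divr_gt0 ?exprn_gt0.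
have b0 := beta2_ge0 P' proj X V Z p.
have w0 : (0 <= 'E_P[fun w => opnorm2 (OmegaV V Sigma w)])%E.
  by rewrite unlock; apply: integral_ge0 => w _; rewrite lee_fin; exact: opnorm2_ge0.
have h3 : (3^-1 : R) != 0 by rewrite invr_eq0.
(* An infinite moment makes the right side infinite: its factor is positive, so no product of 0 and
   infinity occurs, and the other terms are nonnegative. *)
have [binf|bfin] := eqVneq (beta2 P' proj X V Z p) +oo%E.
  suff -> : (g + D = +oo)%E by exact: leey.
  rewrite /g /Gamma binf gt0_mulye ?lte_fin// poweRyr// gt0_muley ?lte_fin//.
  rewrite addye; last by rewrite gt_eqF// (lt_le_trans ltNy0)// mule_ge0// poweR_ge0.
  by rewrite addye// gt_eqF// (lt_le_trans ltNy0).
have [winf|wfin] := eqVneq 'E_P[fun w => opnorm2 (OmegaV V Sigma w)]%E +oo%E.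
  suff -> : (g + D = +oo)%E by exact: leey.
  rewrite /g /Gamma winf gt0_mulye ?lte_fin// poweRyr// gt0_muley ?lte_fin//.
  rewrite addey; last by rewrite gt_eqF// (lt_le_trans ltNy0)// mule_ge0// poweR_ge0.
  by rewrite addye// gt_eqF// (lt_le_trans ltNy0).
have [B hB] : exists B, beta2 P' proj X V Z p = B%:E.
  by exists (fine (beta2 P' proj X V Z p)); rewrite fineK// ge0_fin_numE// ltey.
have [Wt hW] : exists Wt, ('E_P[fun w => opnorm2 (OmegaV V Sigma w)] = Wt%:E)%E.
  exists (fine 'E_P[fun w => opnorm2 (OmegaV V Sigma w)]%E).
  by rewrite fineK// ge0_fin_numE// ltey.
pose gr := 24 * (B * (phi p d.+1 ^+ 2 / eta ^+ 3)) `^ 3^-1 +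
  17 * (Wt * (phi p d.+1 ^+ 2 / eta ^+ 2)) `^ 3^-1.
have gE : g = gr%:E by rewrite /g /Gamma hB hW.
have one (C : set 'cV[R]_d.+1) : measurable C ->
    fine (P (S @^-1` C)) <= fine (P' (T @^-1` enlarge p eta C)) + gr.
  move=> mC; apply: (optimized_bound (N := n.+1%:R) (D := d.+1%:R)) => //.
  - by rewrite -lee_fin -hB.
  - by rewrite -lee_fin -hW.
  move=> s nu eps s0 nu0 eps0.
  exact: (parametric_bound hH hX2 aX mtX hSigma hV hproj hZ hT p1 hB hW mC s0 nu0 eps0 eta0).
have mpre C : measurable C -> measurable (T @^-1` C) by exact: measurable_set_pre.
have mE C := measurable_enlarge eta p1 C.
have split2 (C : set 'cV[R]_d.+1) : measurable C -> fine (P' (T @^-1` enlarge p eta C)) <=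
    fine (P' (T @^-1` C)) + fine (P' (T @^-1` (enlarge p eta C `\` C))).
  move=> mC.
  have := @le_prob3 R _ _ P' (T @^-1` enlarge p eta C) (T @^-1` C)
    (T @^-1` (enlarge p eta C `\` C)) set0.
  rewrite measure0 addr0; apply => //; try (by apply: mpre => //; exact: measurableD).
  by move=> w Ew; left; have [Cw|Cw] := pselect (C (T w)); [left|right].
have mSA : measurable (S @^-1` A) by exact: measurable_set_pre.
have up : fine (P (S @^-1` A)) - fine (P' (T @^-1` A)) <=
    gr + fine (P' (T @^-1` (enlarge p eta A `\` A))).
  by have := one A mA; have := split2 A mA; lra.
have down : fine (P' (T @^-1` A)) - fine (P (S @^-1` A)) <=
    gr + fine (P' (T @^-1` (A `\` shrink p eta A))).
  have mA' : measurable (~` A) by exact: measurableC.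
  (* The inner shell of A is the outer shell of its complement, so the one-sided bound applied to
     the complement gives the reverse inequality. *)
  have -> : A `\` shrink p eta A = enlarge p eta (~` A) `\` ~` A.
    by rewrite /shrink !setDE !setCK setIC.
  have cP : fine (P (S @^-1` ~` A)) = 1 - fine (P (S @^-1` A)).
    by rewrite preimage_setC probability_setC// fineB ?fin_num_measure.
  have cT : fine (P' (T @^-1` ~` A)) = 1 - fine (P' (T @^-1` A)).
    by rewrite preimage_setC probability_setC ?fineB ?fin_num_measure//; exact: mpre.
  by have := one _ mA'; have := split2 _ mA'; rewrite cP cT; lra.
have mTA := mpre _ mA.
have -> : (`|P (S @^-1` A) - P' (T @^-1` A)| =
    `|fine (P (S @^-1` A)) - fine (P' (T @^-1` A))|%:E)%E.
  by rewrite -[in LHS](fineK (fin_num_measure P _ mSA)) -[in LHS](fineK (fin_num_measure P' _ mTA)).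
rewrite gE.
have [h|h] := leP 0 (fine (P (S @^-1` A)) - fine (P' (T @^-1` A))).
  rewrite ger0_norm//; apply: le_trans (leeD2l gr%:E D1).
  by rewrite -[X in (_ + X)%E]fineK ?lee_fin// fin_num_measure//; apply: mpre; exact: measurableD.
rewrite ltr0_norm// opprB; apply: le_trans (leeD2l gr%:E D2).
rewrite -[X in (_ + X)%E]fineK ?lee_fin// fin_num_measure//; apply: mpre.
by apply: measurableD => //; apply: measurableC; exact: mE.
Qed.
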